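(* Let $N\ge1$, $R,V>0$, and let $v$, $\nu$, $\mathcal I$ and $\Omega\subseteq\mathbb R^N$ satisfy hypotheses (v), ($\nu$), (I) and ($\Omega$) listed in the context, and let $n$ be the inward normal defined there. Assume that for all $x\in\partial\Omega$ and all $\rho\in L^1(\mathbb R^N;[0,R])$ with $\operatorname{spt}\rho\subseteq\Omega$ $$\big(\nu(x)+(\mathcal I(\rho))(x)\big)\cdot n(x)\ge 0.$$ Then the Cauchy problem $$\partial_t\rho+\operatorname{div}\big(\rho\,v(\rho)\,(\nu(x)+\mathcal I(\rho))\big)=0,\qquad \rho(0,x)=\rho_0(x)$$ is invariant with respect to $\Omega$: for every $\rho_0\in(L^1\cap BV)(\mathbb R^N;[0,R])$ with $\operatorname{spt}\rho_0\subset\Omega$, its weak entropy solution $\rho\in C^0(\mathbb R^+;L^1(\mathbb R^N;[0,R]))$ satisfies $\operatorname{spt}\rho(t)\subset\Omega$ for all $t\ge0$.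
   Context: Notation: $\mathbb R^+=[0,+\infty[$; for $A\subset\mathbb R^N$, $B(A,r)$ is the set of points at distance less than $r$ from $A$. Hypotheses. (v) $v\in C^2(\mathbb R;\mathbb R)$ is non-increasing, $v(0)=V$, $v(R)=0$, for fixed $V,R>0$. ($\nu$) $\nu\in(C^2\cap W^{1,\infty})(\mathbb R^N;\mathbb R^N)$ and $\operatorname{div}\nu\in(W^{1,1}\cap W^{1,\infty})(\mathbb R^N;\mathbb R)$. (I) $\mathcal I\in C^0\big(L^1(\mathbb R^N;[0,R]);C^2(\mathbb R^N;\mathbb R^N)\big)$ satisfies: (I.1) there is an increasing $C_I\in L^\infty_{loc}(\mathbb R^+;\mathbb R^+)$ such that for all $r\in L^1(\mathbb R^N;[0,R])$: $\|\mathcal I(r)\|_{W^{1,\infty}}\le C_I(\|r\|_{L^1})$ and $\|\operatorname{div}\mathcal I(r)\|_{L^1}\le C_I(\|r\|_{L^1})$; (I.2) (with the same function $C_I$) for all $r\in L^1(\mathbb R^N;[0,R])$: $\|\nabla\operatorname{div}\mathcal I(r)\|_{L^1}\le C_I(\|r\|_{L^1})$; (I.3) there is a constant $K_I$ such that for all $r_1,r_2\in L^1(\mathbb R^N;[0,R])$: $\|\mathcal I(r_1)-\mathcal I(r_2)\|_{L^\infty}\le K_I\|r_1-r_2\|_{L^1}$ and $\|\mathcal I(r_1)-\mathcal I(r_2)\|_{L^1}+\|\operatorname{div}(\mathcal I(r_1)-\mathcal I(r_2))\|_{L^1}\le K_I\|r_1-r_2\|_{L^1}$. ($\Omega$) $\Omega\subseteq\mathbb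 R^N$ is the closure of a non-empty connected open set; if $\partial\Omega\neq\emptyset$, there is $r_\Omega>0$ such that $d_{\partial\Omega}(x)=\inf\{d(x,w):w\in\partial\Omega\}$ is of class $C^2$ on $B(\partial\Omega,r_\Omega)\cap\Omega$ (up to the boundary $\partial\Omega$). The inward normal is $n(x)=\nabla d_{\partial\Omega}(x)$ on $B(\partial\Omega,r_\Omega)\cap\Omega$, with $\|n(x)\|=1$. Weak entropy solution. For $T>0$, a function $\rho\in C^0([0,T];L^1(\mathbb R^N;\mathbb R))$ (with values in $[0,R]$, so that $\mathcal I(\rho(t))$ makes sense) is a weak entropy solution on $[0,T]$ if, with $w(t,x)=\nu(x)+(\mathcal I(\rho(t)))(x)$, it is a Kružkov solution of $\partial_t\rho+\operatorname{div}(\rho v(\rho)w(t,x))=0$, $\rho(0,\cdot)=\rho_0$, i.e. for all $k\in\mathbb R$ and all $\varphi\in C_c^\infty(]-\infty,T]\times\mathbb R^N;\mathbb R^+)$, $$\int_0^T\!\!\int_{\mathbb R^N}\Big[|\rho-k|\,\partial_t\varphi+\big[(\rho v(\rho)-k v(k))\,w\cdot\nabla\varphi-k v(k)\operatorname{div}w\,\varphi\big]\operatorname{sgn}(\rho-k)\Big]dx\,dt+\int_{\mathbb R^N}|\rho_0(x)-k|\,\varphi(0,x)\,dx\ge 0.$$ A function defined on $\mathbb R^+$ is a weak entropy solution if its restriction to $[0,T]$ is one for every $T>0$. Under (v), ($\nu$), (I), for every $\rho_0\in(L^1\cap BV)(\mathbb R^N;[0,R])$ there is a unique weak entropy solution in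 $C^0(\mathbb R^+;L^1(\mathbb R^N;[0,R]))$. *)

(* Defs.v *)
(* The norm [`|x|] of the library on ['rV[R]_N] is the sup norm: it is used below
   only through the topology and the derivatives it induces.  Lengths and
   distances are Euclidean ([enorm]). *)
From HB Require Import structures.
From mathcomp Require Import all_boot all_order all_algebra.
From mathcomp Require Import all_classical all_reals all_analysis.
Set Implicit Arguments.
Unset Strict Implicit.
Unset Printing Implicit Defensive.
Import Order.TTheory GRing.Theory Num.Theory.
Import numFieldNormedType.Exports.
Local Open Scope classical_set_scope.
Local Open Scope ring_scope.

(* The sigma-algebra of R^n is the product (hence Borel) one, as the library
   does for [n.-tuple T]. *)
Section measurable_rV.
Variables (R : realType) (n : nat).

Definition coor_rV (i : 'I_n) (x : 'rV[R]_n) : measurableTypeR R := x ord0 i.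

Let rV_set0 : g_sigma_preimage coor_rV set0.
Proof. exact: sigma_algebra0. Qed.

Let rV_setC A : g_sigma_preimage coor_rV A -> g_sigma_preimage coor_rV (~` A).
Proof. exact: sigma_algebraC. Qed.

Let rV_bigcup (F : _^nat) : (forall i, g_sigma_preimage coor_rV (F i)) ->
  g_sigma_preimage coor_rV (\bigcup_i (F i)).
Proof. exact: sigma_algebra_bigcup. Qed.

HB.instance Definition _ := @isMeasurable.Build default_measure_display
  'rV[R]_n (g_sigma_preimage coor_rV) rV_set0 rV_setC rV_bigcup.

Lemma measurable_coor_rV (i : 'I_n) : measurable_fun [set: 'rV[R]_n] (coor_rV i).
Proof.
move=> _ Y mY; rewrite setTI; apply: sub_sigma_algebra => /=.
rewrite -bigcup_seq/=; exists i => /=; first by rewrite mem_index_enum.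
by exists Y => //; rewrite setTI.
Qed.

End measurable_rV.

Lemma measurable_fun_rV (R : realType) n d (T : measurableType d)
    (f : T -> 'rV[R]_n) :
  (forall i, measurable_fun [set: T] (coor_rV i \o f)) ->
  measurable_fun [set: T] f.
Proof.
move=> mf; suff H : g_sigma_preimage (fun i => coor_rV i \o f) `<=` measurable.
  by move=> _ A mA; apply: H; rewrite g_sigma_preimage_comp; exists A.
apply: smallest_sub; first exact: sigma_algebra_measurable.
case: n f mf => [|m] f mf; first by rewrite big_ord0.
rewrite -bigcup_mkord_ord; apply: bigcup_sub => i Ii.
by move=> A [B mB <-]; exact: mf.
Qed.

Section lebesgue_rV.
Variable R : realType.

Definition cons_rV n (p : measurableTypeR R * 'rV[R]_n) : 'rV[R]_n.+1 :=
  \row_i (if unlift ord0 i is Some j then p.2 ord0 j else p.1).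

Lemma measurable_cons_rV n : measurable_fun setT (@cons_rV n).
Proof.
apply: measurable_fun_rV => i.
have [j ->|->] := unliftP ord0 i.
- rewrite (_ : _ \o _ = coor_rV j \o snd).
    by apply: measurableT_comp => //; exact: measurable_coor_rV.
  by apply/funext => p; rewrite /coor_rV /= mxE liftK.
- rewrite (_ : _ \o _ = fst) //.
  by apply/funext => p; rewrite /coor_rV /= mxE unlift_none.
Qed.

Section cons.
Variables (n : nat) (mu : {sigma_finite_measure set 'rV[R]_n -> \bar R}).

Definition lebesgue_cons : set 'rV[R]_n.+1 -> \bar R :=
  pushforward (lebesgue_measure \x mu)%E (@cons_rV n).

Let pre_cons A : measurable A -> measurable (@cons_rV n @^-1` A).
Proof. by move=> mA; rewrite -[X in measurable X]setTI; exact: measurable_cons_rV. Qed.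

Let lebesgue_cons0 : lebesgue_cons set0 = 0%E.
Proof. by rewrite /lebesgue_cons /pushforward preimage_set0 measure0. Qed.

Let lebesgue_cons_ge0 A : (0 <= lebesgue_cons A)%E.
Proof. exact: (measure_ge0 (lebesgue_measure \x mu)%E). Qed.

Let lebesgue_cons_sigma_additive : semi_sigma_additive lebesgue_cons.
Proof.
move=> F mF tF mUF; rewrite /lebesgue_cons /pushforward preimage_bigcup.
apply: measure_semi_sigma_additive.
- by move=> k; exact: pre_cons.
- apply/trivIsetP => /= i j _ _ ij; rewrite -preimage_setI.
  by move/trivIsetP : tF => /(_ _ _ _ _ ij) ->//; rewrite preimage_set0.
- by rewrite -preimage_bigcup; exact: pre_cons.
Qed.

HB.instance Definition _ := isMeasure.Build _ _ _ lebesgue_cons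
  lebesgue_cons0 lebesgue_cons_ge0 lebesgue_cons_sigma_additive.

Let uncons_rV (x : 'rV[R]_n.+1) : measurableTypeR R * 'rV[R]_n :=
  (coor_rV ord0 x, \row_j x ord0 (lift ord0 j)).

Let measurable_uncons_rV : measurable_fun setT uncons_rV.
Proof.
apply: (@measurable_fun_pair _ _ _ _ _ _ (@coor_rV R n.+1 ord0)
    (fun x => \row_j x ord0 (lift ord0 j))); first exact: measurable_coor_rV.
apply: measurable_fun_rV => i.
rewrite (_ : _ \o _ = coor_rV (lift ord0 i)); first exact: measurable_coor_rV.
by apply/funext => x; rewrite /coor_rV /= mxE.
Qed.

Let cons_rVK : cancel (@cons_rV n) uncons_rV.
Proof.
move=> [a y]; rewrite /uncons_rV /coor_rV /cons_rV /=; congr pair.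
  by rewrite mxE unlift_none.
by apply/rowP => j; rewrite !mxE liftK.
Qed.

Let lebesgue_cons_sigma_finite : sigma_finite setT lebesgue_cons.
Proof.
have /sigma_finiteP[F [FT ndF Foo]] := sigma_finiteT (@lebesgue_measure R).
have /sigma_finiteP[G [GT ndG Goo]] := sigma_finiteT mu.
exists (fun k => uncons_rV @^-1` (F k `*` G k)).
  rewrite -preimage_bigcup -[LHS](preimage_setT uncons_rV); congr (_ @^-1` _).
  rewrite -setXTT FT GT predeqE => -[x y]; split; last by move=> [k _ []]; split; exists k.
  move=> [/= [k _ Fkx] [l _ Gly]]; exists (maxn k l) => //; split.
  - by move: x Fkx; exact/subsetPset/ndF/leq_maxl.
  - by move: y Gly; exact/subsetPset/ndG/leq_maxr.
move=> k; have [mF Fk] := Foo k; have [mG Gk] := Goo k; split.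
  rewrite -[X in measurable X]setTI; apply: measurable_uncons_rV => //.
  exact: measurableX.
rewrite /lebesgue_cons /pushforward -comp_preimage.
rewrite (_ : _ \o _ = id); last by apply/funext => p /=; rewrite cons_rVK.
by rewrite preimage_id product_measure1E// lte_mul_pinfty// ge0_fin_numE.
Qed.

HB.instance Definition _ := Measure_isSigmaFinite.Build _ _ _ lebesgue_cons
  lebesgue_cons_sigma_finite.

End cons.

Fixpoint lebesgue_rV n : {sigma_finite_measure set 'rV[R]_n -> \bar R} :=
  match n with
  | 0 => dirac (0 : 'rV[R]_0)
  | n'.+1 => lebesgue_cons (lebesgue_rV n')
  end.

Definition box_rV n (a b : 'rV[R]_n) : set 'rV[R]_n :=
  [set x | forall i, x ord0 i \in `]a ord0 i, b ord0 i]].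

Lemma measurable_box_rV n (a b : 'rV[R]_n) : measurable (box_rV a b).
Proof.
rewrite (_ : box_rV a b = \bigcap_(i in [set: 'I_n])
    (coor_rV i @^-1` [set` `]a ord0 i, b ord0 i]])).
  apply: fin_bigcap_measurable => // i _.
  by rewrite -[X in measurable X]setTI; exact: measurable_coor_rV.
by apply/seteqP; split => [x xab i _|x xab i]; [exact: xab|exact: (xab i I)].
Qed.

Lemma lebesgue_rV_box n (a b : 'rV[R]_n) : (forall i, a ord0 i <= b ord0 i) ->
  lebesgue_rV n (box_rV a b) = (\prod_(i < n) (b ord0 i - a ord0 i))%:E.
Proof.
elim: n a b => [|n IHn] a b ab.
  by rewrite big_ord0 /= diracE mem_set//= => -[].
pose a' : 'rV[R]_n := \row_j a ord0 (lift ord0 j).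
pose b' : 'rV[R]_n := \row_j b ord0 (lift ord0 j).
have boxE : @cons_rV n @^-1` box_rV a b =
    [set` `]a ord0 ord0, b ord0 ord0]] `*` box_rV a' b'.
  apply/seteqP; split => [[x y] xyab|[x y] [/= xab yab] i] /=.
    split => [|i]/=; first by have := xyab ord0; rewrite mxE unlift_none.
    by have := xyab (lift ord0 i); rewrite !mxE liftK.
  have [j ->|->] := unliftP ord0 i; rewrite mxE ?liftK ?unlift_none//.
  by have := yab j; rewrite !mxE.
rewrite /= /lebesgue_cons /pushforward boxE product_measure1E//; last first.
  exact: measurable_box_rV.
rewrite IHn => [|i]; last by rewrite !mxE.
rewrite big_ord_recl EFinM; congr (_ * _)%E; last first.
  by congr EFin; apply: eq_bigr => j _; rewrite !mxE.
rewrite -[LHS]/(lebesgue_measure [set` `]a ord0 ord0, b ord0 ord0]]).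
rewrite lebesgue_measure_itv/= lte_fin.

case: ltP => // ba.
have /eqP -> : b ord0 ord0 == a ord0 ord0 by rewrite eq_le ba ab.
by rewrite subrr.
Qed.

End lebesgue_rV.

Section calculus.
Variable R : realType.

(* [f] is of class C^k on the open set [U]: in finite dimension, continuity of
   all iterated directional derivatives of order at most [k]. *)
Fixpoint Ck_on (V W : normedModType R) (U : set V) (k : nat) (f : V -> W) : Prop :=
  (forall x, U x -> {for x, continuous f}) /\
  (if k is k'.+1 then
     forall h, (forall x, U x -> derivable f x h) /\ Ck_on U k' ('D_h f)
   else True).

(* All derivatives of order at most [k] of [f] have a limit, from within [U],
   at the points of [A]. *)
Fixpoint derivatives_extend (V W : normedModType R) (U A : set V) (k : nat)
    (f : V -> W) : Prop :=
  (forall x, A x -> cvg (f y @[y --> within U (nbhs x)])) /\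
  (if k is k'.+1 then forall h, derivatives_extend U A k' ('D_h f) else True).

Definition Ck_upto_boundary (V W : normedModType R) (U A : set V) (k : nat)
    (f : V -> W) : Prop :=
  Ck_on U k f /\ derivatives_extend U A k f.

Definition smooth (V W : normedModType R) (f : V -> W) : Prop :=
  forall k, Ck_on setT k f.

Definition compactly_supported (V W : normedModType R) (f : V -> W) : Prop :=
  exists2 K : set V, compact K & forall x, ~ K x -> f x = 0.

Definition enorm m n (A : 'M[R]_(m, n)) : R :=
  Num.sqrt (\sum_i \sum_j A i j ^+ 2).

Variable N : nat.
Local Notation RN := 'rV[R]_N.

Definition dot (x y : RN) : R := \sum_i x ord0 i * y ord0 i.

Definition basis_vec (i : 'I_N) : RN := delta_mx ord0 i.

Definition grad (f : RN -> R) (x : RN) : RN := \row_i 'D_(basis_vec i) f x.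

Definition Dmx (w : RN -> RN) (x : RN) : 'M[R]_N :=
  \matrix_(i, j) ('D_(basis_vec j) w x) ord0 i.

Definition div (w : RN -> RN) (x : RN) : R := \tr (Dmx w x).

End calculus.

Section function_spaces.
Variables (R : realType) (N : nat).
Local Notation RN := 'rV[R]_N.
Local Notation mu := (@lebesgue_rV R N).

(* Elements of L^p are represented by functions.  All the functions whose
   gradients appear in the Sobolev norms below are of class C^1, so that their
   weak derivatives are the classical ones. *)
Definition Lp_norm (p : \bar R) (f : RN -> R) : \bar R := 'N[mu]_p[EFin \o f]%E.

Definition Lp_normv (p : \bar R) m n (w : RN -> 'M[R]_(m, n)) : \bar R :=
  Lp_norm p (fun x => enorm (w x)).

Definition W1p_norm (p : \bar R) (f : RN -> R) : \bar R :=
  (Lp_norm p f + Lp_normv p (grad f))%E.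

Definition W1p_normv (p : \bar R) (w : RN -> RN) : \bar R :=
  (Lp_normv p w + Lp_normv p (Dmx w))%E.

(* L^1(R^N; [0, rmax]) *)
Definition L1_range (rmax : R) (f : RN -> R) : Prop :=
  mu.-integrable setT (EFin \o f) /\ {ae mu, forall x, 0 <= f x <= rmax}.

Definition total_variation_rV (f : RN -> R) : \bar R :=
  ereal_sup [set (\int[mu]_x (f x * div phi x))%:E | phi in
    [set phi : RN -> RN | [/\ Ck_on setT 1 phi, compactly_supported phi &
                            forall x, enorm (phi x) <= 1]]].

Definition BV (f : RN -> R) : Prop :=
  mu.-integrable setT (EFin \o f) /\ (total_variation_rV f < +oo)%E.

(* Support of a class of functions modulo a.e. equality: the complement of the
   largest open set on which [f] vanishes a.e. *)
Definition spt (f : RN -> R) : set RN :=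
  [set x | forall U : set RN, open U -> U x ->
             ~ {ae mu, forall y, U y -> f y = 0}].

Definition continuous_in_L1 (D : set R) (rho : R -> RN -> R) : Prop :=
  forall t, D t ->
    Lp_norm 1 (fun x => rho s x - rho t x) @[s --> within D (nbhs t)] --> 0%E.

End function_spaces.

Section hypotheses.
Variables (R : realType) (N : nat).
Local Notation RN := 'rV[R]_N.

Definition hyp_v (rmax V : R) (v : R -> R) : Prop :=
  [/\ Ck_on setT 2 v, forall x y, x <= y -> v y <= v x, v 0 = V & v rmax = 0].

Definition hyp_nu (nu : RN -> RN) : Prop :=
  [/\ Ck_on setT 2 nu, (W1p_normv +oo nu < +oo)%E,
      (W1p_norm 1 (div nu) < +oo)%E & (W1p_norm +oo (div nu) < +oo)%E].

(* C^2(R^N; R^N) carries its usual topology: uniform convergence on compact sets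
   of the derivatives of order at most 2.  [Inl] acts on representatives; that
   it respects a.e. equality follows from the Lipschitz estimates of [hyp_I]. *)
Definition C2_close (K : set RN) (eps : R) (w1 w2 : RN -> RN) : Prop :=
  forall x, K x ->
    [/\ enorm (w1 x - w2 x) < eps,
        forall i, enorm ('D_(basis_vec R i) w1 x - 'D_(basis_vec R i) w2 x) < eps
      & forall i j,
          enorm ('D_(basis_vec R j) ('D_(basis_vec R i) w1) x -
                 'D_(basis_vec R j) ('D_(basis_vec R i) w2) x) < eps].

Definition continuous_L1_C2 (rmax : R) (Inl : (RN -> R) -> RN -> RN) : Prop :=
  forall r, L1_range rmax r -> forall K : set RN, compact K ->
  forall eps, 0 < eps -> exists2 delta, 0 < delta &
    forall r', L1_range rmax r' ->
      (Lp_norm 1 (fun x => r' x - r x)%R < delta%:E)%E ->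
      C2_close K eps (Inl r') (Inl r).

(* [C] maps R^+ to R^+, is increasing and belongs to L^oo_loc(R^+). *)
Definition increasing_Linfty_loc (C : R -> R) : Prop :=
  [/\ forall s : R, 0 <= s -> 0 <= C s,
      forall s t : R, 0 <= s -> s <= t -> C s <= C t,
      measurable_fun (`[0, +oo[ : set R) C &
      forall M : R, exists B : R,
        {ae (@lebesgue_measure R), forall s, 0 <= s <= M -> `|C s| <= B}].

Definition hyp_I (rmax : R) (Inl : (RN -> R) -> RN -> RN) : Prop :=
  [/\ forall r, L1_range rmax r -> Ck_on setT 2 (Inl r),
      continuous_L1_C2 rmax Inl,
      exists2 C_I : R -> R, increasing_Linfty_loc C_I &
        forall r, L1_range rmax r ->
          [/\ (W1p_normv +oo (Inl r) <= (C_I (fine (Lp_norm 1 r)))%:E)%E,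
              (Lp_norm 1 (div (Inl r)) <= (C_I (fine (Lp_norm 1 r)))%:E)%E &
              (Lp_normv 1 (grad (div (Inl r)))
                 <= (C_I (fine (Lp_norm 1 r)))%:E)%E] &
      exists K_I : R,
        forall r1 r2, L1_range rmax r1 -> L1_range rmax r2 ->
          (Lp_normv +oo (fun x => Inl r1 x - Inl r2 x)%R
             <= K_I%:E * Lp_norm 1 (fun x => r1 x - r2 x)%R)%E /\
          (Lp_normv 1 (fun x => Inl r1 x - Inl r2 x)%R
           + Lp_norm 1 (div (fun x => Inl r1 x - Inl r2 x)%R)
             <= K_I%:E * Lp_norm 1 (fun x => r1 x - r2 x)%R)%E].

Definition boundary (A : set RN) : set RN := closure A `\` interior A.

Definition dist_boundary (Omega : set RN) (x : RN) : R :=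
  inf [set enorm (x - w) | w in boundary Omega].

Definition tubular (A : set RN) (r : R) : set RN :=
  [set x | exists2 a, A a & enorm (x - a) < r].

(* The gradient of the distance at the interior points of [Omega] and, at the
   points of the boundary, its continuous extension. *)
Definition inward_normal (Omega : set RN) (x : RN) : RN :=
  lim (grad (dist_boundary Omega) y @[y --> within (interior Omega) (nbhs x)]).

Definition hyp_Omega (Omega : set RN) : Prop :=
  (exists2 U : set RN, [/\ U !=set0, open U & connected U] & Omega = closure U)
  /\ (boundary Omega !=set0 ->
      exists r : R, [/\ 0 < r,
        Ck_upto_boundary (tubular (boundary Omega) r `&` interior Omega)
          (boundary Omega) 2 (dist_boundary Omega) &
        forall x, (tubular (boundary Omega) r `&` Omega) x ->
          enorm (inward_normal Omega x) = 1]).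

End hypotheses.

Section Cauchy_problem.
Variables (R : realType) (N : nat).
Local Notation RN := 'rV[R]_N.
Local Notation mu := (@lebesgue_rV R N).

(* C_c^oo(]-oo, T] x R^N; R^+): restrictions to t <= T of functions in
   C_c^oo(R x R^N). *)
Definition test_function (T : R) (phi : R * RN -> R) : Prop :=
  [/\ smooth phi, compactly_supported phi &
      forall t x, t <= T -> 0 <= phi (t, x)].

(* [w] is the time-dependent vector field. The integral over [0, T] x R^N is
   written as an iterated one: it depends on rho(t) only through its class. *)
Definition kruzkov_inequality (T : R) (v : R -> R) (w : R -> RN -> RN)
    (rho0 : RN -> R) (rho : R -> RN -> R) (k : R) (phi : R * RN -> R) : Prop :=
  0 <= \int[@lebesgue_measure R]_(t in `[0, T]) (\int[mu]_x
         (`|rho t x - k| * 'D_((1, 0) : R * RN) phi (t, x)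
          + ((rho t x * v (rho t x) - k * v k)
               * dot (w t x) (grad (fun y => phi (t, y)) x)
             - k * v k * div (w t) x * phi (t, x)) * Num.sg (rho t x - k)))
       + \int[mu]_x (`|rho0 x - k| * phi (0, x)).

Definition velocity (nu : RN -> RN) (Inl : (RN -> R) -> RN -> RN)
    (r : RN -> R) (x : RN) : RN := nu x + Inl r x.

Definition weak_entropy_solution_upto (T rmax : R) (v : R -> R)
    (nu : RN -> RN) (Inl : (RN -> R) -> RN -> RN)
    (rho0 : RN -> R) (rho : R -> RN -> R) : Prop :=
  [/\ forall t, 0 <= t <= T -> L1_range rmax (rho t),
      continuous_in_L1 `[0, T] rho &
      forall k phi, test_function T phi ->
        kruzkov_inequality T v (fun t => velocity nu Inl (rho t)) rho0 rho k phi].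

Definition weak_entropy_solution (rmax : R) (v : R -> R)
    (nu : RN -> RN) (Inl : (RN -> R) -> RN -> RN)
    (rho0 : RN -> R) (rho : R -> RN -> R) : Prop :=
  [/\ forall t, 0 <= t -> L1_range rmax (rho t),
      continuous_in_L1 `[0, +oo[ rho &
      forall T, 0 < T -> weak_entropy_solution_upto T rmax v nu Inl rho0 rho].

Definition invariant_Cauchy_problem (rmax : R) (v : R -> R)
    (nu : RN -> RN) (Inl : (RN -> R) -> RN -> RN) (Omega : set RN) : Prop :=
  forall rho0 : RN -> R, L1_range rmax rho0 -> BV rho0 -> spt rho0 `<=` Omega ->
  forall rho : R -> RN -> R, weak_entropy_solution rmax v nu Inl rho0 rho ->
  forall t, 0 <= t -> spt (rho t) `<=` Omega.

End Cauchy_problem.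

(* Main.v *)
(* Let m(t) be the mass of rho(t) outside Omega.  Only the Kruzkov inequality with
   k = 0 is used.  Let D be the distance to the inner core of Omega, the set of
   points of Omega at depth at least a.  By the C^2 regularity, a - D is the
   distance to the boundary in the collar, and gradients of D^2/2 are parallel to
   the normal.  Comparing rho(t) with its restriction to Omega, the hypothesis on
   the normal velocity gives w . n >= - K m(t) on the boundary, so that mass at
   depth d moves outwards with speed at most L d + K m(t).  Hence the mass outside
   Omega at time T started in a collar whose width is controlled by the integral
   of m, and, as rho0 is BV and vanishes outside Omega, the mass of rho0 in a collar
   of width b is O(b).  This is a Gronwall inequality for m, whence m = 0.

   D^2/2 is not smooth: it is replaced in the test functions by a log-sum-exp over
   a finite net of the core, which is semiconcave and whose gradient converges
   where the nearest point of the core is unique. *)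
Require Import Defs.
From mathcomp Require Import all_boot all_order all_algebra.
From mathcomp Require Import all_classical all_reals all_analysis.
From mathcomp Require Import measurable_realfun ess_sup_inf hoelder.
From mathcomp Require Import ring lra.
From mathcomp Require finmap.
Set Implicit Arguments.
Unset Strict Implicit.
Unset Printing Implicit Defensive.
Import Order.TTheory GRing.Theory Num.Theory.
Import numFieldNormedType.Exports.
Local Open Scope classical_set_scope.
Local Open Scope ring_scope.

(** The distance to the boundary is controlled only on the inner side of the collar, and the
    hypotheses give no bound on its second derivatives that is uniform along the boundary, whereas
    test functions must be smooth on the whole space. The distance [D] to the core avoids both
    difficulties: it is defined everywhere, it is at least [a] outside the interior of Omega, and
    [D^2 / 2 - |x|^2 / 2] is an infimum of affine functions, so that the Laplacian of [D^2 / 2] is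
    at most [N] whatever the curvature. This one-sided bound suffices because the field whose
    divergence is estimated is a nonpositive multiple of the gradient. The direction of the gradient
    matters only in the collar, where the nearest point of the core is unique. The Gronwall step
    never integrates m, whose measurability in time is thus not an issue: from m(t) <= A e^(lam t)
    it deduces the same bound with A / 2, and the exponential majorant makes the width of the front
    explicit. *)

(** * Directional derivatives and the classes [Ck_on] *)

Lemma is_derive_line (R : realType) (V W : normedModType R) (f : V -> W) x v l :
  is_derive x v f l <-> is_derive (0 : R) (1 : R) (fun t => f (t *: v + x)) l.
Proof.
have E : (fun h : R => h^-1 *: (f (h *: v + x) - f x)) =
   (fun h : R => h^-1 *: (f ((h *: (1:R) + 0) *: v + x) - f ((0:R) *: v + x))).
  apply/funext => h; rewrite scale0r add0r addr0; congr (_ *: (f (_ *: _ + _) - _)).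
  by rewrite /GRing.scale /= mulr1.
split => -[d e]; split.
- by move: d; rewrite /derivable /= E.
- by rewrite -e /derive /= E.
- by rewrite /derivable /= E.
- by rewrite -e /derive /= E.
Qed.

Lemma is_derive_comp (R : realType) (V : normedModType R) (g : R -> R)
    (f : V -> R) x v dg df :
  is_derive x v f df -> is_derive (f x) 1 g dg ->
  is_derive x v (fun y => g (f y)) (dg * df).
Proof.
move=> /is_derive_line Hf Hg; apply/is_derive_line.
have := @is_derive1_comp R g (fun t => f (t *: v + x)) 0 dg df.
rewrite scale0r add0r; exact.
Qed.

Lemma is_derive_dir (R : realType) (g : R -> R) (x h dg : R) :
  is_derive x (1 : R) g dg -> is_derive x h g (dg * h).
Proof. by move=> Hg; exact: (is_derive_comp (is_derive_id x h)). Qed.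

Section Ck_closure.
Variable R : realType.
Implicit Types V W : normedModType R.

Lemma Ck_on_cont V W (U : set V) k (f : V -> W) :
  Ck_on U k f -> forall x, U x -> {for x, continuous f}.
Proof. by case: k => [|k] []. Qed.

Lemma Ck_on_succ V W (U : set V) k (f : V -> W) :
  (forall x, U x -> {for x, continuous f}) ->
  (forall h, (forall x, U x -> derivable f x h) /\ Ck_on U k ('D_h f)) ->
  Ck_on U k.+1 f.
Proof. by []. Qed.

Lemma Ck_onW V W (U : set V) k (f : V -> W) : Ck_on U k.+1 f -> Ck_on U k f.
Proof.
elim: k f => [|k IH] f [cf Hf]; split => // h; have [df Df] := Hf h; split => //.
exact: IH.
Qed.

Lemma Ck_on_leq V W (U : set V) j k (f : V -> W) : (j <= k)%N ->
  Ck_on U k f -> Ck_on U j f.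
Proof.
move=> jk; rewrite -(subnK jk); elim: (k - j)%N => // n IH /Ck_onW; exact: IH.
Qed.

Lemma Ck_on_eq V W (U : set V) k (f g : V -> W) : Ck_on U k f -> open U ->
  (forall x, U x -> f x = g x) -> Ck_on U k g.
Proof.
move=> + oU; elim: k f g => [|k IH] f g [cf Hf] fg.
  split => // x Ux; rewrite /prop_for /continuous_at -(fg x Ux).
  apply: cvg_trans (cf x Ux); apply: near_eq_cvg.
  by near=> y; apply: fg; near: y; exact: open_nbhs_nbhs.
have nfg x : U x -> \near x, f x = g x.
  by move=> Ux; near=> y; apply: fg; near: y; exact: open_nbhs_nbhs.
apply: Ck_on_succ => [x Ux|h].
  rewrite /prop_for /continuous_at -(fg x Ux).
  by apply: cvg_trans (cf x Ux); apply: near_eq_cvg; exact: nfg.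
have [df Df] := Hf h; split => [x Ux|].
  by apply: near_eq_derivable (df x Ux) => //; exact: nfg.
apply: IH Df _ => x Ux.
by apply: near_eq_derive => //; exact: nfg.
Unshelve. all: by end_near. Qed.

Lemma Ck_on_cst V W (U : set V) k (a : W) : Ck_on U k (fun _ : V => a).
Proof.
elim: k a => [|k IH] a; first by split => // x _; exact: cvg_cst.
apply: Ck_on_succ => [x _|h]; first exact: cvg_cst.
split => [x _|]; first exact: derivable_cst.
rewrite (_ : 'D_h _ = fun=> 0); first exact: IH.
by apply/funext => x; exact: derive_cst.
Qed.

Lemma Ck_onD V W (U : set V) k (f g : V -> W) : open U ->
  Ck_on U k f -> Ck_on U k g -> Ck_on U k (fun x => f x + g x).
Proof.
move=> oU; elim: k f g => [|k IH] f g [cf Hf] [cg Hg].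
  by split => // x Ux; apply: cvgD; [exact: cf|exact: cg].
apply: Ck_on_succ => [x Ux|h]; first by apply: cvgD; [exact: cf|exact: cg].
have [df Df] := Hf h; have [dg Dg] := Hg h; split => [x Ux|].
  by apply: derivableD; [exact: df|exact: dg].
refine (Ck_on_eq (IH _ _ Df Dg) oU _) => x Ux.
exact/esym/(deriveD (df x Ux) (dg x Ux)).
Qed.

Lemma Ck_onM V (U : set V) k (f g : V -> R) : open U ->
  Ck_on U k f -> Ck_on U k g -> Ck_on U k (fun x => f x * g x).
Proof.
move=> oU; elim: k f g => [|k IH] f g [cf Hf] [cg Hg].
  by split => // x Ux; apply: cvgM; [exact: cf|exact: cg].
apply: Ck_on_succ => [x Ux|h]; first by apply: cvgM; [exact: cf|exact: cg].
have [df Df] := Hf h; have [dg Dg] := Hg h; split => [x Ux|].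
  by apply: derivableM; [exact: df|exact: dg].
have Hf' : Ck_on U k f by apply: Ck_onW; split.
have Hg' : Ck_on U k g by apply: Ck_onW; split.
refine (Ck_on_eq (Ck_onD oU (IH _ _ Hf' Dg) (IH _ _ Hg' Df)) oU _) => x Ux.
exact/esym/(deriveM (df x Ux) (dg x Ux)).
Qed.

Lemma Ck_onZ V (U : set V) k (a : R) (f : V -> R) : open U ->
  Ck_on U k f -> Ck_on U k (fun x => a * f x).
Proof. by move=> oU; apply: Ck_onM => //; exact: Ck_on_cst. Qed.

Lemma Ck_onN V (U : set V) k (f : V -> R) : open U ->
  Ck_on U k f -> Ck_on U k (fun x => - f x).
Proof.
move=> oU /(Ck_onZ (-1) oU); rewrite (_ : (fun x => - f x) = (fun x => -1 * f x))//.
by apply/funext => x; rewrite mulN1r.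
Qed.

Lemma Ck_onB V (U : set V) k (f g : V -> R) : open U ->
  Ck_on U k f -> Ck_on U k g -> Ck_on U k (fun x => f x - g x).
Proof. by move=> oU Hf Hg; apply: Ck_onD => //; exact: Ck_onN. Qed.

Lemma Ck_on_sum V (U : set V) k (I : Type) (s : seq I) (f : I -> V -> R) : open U ->
  (forall i, Ck_on U k (f i)) -> Ck_on U k (fun x => \sum_(i <- s) f i x).
Proof.
move=> oU Hf; elim: s => [|i s IH].
  rewrite (_ : (fun x => _) = (fun=> 0)); first exact: Ck_on_cst.
  by apply/funext => x; rewrite big_nil.
rewrite (_ : (fun x => _) = (fun x => f i x + \sum_(j <- s) f j x)).
  exact: Ck_onD.
by apply/funext => x; rewrite big_cons.
Qed.

(** Only ['D_1 g] enters the chain rule, so the induction replaces [g] by ['D_1 g] and keeps [f]. *)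
Lemma Ck_on_comp V (U : set V) (D : set R) k (g : R -> R) (f : V -> R) : open U ->
  (forall x, U x -> D (f x)) -> Ck_on D k g -> Ck_on U k f ->
  Ck_on U k (fun x => g (f x)).
Proof.
move=> oU UD; elim: k g f UD => [|k IH] g f UD [cg Hg] [cf Hf].
  by split => // x Ux; apply: continuous_comp; [exact: cf|exact/cg/UD].
apply: Ck_on_succ => [x Ux|h]; first by apply: continuous_comp; [exact: cf|exact/cg/UD].
have [df Df] := Hf h; have [dg Dg] := Hg 1.
have H x : U x -> is_derive x h (fun x => g (f x)) ('D_1 g (f x) * 'D_h f x).
  move=> Ux; apply: is_derive_comp; apply/derivableP; [exact: df|exact/dg/UD].
split => [x /H[]//|].
have Hf' : Ck_on U k f by apply: Ck_onW; split.
refine (Ck_on_eq (Ck_onM oU (IH _ _ UD Dg Hf') Df) oU _) => x Ux.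
by have [_ ->] := H x Ux.
Qed.

(** Serves for the two projections of R x R^N, to regard functions of t alone or of x alone as
    functions of (t, x). *)
Lemma Ck_on_linear V V' W k (l : V' -> V) (f : V -> W) : continuous l ->
  (forall t v x, l (t *: v + x) = t *: l v + l x) ->
  Ck_on setT k f -> Ck_on setT k (fun x => f (l x)).
Proof.
move=> cl ll; elim: k f => [|k IH] f [cf Hf].
  by split => // x _; exact: (@continuous_comp _ _ _ l f x (cl x) (cf _ I)).
apply: Ck_on_succ => [x _|h]; first exact: (@continuous_comp _ _ _ l f x (cl x) (cf _ I)).
have [df Df] := Hf (l h).
have E x : (fun t : R => t^-1 *: (((fun x => f (l x)) \o shift x) (t *: h) - f (l x)))
    = (fun t : R => t^-1 *: ((f \o shift (l x)) (t *: l h) - f (l x))).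
  by apply/funext => t /=; rewrite ll.
split => [x _|]; first by have := df (l x) I; rewrite /derivable E.
rewrite (_ : 'D_h _ = fun x => 'D_(l h) f (l x)); first exact: (IH ('D_(l h) f) Df).
by apply/funext => x; rewrite /derive E.
Qed.

Lemma is_derive_coord n (i : 'I_n) (x h : 'rV[R]_n) :
  is_derive x h (fun y : 'rV[R]_n => y ord0 i) (h ord0 i).
Proof.
apply: DeriveDef.
  have H : derivable (id : 'rV[R]_n -> 'rV[R]_n) x h by exact: derivable_id.
  by move/derivable_mxP : H => /(_ ord0 i).
have H : derivable (id : 'rV[R]_n -> 'rV[R]_n) x h by exact: derivable_id.
have /matrixP/(_ ord0 i) := derive_mx H.
by rewrite derive_id mxE => ->.
Qed.

Lemma Ck_on_coord n (i : 'I_n) k : Ck_on setT k (fun x : 'rV[R]_n => x ord0 i).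
Proof.
have c : forall x, {for x, continuous (fun x : 'rV[R]_n => x ord0 i)}.
  by move=> x; exact: coord_continuous.
case: k => [|k]; first by split.
apply: Ck_on_succ => // h; split.
  by move=> x _; have [] := is_derive_coord i x h.
rewrite (_ : 'D_h _ = fun=> h ord0 i); first exact: Ck_on_cst.
by apply/funext => x; have [] := is_derive_coord i x h.
Qed.

Lemma Ck_on_id (U : set R) k : Ck_on U k (fun x : R => x).
Proof.
case: k => [|k]; first by split => // x _; exact: cvg_id.
apply: Ck_on_succ => [x _|h]; first exact: cvg_id.
split; first by move=> x _; exact: derivable_id.
rewrite (_ : 'D_h _ = fun=> h); first exact: Ck_on_cst.
by apply/funext => x; rewrite derive_id.
Qed.

(* It suffices to differentiate in the direction [1]. *)
Lemma Ck_on1S (U : set R) k (f df : R -> R) : open U ->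
  (forall x, U x -> is_derive x 1 f (df x)) -> Ck_on U k df -> Ck_on U k.+1 f.
Proof.
move=> oU Hf Hdf; apply: Ck_on_succ => [x Ux|h].
  have [d _] := Hf x Ux.
  exact/differentiable_continuous/derivable1_diffP.
split => [x Ux|]; first by have [] := is_derive_dir h (Hf x Ux).
refine (Ck_on_eq (Ck_onZ h oU Hdf) oU _) => x Ux.
by have [_ ->] := is_derive_dir h (Hf x Ux); rewrite mulrC.
Qed.

Lemma Ck_on_expR k : Ck_on setT k (@expR R).
Proof.
elim: k => [|k IH]; first by split => // x _; exact: continuous_expR.
by apply: (Ck_on1S openT) IH => x _; exact: is_derive_expR.
Qed.

Lemma is_derive_inv (x : R) : 0 < x ->
  is_derive x (1 : R) (fun x => x^-1) (- (x^-1 * x^-1)).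
Proof.
move=> x0; apply: is_derive_eq.
  by apply: (@is_deriveV _ id x 1 1); rewrite ?gt_eqF.
by rewrite /GRing.scale/= mulr1 -exprVn expr2.
Qed.

Lemma Ck_on_inv k : Ck_on [set x : R | 0 < x] k (fun x => x^-1).
Proof.
have o := @open_gt R 0.
elim: k => [|k IH].
  by split => // x x0; apply: cvgV => //; rewrite gt_eqF.
by apply: (Ck_on1S o is_derive_inv); apply: Ck_onN => //; exact: Ck_onM.
Qed.

Lemma Ck_on_ln k : Ck_on [set x : R | 0 < x] k (@ln R).
Proof.
case: k => [|k]; first by split => // x x0; exact: continuous_ln.
apply: (Ck_on1S (@open_gt R 0) _ (@Ck_on_inv k)) => x; exact: is_derive1_ln.
Qed.

End Ck_closure.

Lemma is_derive_exprn (R : realType) (V : normedModType R) (f : V -> R) n x v df :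
  is_derive x v f df ->
  is_derive x v (fun y => f y ^+ n) (n%:R * f x ^+ n.-1 * df).
Proof.
move=> H; have := is_deriveX n H.
by rewrite (_ : f ^+ n = fun y => f y ^+ n)//; apply/funext => y; rewrite exprfctE.
Qed.

(** * A smooth step function *)

Section smooth_step.
Variable R : realType.

(** The power [n] makes the family stable under differentiation up to linear combinations, so that
    one induction proves smoothness for all [n] at once. *)
Definition flat (n : nat) (x : R) : R :=
  if 0 < x then x^-1 ^+ n * expR (- x^-1) else 0.

Lemma flat_ge0 n x : 0 <= flat n x.
Proof.
by rewrite /flat; case: ltP => // x0; rewrite mulr_ge0 ?expR_ge0// exprn_ge0// invr_ge0 ltW.
Qed.

Lemma flat_le0 n x : x <= 0 -> flat n x = 0.
Proof. by rewrite /flat leNgt => /negbTE ->. Qed.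

Lemma flat_gt0 n x : 0 < x -> 0 < flat n x.
Proof. by move=> x0; rewrite /flat x0 mulr_gt0 ?expR_gt0// exprn_gt0// invr_gt0. Qed.

(** With y = 1 / x and m = n + 1, this is (y / m)^m <= (1 + y / m)^m <= e^y. The linear decay at 0,
    for every [n], gives the derivative of [flat n] there. *)
Lemma flat_bound n x : `|flat n x| <= n.+1%:R ^+ n.+1 * `|x|.
Proof.
rewrite (ger0_norm (flat_ge0 _ _)) /flat; case: ltP => x0; last by rewrite mulr_ge0 ?exprn_ge0.
rewrite gtr0_norm// expRN ler_pdivrMr ?expR_gt0//.
have y0 : 0 < x^-1 by rewrite invr_gt0.
set y := x^-1 in y0 *.
have H : (y / n.+1%:R) ^+ n.+1 <= expR y.
  rewrite -[in leRHS](@divfK _ n.+1%:R _ y) ?pnatr_eq0// expRM_natr.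
  rewrite lerXn2r ?nnegrE ?expR_ge0 ?divr_ge0 ?ltW//.
  by rewrite (lt_le_trans _ (expR_ge1Dx _))// ltrDr.
have {}H : y ^+ n.+1 <= n.+1%:R ^+ n.+1 * expR y.
  by move: H; rewrite expr_div_n ler_pdivrMr ?exprn_gt0// mulrC.
have -> : y ^+ n = x * y ^+ n.+1 by rewrite exprS mulrA divff ?gt_eqF// mul1r.
by rewrite mulrAC mulrC ler_wpM2r// ltW.
Qed.

Lemma is_derive_flat n (x : R) :
  is_derive x (1 : R) (flat n) (flat n.+2 x - n%:R * flat n.+1 x).
Proof.
have [x0|x0|->] := ltrgtP x 0.
- rewrite !flat_le0 ?ltW// mulr0 subrr.
  apply: near_eq_is_derive (is_derive_cst (0 : R) x (1 : R)).
  near=> y; rewrite flat_le0// ltW//; near: y; exact: lt_nbhsl.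
- have dV := is_derive_inv x0.
  have dE : is_derive x 1 (fun x => expR (- x^-1)) (expR (- x^-1) * - - (x^-1 * x^-1)).
    have dN : is_derive x (1 : R) (fun x => - x^-1) (- - (x^-1 * x^-1)).
      exact: is_deriveN dV.
    exact: is_derive_comp dN (is_derive_expR (- x^-1)).
  have dX : is_derive x 1 (fun x => x^-1 ^+ n) (n%:R * x^-1 ^+ n.-1 * - (x^-1 * x^-1)).
    exact: is_derive_exprn dV.
  apply: is_derive_eq.
    apply: near_eq_is_derive (is_deriveM dX dE).
    near=> y; rewrite /flat ifT//; near: y; exact: lt_nbhsr.
  rewrite /GRing.scale/= /flat x0; case: n {dX} => [|n]; rewrite ?expr0 /= ?exprS; ring.
- rewrite !flat_le0// mulr0 subrr.
  have H : (h^-1 *: (flat n (h *: (1:R) + 0) - flat n 0)) @[h --> (0:R)^'] --> (0 : R).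
    apply/cvgr0Pnorm_le => e e0.
    have c0 : 0 < n.+2%:R ^+ n.+2 :> R by rewrite exprn_gt0.
    near=> h.
    have hN0 : h != 0 by near: h; exact: nbhs_dnbhs_neq.
    rewrite /GRing.scale/= mulr1 addr0 (flat_le0 n (lexx 0)) subr0.
    (* The difference quotient at 0 is the next member of the family, which tends to 0 by
       [flat_bound]. *)
    have -> : h^-1 * flat n h = flat n.+1 h.
      by rewrite /flat; case: ifP => _; rewrite ?mulr0// exprS mulrA.
    rewrite (le_trans (flat_bound _ _))// mulrC -ler_pdivlMr//.
    by near: h; apply: dnbhs0_le; exact: divr_gt0.
  by split; [apply/cvg_ex; exists 0|exact/cvg_lim].
Unshelve. all: by end_near. Qed.

Lemma Ck_on_flat k n : Ck_on setT k (flat n).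
Proof.
elim: k n => [|k IH] n.
  split => // x _; have [d _] := is_derive_flat n x.
  exact/differentiable_continuous/derivable1_diffP.
apply: (Ck_on1S openT (fun x _ => is_derive_flat n x)).
by apply: Ck_onB; [exact: openT|exact: IH|apply: Ck_onZ; [exact: openT|exact: IH]].
Qed.

Lemma flat_nondecreasing : {homo flat 0 : x y / x <= y}.
Proof.
move=> x y xy; rewrite /flat; case: ltP => x0; last first.
  by case: ltP => // y0; rewrite mulr_ge0 ?expR_ge0// exprn_ge0// invr_ge0 ltW.
rewrite (lt_le_trans x0 xy) !expr0 !mul1r ler_expR lerN2 lef_pV2 ?posrE//.
exact: lt_le_trans xy.
Qed.

(* [1 - flat (e^-1 - flat x) / flat e^-1] vanishes for [x <= 0] and equals [1]
   for [x >= 1], because [flat 1 = e^-1]. *)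
Definition step (x : R) : R :=
  1 - flat 0 (expR (- 1) - flat 0 x) / flat 0 (expR (- 1)).

Definition dstep (x : R) : R :=
  flat 2 (expR (- 1) - flat 0 x) * flat 2 x / flat 0 (expR (- 1)).

Let c0 : 0 < flat 0 (expR (- 1)).
Proof. by rewrite flat_gt0// expR_gt0. Qed.

Lemma step_le0 x : x <= 0 -> step x = 0.
Proof.
by move=> x0; rewrite /step (flat_le0 0 x0) subr0 divff ?subrr// gt_eqF.
Qed.

Lemma flat01 : flat 0 1 = expR (- 1).
Proof. by rewrite /flat ltr01 expr0 mul1r invr1. Qed.

Lemma step_ge1 x : 1 <= x -> step x = 1.
Proof.
move=> x1; rewrite /step [X in X / _]flat_le0 ?mul0r ?subr0//.
by rewrite subr_le0 -flat01 flat_nondecreasing.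
Qed.

Lemma step_le1 x : step x <= 1.
Proof. by rewrite /step gerBl divr_ge0 ?flat_ge0. Qed.

Lemma step_ge0 x : 0 <= step x.
Proof.
rewrite /step subr_ge0 ler_pdivrMr// mul1r flat_nondecreasing//.
by rewrite gerBl flat_ge0.
Qed.

Lemma is_derive_step (x : R) : is_derive x (1 : R) step (dstep x).
Proof.
have d1 := is_derive_flat 0 x; rewrite mul0r subr0 in d1.
have d2 := is_derive_flat 0 (expR (- 1) - flat 0 x); rewrite mul0r subr0 in d2.
have d3 : is_derive x (1 : R) (fun y => expR (- 1) - flat 0 y) (0 - flat 2 x).
  exact: is_deriveB.
have d4 := is_derive_comp d3 d2.
have d5 : is_derive x (1 : R)
    (fun y => (flat 0 (expR (- 1)))^-1 * flat 0 (expR (- 1) - flat 0 y))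
    ((flat 0 (expR (- 1)))^-1 * (flat 2 (expR (- 1) - flat 0 x) * (0 - flat 2 x))).
  exact: is_deriveZ.
have := is_deriveB (is_derive_cst (1 : R) x (1 : R)) d5.
rewrite (_ : _ - _ = step); last first.
  by apply/funext => y; rewrite /step -[LHS]/(1 - _ * _) mulrC.
by rewrite (_ : _ - _ = dstep x)// /dstep; ring.
Qed.

Lemma Ck_on_step k : Ck_on setT k step.
Proof.
have o := @openT R.
rewrite (_ : step = fun x => 1 - (flat 0 (expR (- 1)))^-1 * flat 0 (expR (- 1) - flat 0 x)).
  apply: Ck_onB => //; first exact: Ck_on_cst.
  apply: Ck_onZ => //; apply: (@Ck_on_comp _ _ _ setT) => //; first exact: Ck_on_flat.
  apply: Ck_onB => //; [exact: Ck_on_cst|exact: Ck_on_flat].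
by apply/funext => y; rewrite /step mulrC.
Qed.

Lemma dstep_ge0 x : 0 <= dstep x.
Proof. by rewrite /dstep !mulr_ge0 ?flat_ge0// invr_ge0 flat_ge0. Qed.

Lemma dstep_le0 x : x <= 0 -> dstep x = 0.
Proof. by move=> x0; rewrite /dstep (flat_le0 2 x0) mulr0 mul0r. Qed.

Lemma dstep_ge1 x : 1 <= x -> dstep x = 0.
Proof.
move=> x1; rewrite /dstep [flat 2 (_ - _)]flat_le0 ?mul0r//.
by rewrite subr_le0 -flat01 flat_nondecreasing.
Qed.

Lemma Ck_on_dstep k : Ck_on setT k dstep.
Proof.
have := (Ck_on_step k.+1).2 1 => -[_].
rewrite (_ : 'D_1 step = dstep)//.
by apply/funext => x; have [] := is_derive_step x.
Qed.

Lemma dstep_bounded : exists2 C, 0 < C & forall x, dstep x <= C.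
Proof.
have [|c _ Hc] := @EVT_max R dstep 0 1 ler01.
  apply: continuous_subspaceT => x; exact: (Ck_on_cont (Ck_on_dstep 0)).
exists (dstep c + 1); first by rewrite ltr_wpDl// dstep_ge0.
move=> x; have [x0|x0] := leP x 0; first by rewrite dstep_le0// addr_ge0// dstep_ge0.
have [x1|x1] := leP 1 x; first by rewrite dstep_ge1// addr_ge0// dstep_ge0.
by rewrite (le_trans (Hc x _))// ?lerDl// in_itv/= !ltW.
Qed.

End smooth_step.

(** * Lebesgue measure and the topology of R^N *)

Section measure_rV.
Variables (R : realType) (N : nat).
Local Notation RN := 'rV[R]_N.
Local Notation mu := (@lebesgue_rV R N).

Lemma norm_lt_coord (x : RN) (e : R) : 0 < e ->
  (forall i, `|x ord0 i| < e) -> `|x| < e.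
Proof.
move=> e0 xe; rewrite [ltLHS]/Num.Def.normr /= mx_normrE.
by apply/bigmax_ltP; split => // -[i j] _ /=; rewrite ord1.
Qed.

(** A base of the topology with a countable index type: it links open sets to the product
    sigma-algebra and lets almost-everywhere statements be combined. *)
Definition rat_cube (p : 'rV[rat]_N * nat) : set RN :=
  [set y | forall i, `|y ord0 i - ratr (p.1 ord0 i)| < p.2.+1%:R^-1].

Lemma measurable_rat_cube p : measurable (rat_cube p).
Proof.
rewrite (_ : rat_cube p = \bigcap_(i in [set: 'I_N])
    (coor_rV i @^-1` ball (ratr (p.1 ord0 i) : R) p.2.+1%:R^-1)); last first.
  apply/seteqP; split => [y py i _|y py i]; rewrite /= /ball /= distrC.
    exact: py.
  by have := py i I; rewrite /= /ball /= distrC.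
apply: fin_bigcap_measurable => // i _.
rewrite -[X in measurable X]setTI; apply: measurable_coor_rV => //.
by apply: open_measurable; exact: ball_open.
Qed.

Lemma rat_cube_nbhs (U : set RN) x : open U -> U x ->
  exists2 p, rat_cube p x & rat_cube p `<=` U.
Proof.
move=> oU Ux.
have /nbhs_ballP[e /= e0 eU] : nbhs x U by exact: open_nbhs_nbhs.
have [k ke] : exists k, k.+1%:R^-1 < e / 2.
  by have [k _ /(_ k (leqnn k))] := near_infty_natSinv_lt (PosNum (divr_gt0 e0 (ltr0Sn R 1)));
    exists k.
have k0 : 0 < k.+1%:R^-1 :> R by rewrite invr_gt0.
have /choice[q Hq] (i : 'I_N) : exists q : rat, `|x ord0 i - ratr q| < k.+1%:R^-1.
  have lt : x ord0 i - k.+1%:R^-1 < x ord0 i + k.+1%:R^-1.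
    by move: k0; set d := _^-1 => k0; lra.
  have [q] := rat_in_itvoo lt.
  by rewrite in_itv /= => qk; exists q; rewrite distrC ltr_distl.
exists (\row_i q i, k) => [i|y yp]; first by rewrite mxE.
apply: eU; rewrite -ball_normE /=; apply: norm_lt_coord => // i.
rewrite !mxE (_ : x ord0 i - y ord0 i = (x ord0 i - ratr (q i)) - (y ord0 i - ratr (q i))); last by ring.
rewrite (le_lt_trans (ler_normB _ _))// (lt_trans (ltrD (Hq i) _) (_ : k.+1%:R^-1 + k.+1%:R^-1 < _))//.
  by have := yp i; rewrite mxE.
by rewrite [ltRHS](splitr e) ltrD.
Qed.

Lemma open_bigcup_rat_cube (U : set RN) : open U ->
  U = \bigcup_(p in [set p | rat_cube p `<=` U]) rat_cube p.
Proof.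
move=> oU; apply/seteqP; split => [x Ux|x [p /= pU /pU]//].
by have [p px pU] := rat_cube_nbhs oU Ux; exists p.
Qed.

Lemma open_measurable_rV (U : set RN) : open U -> measurable U.
Proof.
move=> /open_bigcup_rat_cube ->; rewrite bigcup_mkcond.
apply: countable_bigcupT_measurable => [|p]; first exact: countableP.
by case: ifP => _ //; exact: measurable_rat_cube.
Qed.

Lemma closed_measurable_rV (A : set RN) : closed A -> measurable A.
Proof.
by move=> /closed_openC /open_measurable_rV /measurableC; rewrite setCK.
Qed.

Lemma continuous_measurable_rV (f : RN -> R) : continuous f ->
  measurable_fun setT f.
Proof.
move=> /continuousP cf; apply: (measurability _ (RGenOpens.measurableE R)).
move=> _ [_ [a [b ->] <-]]; rewrite setTI; apply: open_measurable_rV.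
exact/cf/interval_open.
Qed.

Lemma rat_cube_gt0 p : (0 < mu (rat_cube p))%E.
Proof.
pose e : R := p.2.+1%:R^-1 / 2.
have e0 : 0 < e by rewrite divr_gt0// invr_gt0.
pose a : RN := \row_i (ratr (p.1 ord0 i) - e).
pose b : RN := \row_i (ratr (p.1 ord0 i) + e).
apply: (@lt_le_trans _ _ (mu (box_rV a b))).
  rewrite lebesgue_rV_box => [|i]; last by rewrite !mxE; lra.
  by rewrite lte_fin prodr_gt0// => i _; rewrite !mxE; lra.
apply: le_measure; rewrite ?inE; [exact: measurable_box_rV|exact: measurable_rat_cube|].
move=> y yab i; have := yab i; rewrite !mxE in_itv/= ltr_norml => /andP[ay yb].
have ee : p.2.+1%:R^-1 = e + e by rewrite /e -splitr.
rewrite {}ee; move: (y ord0 i) (ratr _) ay yb e0 => u v; move: (e) => d.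
by move=> *; apply/andP; split; lra.
Qed.

(** A nonempty open set contains a rational cube, which has positive measure and so does not fit in
    the exceptional null set. This turns essential bounds on continuous functions into bounds at
    every point. *)
Lemma ae_dense (P : RN -> Prop) (U : set RN) : {ae mu, forall x, P x} ->
  open U -> U !=set0 -> exists2 x, U x & P x.
Proof.
move=> [A [mA A0 PA]] oU [x Ux]; apply: contrapT => H.
have [p px pU] := rat_cube_nbhs oU Ux.
have : (mu (rat_cube p) <= mu A)%E.
  apply: le_measure; rewrite ?inE//; first exact: measurable_rat_cube.
  by move=> y /pU Uy; apply: PA => Py; apply: H; exists y.
by rewrite A0 leNgt rat_cube_gt0.
Qed.

Lemma ae_le_continuous (f : RN -> R) (c : R) : continuous f ->
  {ae mu, forall x, f x <= c} -> forall x, f x <= c.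
Proof.
move=> cf fc x; rewrite leNgt; apply/negP => cx.
have [|y /= cy] := ae_dense fc (open_comp (fun y _ => cf y) (@open_gt R c)).
  by exists x.
by rewrite leNgt cy.
Qed.

(** The norm of exponent [+oo] is the essential supremum only if the whole space has positive
    measure. *)
Lemma mu_setT_gt0 : (0 < mu setT)%E.
Proof.
rewrite (lt_le_trans (rat_cube_gt0 (0, 0%N)))//.
by apply: le_measure; rewrite ?inE//; exact: measurable_rat_cube.
Qed.

Lemma Lp_normy_le (f : RN -> R) (c : R) : continuous f ->
  (Lp_norm +oo f <= c%:E)%E -> forall x, `|f x| <= c.
Proof.
move=> cf; rewrite /Lp_norm unlock mu_setT_gt0 => /ess_supP H.
apply: ae_le_continuous; last by apply: filterS H => x /=; rewrite lee_fin.
by move=> x; apply: continuous_comp; [exact: cf|exact: norm_continuous].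
Qed.

(** The complement of the support is covered by rational cubes on which [f] vanishes almost
    everywhere. There are countably many of them, so [f] vanishes almost everywhere on their
    union. *)
Lemma spt_ae (A : set RN) (f : RN -> R) : closed A ->
  spt f `<=` A <-> {ae mu, forall x, ~ A x -> f x = 0}.
Proof.
move=> cA; split => [fA|fA x sx]; last first.
  apply: contrapT => nAx; apply: (sx (~` A)) => //; exact: closed_openC.
pose P p := {ae mu, forall y, rat_cube p y -> f y = 0}.
have H (p : 'rV[rat]_N * nat) : {ae mu, forall x, P p -> rat_cube p x -> f x = 0}.
  have [Pp|nPp] := pselect (P p); first by apply: filterS Pp => x + _; exact.
  by apply: nearW => x.
have {}H : {ae mu, forall x, forall n, forall p, unpickle n = Some p ->
    P p -> rat_cube p x -> f x = 0}.
  apply: ae_foralln => n; case E : (unpickle n) => [p|]; last exact: nearW.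
  by apply: filterS (H p) => x Hx _ [<-].
apply: filterS H => x Hx nAx.
have /existsNP[U] : ~ spt f x by move=> /fA.
move=> /not_implyP[oU /not_implyP[Ux /contrapT fU]].
have [p px pU] := rat_cube_nbhs oU Ux.
apply: (Hx (pickle p) p) => //; first exact: pickleK.
by apply: filterS fU => y Hy /pU.
Qed.

End measure_rV.

Lemma continuous_subr (R : realType) (V : normedModType R) (z : V) :
  continuous (fun x : V => x - z).
Proof. by move=> x; apply: cvgB; [exact: cvg_id|exact: cvg_cst]. Qed.

(** * Euclidean inner product and norm *)

Section euclid.
Variables (R : realType) (N : nat).
Local Notation RN := 'rV[R]_N.
Implicit Types x y z : RN.

Lemma dotC x y : dot x y = dot y x.
Proof. by apply: eq_bigr => i _; rewrite mulrC. Qed.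

Lemma dotDl x y z : dot (x + y) z = dot x z + dot y z.
Proof. by rewrite -big_split; apply: eq_bigr => i _; rewrite mxE mulrDl. Qed.

Lemma dotZl a x z : dot (a *: x) z = a * dot x z.
Proof. by rewrite mulr_sumr; apply: eq_bigr => i _; rewrite mxE mulrA. Qed.

Lemma dotNl x z : dot (- x) z = - dot x z.
Proof. by rewrite -scaleN1r dotZl mulN1r. Qed.

Lemma dotBl x y z : dot (x - y) z = dot x z - dot y z.
Proof. by rewrite dotDl dotNl. Qed.

Lemma dotDr x y z : dot z (x + y) = dot z x + dot z y.
Proof. by rewrite dotC dotDl !(dotC z). Qed.

Lemma dotZr a x z : dot z (a *: x) = a * dot z x.
Proof. by rewrite dotC dotZl dotC. Qed.

Lemma dotNr x z : dot z (- x) = - dot z x.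
Proof. by rewrite dotC dotNl dotC. Qed.

Lemma dotBr x y z : dot z (x - y) = dot z x - dot z y.
Proof. by rewrite dotDr dotNr. Qed.

Lemma dot_sumr (I : Type) (s : seq I) (f : I -> RN) x :
  dot x (\sum_(i <- s) f i) = \sum_(i <- s) dot x (f i).
Proof.
elim: s => [|i s IH].
  by rewrite !big_nil /dot big1// => i _; rewrite mxE mulr0.
by rewrite !big_cons dotDr IH.
Qed.

Lemma dot0l x : dot 0 x = 0.
Proof. by rewrite /dot big1// => i _; rewrite mxE mul0r. Qed.

Lemma dot_ge0 x : 0 <= dot x x.
Proof. by apply: sumr_ge0 => i _; rewrite -expr2 sqr_ge0. Qed.

Lemma enormE x : enorm x = Num.sqrt (dot x x).
Proof.
by rewrite /enorm big_ord1; congr Num.sqrt; apply: eq_bigr.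
Qed.

Lemma enorm_ge0 m n (A : 'M[R]_(m, n)) : 0 <= enorm A.
Proof. exact: sqrtr_ge0. Qed.

Lemma sqr_enorm x : enorm x ^+ 2 = dot x x.
Proof. by rewrite enormE sqr_sqrtr// dot_ge0. Qed.

Lemma coord_le_enorm m n (A : 'M[R]_(m, n)) i j : `|A i j| <= enorm A.
Proof.
rewrite -sqrtr_sqr ler_wsqrtr// (bigD1 i)//= (bigD1 j)//= -addrA lerDl.
by rewrite addr_ge0// ?sumr_ge0// => k _; rewrite ?sumr_ge0// => *; rewrite sqr_ge0.
Qed.

Lemma enorm0 : enorm (0 : RN) = 0.
Proof. by rewrite enormE dot0l sqrtr0. Qed.

Lemma enorm_eq0 x : enorm x = 0 -> x = 0.
Proof.
move=> x0; apply/rowP => i; rewrite mxE; apply/normr0_eq0/eqP.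
by rewrite eq_le normr_ge0 -x0 coord_le_enorm.
Qed.

Lemma enorm_gt0 x : x != 0 -> 0 < enorm x.
Proof.
by move=> x0; rewrite lt_neqAle enorm_ge0 andbT eq_sym; apply: contra x0 => /eqP/enorm_eq0->.
Qed.

Lemma enormZ a x : enorm (a *: x) = `|a| * enorm x.
Proof. by rewrite !enormE dotZl dotZr mulrA -expr2 sqrtrM ?sqr_ge0// sqrtr_sqr. Qed.

Lemma enormN x : enorm (- x) = enorm x.
Proof. by rewrite !enormE dotNl dotNr opprK. Qed.

Lemma enormB x y : enorm (x - y) = enorm (y - x).
Proof. by rewrite -enormN opprB. Qed.

Lemma cauchy_schwarz x y : dot x y <= enorm x * enorm y.
Proof.
have [->|y0] := eqVneq y 0.
  by rewrite dotC dot0l mulr_ge0// enorm_ge0.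
have ny := enorm_gt0 y0.
(* The square expands to 2 |x| |y| (|x| |y| - x . y). *)
have H := dot_ge0 (enorm y *: x - enorm x *: y).
rewrite !(dotBl, dotBr, dotZl, dotZr) -!sqr_enorm (dotC y x) in H.
have [x0|x0] := eqVneq x 0; first by rewrite x0 dot0l mulr_ge0 ?enorm_ge0.
have nx := enorm_gt0 x0.
have {}H : 0 <= (enorm x * enorm y) * (enorm x * enorm y - dot x y) * 2.
  by apply: le_trans H _; rewrite le_eqVlt; apply/orP; left; apply/eqP; ring.
rewrite pmulr_lge0// pmulr_rge0 ?mulr_gt0// in H.
by rewrite -subr_ge0.
Qed.

Lemma norm_dot_le x y : `|dot x y| <= enorm x * enorm y.
Proof.
rewrite ler_norml cauchy_schwarz andbT lerNl -dotNl -(enormN x).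
exact: cauchy_schwarz.
Qed.

Lemma enormD x y : enorm (x + y) <= enorm x + enorm y.
Proof.
rewrite -(@ler_pXn2r _ 2)// ?nnegrE ?addr_ge0 ?enorm_ge0//.
rewrite sqr_enorm dotDl !dotDr -!sqr_enorm (dotC y x) sqrrD.
have := cauchy_schwarz x y; lra.
Qed.

Lemma enorm_triangle y x z : enorm (x - z) <= enorm (x - y) + enorm (y - z).
Proof. by rewrite (_ : x - z = (x - y) + (y - z)) ?enormD// addrA subrK. Qed.

Lemma enorm_sum (I : Type) (s : seq I) (f : I -> RN) :
  enorm (\sum_(i <- s) f i) <= \sum_(i <- s) enorm (f i).
Proof.
elim: s => [|i s IH]; first by rewrite !big_nil enorm0.
by rewrite !big_cons (le_trans (enormD _ _))// lerD.
Qed.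

Lemma norm_le_enorm x : `|x| <= enorm x.
Proof.
rewrite [leLHS]/Num.Def.normr /= mx_normrE.
by apply/bigmax_leP; split => [|[i j] _ /=]; [exact: enorm_ge0|exact: coord_le_enorm].
Qed.

Lemma sum_coord_le x : \sum_i `|x ord0 i| <= N%:R * enorm x.
Proof.
apply: (@le_trans _ _ (\sum_(i < N) enorm x)); first by apply: ler_sum => i _; exact: coord_le_enorm.
by rewrite sumr_const card_ord mulr_natl.
Qed.

Lemma continuous_dot (T : topologicalType) (f g : T -> RN) :
  continuous f -> continuous g -> continuous (fun t => dot (f t) (g t)).
Proof.
move=> cf cg t; rewrite /dot; elim: (index_enum _) => [|i s IH].
  rewrite (_ : (fun t => _) = fun=> 0); first exact: cvg_cst.
  by apply/funext => y; rewrite big_nil.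
rewrite (_ : (fun t => _) =
  fun t => f t ord0 i * g t ord0 i + \sum_(j <- s) f t ord0 j * g t ord0 j).
  apply: cvgD IH; apply: cvgM.
    exact: (continuous_comp (cf t) (@coord_continuous _ _ _ ord0 i _)).
  exact: (continuous_comp (cg t) (@coord_continuous _ _ _ ord0 i _)).
by apply/funext => y; rewrite big_cons.
Qed.

Lemma continuous_enorm : continuous (@enorm R 1 N).
Proof.
rewrite (_ : @enorm R 1 N = fun x => Num.sqrt (dot x x)); last first.
  by apply/funext => x; exact: enormE.
move=> x; apply: (@continuous_comp _ _ _ (fun x => dot x x) Num.sqrt).
  by apply: continuous_dot => y; exact: cvg_id.
exact: sqrt_continuous.
Qed.

Lemma continuous_enormB z : continuous (fun x : RN => enorm (x - z)).
Proof.
move=> x; apply: (@continuous_comp _ _ _ (fun x => x - z) (@enorm R 1 N)).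
  exact: continuous_subr.
exact: (@continuous_enorm (x - z)).
Qed.

Lemma near_enorm x e : 0 < e -> \forall y \near x, enorm (y - x) < e.
Proof.
have H : enorm (y - x) @[y --> x] --> (0 : R).
  by have := @continuous_enormB x x; rewrite /continuous_at subrr enorm0.
by move=> e0; exact: (cvgr_lt _ H).
Qed.

Lemma enorm_ball_compact x r : compact [set y | enorm (y - x) <= r].
Proof.
apply: bounded_closed_compact; last first.
  have := closed_comp (fun y _ => @continuous_enormB x y) (@closed_le R r).
  by [].
exists (r + enorm x); split; first exact: num_real.
move=> M rM y /= yr; rewrite (le_trans (norm_le_enorm _))//.
have := enormD (y - x) x; rewrite subrK => /le_trans; apply.
by rewrite ltW// (le_lt_trans _ rM)// lerD2r.
Qed.

End euclid.

(** * First-order conditions along lines *)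

Section first_order.
Variables (R : realType) (V : normedModType R).

Lemma is_derive_expansion (f : V -> R) x v l : is_derive x v f l ->
  forall e, 0 < e -> exists2 de, 0 < de &
    forall h, `|h| < de -> `|f (h *: v + x) - f x - h * l| <= e * `|h|.
Proof.
move=> [/cvg_ex[/= l' fl] dl] e e0.
have {dl}ll : l' = l by rewrite -dl; exact/esym/cvg_lim.
rewrite {}ll in fl.
have /cvgrPdist_le/(_ e e0)/= := fl.
rewrite near_withinE => /nbhs_ballP[de /= de0 Hde]; exists de => // h hde.
have [->|h0] := eqVneq h 0; first by rewrite scale0r add0r subrr mul0r subr0 !normr0 mulr0.
have := Hde h; rewrite /ball /= sub0r normrN => /(_ hde h0).
rewrite /GRing.scale/= => H.
have -> : f (h *: v + x) - f x - h * l = - h * (l - h^-1 * (f (h *: v + x) - f x)).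
  by field.
by rewrite normrM normrN mulrC ler_wpM2r.
Qed.

Lemma is_derive_at_min (f : V -> R) x v l : is_derive x v f l ->
  (forall h, f x <= f (h *: v + x)) -> l = 0.
Proof.
move=> fl fx; apply/eqP; rewrite -normr_le0; apply/ler_addgt0Pl => e e0.
rewrite addr0.
have [de de0 H] := is_derive_expansion fl e0.
have d2 : `|de / 2| < de by rewrite gtr0_norm; lra.
have d2' : `|- (de / 2)| < de by rewrite normrN.
have := H _ d2; have := H _ d2'; have := fx (de / 2); have := fx (- (de / 2)).
move: (f _) (f _) (f _) => u1 u2 u3; rewrite normrN (gtr0_norm (_ : 0 < de / 2)) ?divr_gt0//.
rewrite !ler_norml => a b /andP[c1 c2] /andP[c3 c4].
have de20 : 0 < de / 2 by rewrite divr_gt0.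
apply/andP; split; rewrite -(ler_pM2l de20); lra.
Qed.

Lemma continuousP_near (f : V -> R) :
  (forall x e, 0 < e -> \forall y \near x, `|f x - f y| < e) -> continuous f.
Proof. by move=> H x; apply/cvgrPdist_lt => e e0; exact: H. Qed.

End first_order.

(** * Distance to a set *)

Section sdist.
Variables (R : realType) (N : nat).
Local Notation RN := 'rV[R]_N.
Implicit Types (x y z : RN) (G : set RN).

(** [dist_boundary Omega] unfolds to [sdist (boundary Omega)], so the same lemmas serve for the
    distances to the boundary and to the core. *)
Definition sdist G x : R := inf [set enorm (x - w) | w in G].

Lemma sdist_le G x w : G w -> sdist G x <= enorm (x - w).
Proof.
move=> Gw; apply: ge_inf; last by exists w.
by exists 0 => _ [y _ <-]; exact: enorm_ge0.
Qed.

Lemma sdist_ge G x c : G !=set0 -> (forall w, G w -> c <= enorm (x - w)) ->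
  c <= sdist G x.
Proof.
move=> [w Gw] H; apply: lb_le_inf; first by exists (enorm (x - w)); exists w.
by move=> _ [y Gy <-]; exact: H.
Qed.

Lemma sdist_ge0 G x : G !=set0 -> 0 <= sdist G x.
Proof. by move=> G0; apply: sdist_ge => // w _; exact: enorm_ge0. Qed.

Lemma sdist_attained G x : closed G -> G !=set0 ->
  exists2 p, G p & enorm (x - p) = sdist G x.
Proof.
move=> cG [w0 Gw0].
have cK : compact ([set y | enorm (y - x) <= enorm (w0 - x)] `&` G).
  by apply: compact_closedI => //; exact: enorm_ball_compact.
have [|p] := EVT_min_rV _ cK (continuous_subspaceT (@continuous_enormB R N x)).
  by exists w0; split => //=.
rewrite inE => -[/= _ Gp] Hp; exists p => //.
apply/eqP; rewrite eq_le sdist_le// andbT.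
apply: sdist_ge; first by exists w0.
move=> w Gw; have [ww|/ltW ww] := leP (enorm (w - x)) (enorm (w0 - x)).
  by rewrite enormB (enormB x) Hp// inE; split.
apply: (@le_trans _ _ (enorm (w0 - x))); last by rewrite (enormB x).
by rewrite enormB Hp// inE; split => //=.
Qed.

Lemma sdist_lip G x y : G !=set0 -> sdist G x <= sdist G y + enorm (x - y).
Proof.
move=> G0; rewrite -lerBlDr; apply: sdist_ge => // w Gw.
rewrite lerBlDr (le_trans (sdist_le x Gw))// [leRHS]addrC; exact: enorm_triangle.
Qed.

Lemma continuous_sdist G : G !=set0 -> continuous (sdist G).
Proof.
move=> G0; apply: continuousP_near => x e e0; near=> y.
have xy : enorm (y - x) < e by near: y; exact: near_enorm.
rewrite ltr_norml; have := sdist_lip x y G0; have := sdist_lip y x G0.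
by rewrite (enormB x) => H1 H2; apply/andP; split; lra.
Unshelve. all: by end_near. Qed.

Lemma is_derive_enorm p x v : x != p ->
  is_derive x v (fun y => enorm (y - p)) (dot (x - p) v / enorm (x - p)).
Proof.
move=> xp; have n0 : 0 < enorm (x - p) by apply: enorm_gt0; rewrite subr_eq0.
have d1 : is_derive x v (fun y => dot (y - p) (y - p)) (2 * dot (x - p) v).
  have -> : (fun y => dot (y - p) (y - p)) = \sum_(i < N) (fun y : RN => (y ord0 i - p ord0 i) ^+ 2).
    apply/funext => y; rewrite fct_sumE; apply: eq_bigr => i _.
    by rewrite !mxE expr2.
  have -> : 2 * dot (x - p) v = \sum_(i < N) (2 * (x ord0 i - p ord0 i) * v ord0 i).
    by rewrite /dot mulr_sumr; apply: eq_bigr => i _; rewrite !mxE mulrA.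
  apply: is_derive_sum => i.
  have d2 : is_derive x v (fun y : RN => y ord0 i - p ord0 i) (v ord0 i).
    by rewrite -[X in is_derive _ _ _ X]subr0; apply: is_deriveB; exact: is_derive_coord.
  by have := is_derive_exprn 2 d2; rewrite expr1.
have dd : 0 < dot (x - p) (x - p) by rewrite -sqr_enorm exprn_gt0.
have := is_derive_comp d1 (is_derive1_sqrt dd).
rewrite (_ : (fun y => _) = (fun y => enorm (y - p))); last first.
  by apply/funext => y; rewrite enormE.
move=> H; apply: is_derive_eq H _; rewrite -enormE; field.
by rewrite gt_eqF.
Qed.

End sdist.

Section crossing.
Variables (R : realType) (N : nat).
Local Notation RN := 'rV[R]_N.
Implicit Types (x y z : RN) (A : set RN).

Lemma continuous_line x v : continuous (fun t : R => t *: v + x).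
Proof. by move=> t; apply: cvgD; [apply: cvgZr_tmp; exact: cvg_id|exact: cvg_cst]. Qed.

(** Take the first point of the segment outside the interior, which exists by compactness: the
    points just before it are interior, so it lies in the closure. *)
Lemma segment_meets_boundary A x y : (interior A) x -> ~ (interior A) y ->
  exists2 t : R, 0 <= t <= 1 & boundary A (t *: (y - x) + x).
Proof.
move=> Ax nAy; pose g t : RN := t *: (y - x) + x.
have cK : compact ([set t : R | 0 <= t <= 1] `&` (g @^-1` ~` interior A)).
  apply: compact_closedI.
    rewrite (_ : [set t : R | 0 <= t <= 1] = `[0, 1]%classic); first exact: segment_compact.
    by apply/seteqP; split => t /=; rewrite in_itv.
  apply: closed_comp => [t _|]; first exact: continuous_line.
  by apply: open_closedC; exact: open_interior.
have ci : continuous (fun t : R => t) by move=> t; exact: cvg_id.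
have [|t] := compact_EVT_min _ cK (continuous_subspaceT ci).
  by exists 1; split => /=; rewrite ?ler01 ?lexx// /g scale1r subrK.
move=> /set_mem[t01 ngt] mint; have /andP[t0 t1] : 0 <= t <= 1 := t01.
exists t; first by rewrite t0.
split => //; move=> B /(continuous_line).
have {}t0 : 0 < t.
  rewrite lt_neqAle t0 andbT; apply/eqP => t00; apply: ngt.
  by rewrite /g -t00 scale0r add0r.
move=> /nbhs_ballP[e /= e0 eB].
(* A time just before [t]; the minimum keeps it nonnegative. *)
pose s := t - Num.min (e / 2) t.
have m0 : 0 < Num.min (e / 2) t by rewrite lt_min t0 divr_gt0.
exists (g s); split; last first.
  apply: eB; rewrite /ball/= /s opprB addrC subrK gtr0_norm//.
  by rewrite (le_lt_trans (_ : _ <= e / 2)) ?ge_min ?lexx//; lra.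
apply: interior_subset; apply: contrapT => ngs.
have : t <= s.
  apply: mint; rewrite inE; split => //=; rewrite /s.
  by rewrite subr_ge0 ge_min lexx orbT/=; lra.
by rewrite /s /=; lra.
Qed.

End crossing.

Lemma cvg_near (R : realType) (V : normedModType R) (T : Type) (F : set_system T)
    (f : T -> V) (l : V) : Filter F ->
  (forall e, 0 < e -> \forall t \near F, `|l - f t| < e) -> f t @[t --> F] --> l.
Proof. by move=> FF H; apply/cvgrPdist_lt. Qed.

(** * Geometry of the collar: normals, the core and its nearest points *)

Section domain.
Variables (R : realType) (N : nat).
Local Notation RN := 'rV[R]_N.
Variables (Omega U : set RN) (r : R).
Hypotheses (oU : open U) (OmegaE : Omega = closure U).
Hypotheses (bd0 : boundary Omega !=set0) (r0 : 0 < r).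
Hypothesis Cd : Ck_upto_boundary (tubular (boundary Omega) r `&` interior Omega)
  (boundary Omega) 2 (dist_boundary Omega).
Local Notation bd := (boundary Omega).
Local Notation int := (interior Omega).
Local Notation d := (dist_boundary Omega).
Local Notation n := (inward_normal Omega).
Implicit Types (x y p c h : RN).

Lemma closed_domain : closed Omega.
Proof. by rewrite OmegaE; exact: closed_closure. Qed.

Lemma boundaryE : bd = Omega `&` ~` int.
Proof.
by rewrite /boundary setDE; congr (_ `&` _); exact/esym/closure_id/closed_domain.
Qed.

Lemma closed_boundary : closed bd.
Proof.
rewrite boundaryE; apply: closedI; first exact: closed_domain.
by apply: open_closedC; exact: open_interior.
Qed.

Lemma sub_interior : U `<=` int.
Proof.
move=> x Ux; have : nbhs x U by exact: open_nbhs_nbhs.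
by apply: filterS; rewrite OmegaE; exact: subset_closure.
Qed.

Lemma domain_cases x : Omega x -> int x \/ bd x.
Proof.
by move=> Ox; have [ix|nx] := pselect (int x); [left|right; rewrite boundaryE].
Qed.

Lemma dist_le p x : bd p -> d x <= enorm (x - p).
Proof. exact: sdist_le. Qed.

Lemma dist_attained x : exists2 p, bd p & enorm (x - p) = d x.
Proof. exact: sdist_attained closed_boundary bd0. Qed.

Lemma dist_lip x y : d x <= d y + enorm (x - y).
Proof. exact: sdist_lip. Qed.

Lemma dist_le_out x y : int x -> ~ int y -> d x <= enorm (x - y).
Proof.
move=> ix ny; have [t /andP[t0 t1] bz] := segment_meets_boundary ix ny.
apply: le_trans (dist_le _ bz) _.
rewrite opprD addrCA subrr addr0 enormN enormZ ger0_norm// (enormB x).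
by rewrite ler_piMl// enorm_ge0.
Qed.

Lemma dist_gt0 x : int x -> 0 < d x.
Proof.
move=> ix; have [p bp <-] := dist_attained x.
apply: enorm_gt0; rewrite subr_eq0; apply/eqP => xp.
by move: bp; rewrite boundaryE -xp => -[].
Qed.

Lemma collar_tubular x : int x -> d x < r -> (tubular bd r `&` int) x.
Proof.
by move=> ix xr; split => //; have [p bp E] := dist_attained x; exists p; rewrite ?E.
Qed.

(** The function |y - p| - d y is nonnegative and vanishes at [x], so its directional derivatives
    vanish there. The hypothesis supplies the differentiability of [d], and minimality then forces
    the value. *)
Lemma derive_dist x p h : int x -> d x < r -> bd p -> enorm (x - p) = d x ->
  is_derive x h d (dot (x - p) h / d x).
Proof.
move=> ix xr bp xp.
have [[_ /(_ h)[dd _]] _] := Cd.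
have {}dd : derivable d x h by apply: dd; exact: collar_tubular.
have xNp : x != p.
  by apply/eqP => E; have := dist_gt0 ix; rewrite -xp E subrr enorm0 ltxx.
have de := is_derive_enorm h xNp.
have H := is_deriveB de (derivableP dd).
have E : dot (x - p) h / enorm (x - p) - 'D_h d x = 0.
  apply: is_derive_at_min H _ => t.
  rewrite -[X in X <= _]/(enorm (x - p) - d x) -[X in _ <= X]/(enorm (_ - p) - d (t *: h + x)).
  by rewrite xp subrr subr_ge0 dist_le.
rewrite -xp; move/eqP : E; rewrite subr_eq0 => /eqP ->; exact: derivableP.
Qed.

(** By the triangle inequality d y >= d x - |x - y| = s d x. The point is interior because |x - y| =
    (1 - s) d x is less than the distance from [x] to any point that is not. *)
Lemma dist_segment x p s : int x -> bd p -> enorm (x - p) = d x -> 0 < s <= 1 ->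
  let y := s *: (x - p) + p in
  [/\ int y, d y = s * d x & enorm (y - p) = s * d x].
Proof.
move=> ix bp xp /andP[s0 s1] y.
have dx := dist_gt0 ix.
have yp : enorm (y - p) = s * d x by rewrite /y addrK enormZ gtr0_norm// xp.
have xy : enorm (x - y) = (1 - s) * d x.
  have -> : x - y = (1 - s) *: (x - p) by apply/rowP => i; rewrite !mxE; ring.
  by rewrite enormZ ger0_norm ?subr_ge0// xp.
split => //.
  apply: contrapT => niy; have := dist_le_out ix niy; rewrite xy.
  by apply/negP; rewrite -ltNge; nra.
apply/eqP; rewrite eq_le -{1}yp dist_le//=.
have := dist_lip x y; rewrite xy; lra.
Qed.

(** Along the segment from [x] to [p] the gradient of [d] is constantly (x - p) / d x. Since the
    gradient has a limit at [p] by hypothesis, this constant is the limit. *)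
Lemma inward_normalE x p : int x -> d x < r -> bd p -> enorm (x - p) = d x ->
  n p = (d x)^-1 *: (x - p).
Proof.
move=> ix xr bp xp; have dx := dist_gt0 ix.
have gradE s : 0 < s <= 1 -> forall i,
    'D_(basis_vec R i) d (s *: (x - p) + p) = (x - p) ord0 i / d x.
  move=> s01 i; have [iy dy yp] := dist_segment ix bp xp s01.
  case/andP: (s01) => s0 s1.
  have yr : d (s *: (x - p) + p) < r by rewrite dy; apply: le_lt_trans xr; nra.
  have [_ ->] := derive_dist (basis_vec R i) iy yr bp (etrans yp (esym dy)).
  rewrite addrK dotZl dy /dot (bigD1 i)//= big1 => [|j ji]; rewrite !mxE/=.
    by rewrite !eqxx /= mulr1 addr0; field; rewrite !gt_eqF.
  by rewrite (negbTE ji) ?andbF mulr0.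
have cvgD i : 'D_(basis_vec R i) d y @[y --> within (tubular bd r `&` int) (nbhs p)]
    --> (x - p) ord0 i / d x.
  have [_ [_ /(_ (basis_vec R i))[/(_ p bp) + _]]] := Cd.
  move=> /cvg_ex[/= l dl]; suff -> : (x - p) ord0 i / d x = l by [].
  apply/eqP; rewrite -subr_eq0 -normr_le0; apply/ler_addgt0Pl => e e0; rewrite addr0.
  have /cvgrPdist_le/(_ e e0) := dl; rewrite near_withinE => H.
  have Hl := continuous_line (x := p) (v := x - p) (x0 := 0).
  have : nbhs (0 *: (x - p) + p) (fun y => (tubular bd r `&` int) y ->
     `|l - 'D_(basis_vec R i) d y| <= e) by rewrite scale0r add0r.
  move=> /Hl /nbhs_ballP[de /= de0 Hde].
  (* A point of the segment close enough to [p] to compare the limit [l] with the constant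
     gradient. *)
  pose s := Num.min 1 (de / 2).
  have s0 : 0 < s by rewrite lt_min ltr01 divr_gt0.
  have s01 : 0 < s <= 1 by rewrite s0 ge_min lexx.
  have [iy dy yp] := dist_segment ix bp xp s01.
  have := Hde s; rewrite /ball /= sub0r normrN gtr0_norm//.
  have sde : s < de by rewrite gt_min; apply/orP; right; lra.
  move=> /(_ sde); rewrite gradE// distrC; apply.
  apply: collar_tubular => //; rewrite dy; apply: le_lt_trans xr.
  by case/andP: s01 => _ s1; nra.
suff : grad d y @[y --> within int (nbhs p)] --> (d x)^-1 *: (x - p).
  (* Properness makes the limit unique; it holds because [p] is in the closure of [U], which is
     contained in the interior of Omega. *)
  have ip : ProperFilter (within int (nbhs p)).
    apply: Build_ProperFilter_ex => P nP.
    have Op : closure U p by move: bp; rewrite boundaryE OmegaE => -[].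
    by have [y [Uy Py]] := Op _ nP; exists y; apply: Py; exact: sub_interior.
  exact: cvg_lim.
apply: (@cvg_near _ _ _ (within int (nbhs p))) => e e0.
have H (i : 'I_N) : \forall y \near p, int y ->
    `|(x - p) ord0 i / d x - 'D_(basis_vec R i) d y| < e.
  have /cvgrPdist_lt/(_ e e0) := cvgD i; rewrite near_withinE => Hi.
  near=> y => iy; apply: (near Hi y) => //; split => //.
  by exists p => //; near: y; exact: near_enorm.
have {}H := filter_forall _ H.
rewrite near_withinE; near=> y => iy; apply: norm_lt_coord => // i.
have : forall i, int y -> `|(x - p) ord0 i / d x - 'D_(basis_vec R i) d y| < e.
  by near: y; exact: H.
by move=> /(_ i iy); rewrite !mxE mulrC.
Unshelve. all: by end_near. Qed.

(* Maximize [d - k |x - .|] on a ball: at an interior maximum, moving away from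
   the nearest boundary point would increase [d] at unit speed. *)
Lemma dist_growth x a k : int x -> d x < a -> 0 < k < 1 ->
  d x + (a - d x) / k < r ->
  exists c, [/\ int c, a <= d c & enorm (x - c) <= (a - d x) / k].
Proof.
move=> ix xa /andP[k0 k1]; set t1 := (a - d x) / k; move=> xr.
have t10 : 0 < t1 by rewrite divr_gt0// subr_gt0.
have cK : compact ([set y | enorm (y - x) <= t1] `&` Omega).
  by apply: compact_closedI; [exact: enorm_ball_compact|exact: closed_domain].
have cf : continuous (fun y => d y - k * enorm (y - x)).
  apply: continuousP_near => z e e0; near=> y.
  have yz : enorm (y - z) < e / 2 by near: y; apply: near_enorm; rewrite divr_gt0.
  have h1 := dist_lip y z; have h2 := dist_lip z y; rewrite (enormB z y) in h2.
  have h3 := enorm_triangle z y x; have h4 := enorm_triangle y z x.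
  rewrite (enormB z y) in h4; have Y0 := enorm_ge0 (y - z).
  move: (enorm (z - x)) (enorm (y - x)) (enorm (y - z)) h1 h2 h3 h4 yz Y0.
  move: (d y) (d z) => u1 u2 A B Y h1 h2 h3 h4 yz Y0.
  have kAB : `|k * (A - B)| <= Y.
    rewrite normrM gtr0_norm//; apply: (@le_trans _ _ `|A - B|).
      by rewrite ler_piMl// ltW.
    by rewrite ler_norml; apply/andP; split; lra.
  by move: kAB; rewrite ler_norml ltr_norml => /andP[c1 c2]; apply/andP; split; lra.
have [|c] := EVT_max_rV _ cK (continuous_subspaceT cf).
  by exists x; split => /=; [rewrite subrr enorm0 ltW|exact: interior_subset].
rewrite inE => -[/= cx Oc] cmax.
have cmaxx : d x <= d c - k * enorm (c - x).
  have : x \in [set y | enorm (y - x) <= t1] `&` Omega.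
    by rewrite inE; split => /=; [rewrite subrr enorm0 ltW|exact: interior_subset].
  by move=> /cmax; rewrite subrr enorm0 mulr0 subr0.
have dx := dist_gt0 ix.
have en0 := enorm_ge0 (c - x).
have ic : int c.
  have [//|bc] := domain_cases Oc.
  have := dist_le c bc; rewrite subrr enorm0 => dc.
  have : 0 <= k * enorm (c - x) by rewrite mulr_ge0// ltW.
  lra.
have cr : d c < r.
  by apply: le_lt_trans xr; have := dist_lip c x; lra.
exists c; split => //; last by rewrite enormB.
have [ct|tc] := ltP (enorm (c - x)) t1; last first.
  have -> : a = d x + k * t1 by rewrite /t1; field; rewrite gt_eqF.
  have : k * t1 <= k * enorm (c - x) by rewrite ler_wpM2l// ltW.
  lra.
exfalso.
have [p bp cp] := dist_attained c.
have dc := dist_gt0 ic.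
pose e := (d c)^-1 *: (c - p).
have ee : enorm e = 1 by rewrite enormZ gtr0_norm ?invr_gt0// cp mulVf ?gt_eqF.
have := derive_dist e ic cr bp cp.
have -> : dot (c - p) e / d c = 1.
  by rewrite dotZr -sqr_enorm cp; field; rewrite gt_eqF.
(* In the direction [e] the distance grows at rate 1 and the penalty at rate at most [k]: an error
   of half the gap 1 - k still leaves a strict gain, against maximality. *)
have k2 : 0 < (1 - k) / 2 by lra.
move=> /is_derive_expansion /(_ _ k2)[de de0 Hde].
have near_int : \forall y \near c, int y.
  by apply: open_nbhs_nbhs; split => //; exact: open_interior.
have near_int0 : \forall h \near (0 : R), int (h *: e + c).
  have := continuous_line (x := c) (v := e) (x0 := 0).
  by rewrite /continuous_at scale0r add0r; apply.
have /nbhs_ballP[g /= g0 Hg] := near_int0.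
pose h := Num.min (de / 2) (Num.min (g / 2) (t1 - enorm (c - x))).
have h0 : 0 < h by rewrite !lt_min !divr_gt0// subr_gt0.
have hde : h < de by rewrite gt_min; apply/orP; left; lra.
have hg : h < g by rewrite !gt_min; apply/orP; right; apply/orP; left; lra.
have ht : h <= t1 - enorm (c - x) by rewrite !ge_min lexx !orbT.
have := Hde h; rewrite gtr0_norm// mulr1 => /(_ hde); rewrite ler_norml => /andP[Hd _].
have iy : int (h *: e + c) by apply: Hg; rewrite /ball /= sub0r normrN gtr0_norm.
have yx : enorm (h *: e + c - x) <= h + enorm (c - x).
  by rewrite -addrA (le_trans (enormD _ _))// enormZ ee mulr1 gtr0_norm.
have : h *: e + c \in [set y | enorm (y - x) <= t1] `&` Omega.
  rewrite inE; split => /=; last exact: interior_subset.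
  by apply: le_trans yx _; lra.
move=> /cmax; apply/negP; rewrite -ltNge.
have : k * enorm (h *: e + c - x) <= k * (h + enorm (c - x)) by rewrite ler_wpM2l// ltW.
nra.
Unshelve. all: by end_near. Qed.

Variable a : R.
Hypotheses (a0 : 0 < a) (ar : a < r).

Definition inner_core : set RN := [set c | int c /\ a <= d c].
Local Notation G := inner_core.
Local Notation D := (sdist inner_core).

Lemma closed_inner_core : closed G.
Proof.
have cd : continuous d by exact: continuous_sdist.
rewrite (_ : G = Omega `&` (d @^-1` [set t | a <= t])).
  by apply: closedI; [exact: closed_domain|apply: closed_comp => [x _|]; [exact: cd|exact: closed_ge]].
apply/seteqP; split => x [/= ix ax]; split => //; first exact: interior_subset.
have [//|bx] := domain_cases ix.
have := dist_le x bx; rewrite subrr enorm0 => dx.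
by have := lt_le_trans a0 (le_trans ax dx); rewrite ltxx.
Qed.

Lemma near_core x e : int x -> d x < a -> 0 < e ->
  exists2 c, G c & enorm (x - c) <= a - d x + e.
Proof.
move=> ix xa e0; have dx := dist_gt0 ix.
pose s := a - d x; have s0 : 0 < s by rewrite /s subr_gt0.
(* For the slope [s / (s + e1)] the search radius in [dist_growth] is [s + e1]; the bound (r - a) /
   2 keeps the depth [a + e1] that can be reached below [r]. *)
pose e1 := Num.min e ((r - a) / 2).
have e10 : 0 < e1 by rewrite lt_min e0 divr_gt0// subr_gt0.
have e1r : e1 <= (r - a) / 2 by rewrite ge_min lexx orbT.
have e1e : e1 <= e by rewrite ge_min lexx.
have sk : (a - d x) / (s / (s + e1)) = s + e1.
  by rewrite -/s; field; rewrite !gt_eqF// addr_gt0.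
have k01 : 0 < s / (s + e1) < 1.
  apply/andP; split; first by rewrite divr_gt0// addr_gt0.
  by rewrite ltr_pdivrMr; [rewrite mul1r ltrDl|exact: addr_gt0].
have [|c [ic ac]] := dist_growth ix xa k01; first by rewrite sk /s; lra.
by rewrite sk => xc; exists c => //; apply: le_trans xc _; rewrite /s; lra.
Qed.

(** A point of [U] near the boundary has depth less than [a], and [near_core] climbs from it to
    depth [a]. *)
Lemma inner_core0 : G !=set0.
Proof.
have [p bp] := bd0.
have Op : closure U p by move: bp; rewrite boundaryE OmegaE => -[].
have [u [Uu /= up]] := Op _ (near_enorm p a0).
have iu := sub_interior Uu.
have ua : d u < a by apply: le_lt_trans (dist_le u bp) up.
by have [c Gc _] := near_core iu ua ltr01; exists c.
Qed.

Lemma core_dist_ge x : a - d x <= D x.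
Proof.
apply: sdist_ge; first exact: inner_core0.
by move=> c [ic ac]; have := dist_lip c x; rewrite (enormB c); lra.
Qed.

Lemma core_distE x : int x -> d x < a -> D x = a - d x.
Proof.
move=> ix xa; apply/eqP; rewrite eq_le core_dist_ge andbT.
apply/ler_addgt0Pr => e e0; have [c Gc xc] := near_core ix xa e0.
exact: le_trans (sdist_le x Gc) xc.
Qed.

Lemma core_dist0 x : G x -> D x = 0.
Proof.
move=> Gx; apply/eqP; rewrite eq_le sdist_ge0 ?andbT; last exact: inner_core0.
by have := sdist_le x Gx; rewrite subrr enorm0.
Qed.

Lemma core_dist_out x : ~ int x -> a <= D x.
Proof.
move=> nx; apply: sdist_ge; first exact: inner_core0.
by move=> c [ic ac]; rewrite enormB; exact: le_trans ac (dist_le_out ic nx).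
Qed.

Lemma core_dist_le x : Omega x -> D x <= a.
Proof.
rewrite {1}OmegaE => cx; apply/ler_addgt0Pr => e e0.
have [u [Uu /= up]] := cx _ (near_enorm x e0).
have iu := sub_interior Uu.
have Du : D u <= a.
  have [ua|au] := ltP (d u) a; first by rewrite core_distE// gerBl ltW// dist_gt0.
  by rewrite core_dist0 ?ltW.
have := sdist_lip x u inner_core0; rewrite (enormB x); lra.
Qed.

(** If [c] is nearest to [x] in the core, then a <= d c <= |c - p| <= |c - x| + |x - p| = a. So [p]
    is also nearest to [c] on the boundary, and the formula for the normal, applied at [c],
    determines [c] from [p]. If [x] is on the boundary, [p] is [x]. *)
Lemma core_nearest x : Omega x -> 0 < D x ->
  exists p, [/\ bd p, enorm (x - p) = a - D x, int x -> d x = a - D x &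
    forall c, G c -> enorm (x - c) = D x -> c = p + a *: n p].
Proof.
move=> Ox Dx0.
suff [p [bp xp xd]] : exists p, [/\ bd p, enorm (x - p) = a - D x & int x -> d x = a - D x].
  exists p; split => // c [ic ac] xc.
  have cp : enorm (c - p) <= a.
    by have := enorm_triangle x c p; rewrite (enormB c x) xc xp; lra.
  have dc := dist_le c bp.
  have dca : d c = a by apply/eqP; rewrite eq_le ac andbT; lra.
  have cpa : enorm (c - p) = d c by apply/eqP; rewrite eq_le dc dca cp.
  have cr : d c < r by rewrite dca.
  rewrite (inward_normalE ic cr bp cpa) dca scalerA divff ?gt_eqF// scale1r.
  by rewrite addrC subrK.
have [ix|bx] := domain_cases Ox; last first.
  have nx : ~ int x by move: bx; rewrite boundaryE => -[].
  have Da : D x = a by apply/eqP; rewrite eq_le core_dist_le// core_dist_out.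
  by exists x; split => //; rewrite Da !subrr ?enorm0.
have [xa|ax] := ltP (d x) a; last first.
  by move: Dx0; rewrite core_dist0 ?ltxx.
have [p bp xp] := dist_attained x; have := core_distE ix xa => E.
by exists p; split => //; rewrite ?xp E; lra.
Qed.

Lemma core_nearest_unique x c c' : Omega x -> 0 < D x ->
  G c -> enorm (x - c) = D x -> G c' -> enorm (x - c') = D x -> c = c'.
Proof.
move=> Ox Dx Gc xc Gc' xc'; have [p [_ _ _ H]] := core_nearest Ox Dx.
by rewrite (H c)// (H c').
Qed.

(** Both points lie on the normal line at [p]: [x] at depth a - D x and [c] at depth [a]. *)
Lemma core_direction x c : int x -> 0 < D x -> G c -> enorm (x - c) = D x ->
  exists p, [/\ bd p, enorm (x - p) = a - D x & x - c = - (D x *: n p)].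
Proof.
move=> ix Dx Gc xc; have [p [bp xp dx H]] := core_nearest (interior_subset ix) Dx.
exists p; split => //.
have xr : d x < r by rewrite (dx ix) (lt_trans _ ar)// ltrBlDr ltrDl.
have dx0 := dist_gt0 ix.
rewrite (H c Gc xc) opprD addrA.
have := inward_normalE ix xr bp (etrans xp (esym (dx ix))).
move=> /(congr1 (fun y => d x *: y)); rewrite scalerA divff ?gt_eqF// scale1r => <-.
rewrite -scalerBl -scaleNr; congr (_ *: _); rewrite (dx ix).
by rewrite addrAC subrr sub0r.
Qed.

End domain.

(** * Log-sum-exp over a finite net *)

Section soft_distance.
Variables (R : realType) (N : nat).
Local Notation RN := 'rV[R]_N.
Implicit Types (x y c h : RN).

Lemma is_derive_sumseq (V : normedModType R) (I : Type) (s : seq I) (f : I -> V -> R)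
    (df : I -> R) (z v : V) :
  (forall i, is_derive z v (f i) (df i)) ->
  is_derive z v (fun t => \sum_(i <- s) f i t) (\sum_(i <- s) df i).
Proof.
move=> H; elim: s => [|i s IH].
  rewrite big_nil (_ : (fun t => _) = fun=> 0); first exact: is_derive_cst.
  by apply/funext => t; rewrite big_nil.
rewrite big_cons (_ : (fun t => _) = fun t => f i t + \sum_(j <- s) f j t).
  by apply: is_deriveD.
by apply/funext => t; rewrite big_cons.
Qed.

Lemma sumr_cst (I : Type) (s : seq I) (b : R) : \sum_(i <- s) b = (size s)%:R * b.
Proof.
by elim: s => [|i s IH]; rewrite ?big_nil ?mul0r// big_cons IH /= -natr1 mulrDl mul1r addrC.
Qed.

Lemma dot_le_half x y : dot x y <= (dot x x + dot y y) / 2.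
Proof. by have := dot_ge0 (x - y); rewrite dotBl !dotBr (dotC y x); lra. Qed.

Lemma is_derive_dotl x h c : is_derive x h (fun y : RN => dot y c) (dot h c).
Proof.
rewrite /dot; apply: (@is_derive_sumseq RN _ _ (fun (i : 'I_N) (y : RN) => y ord0 i * c ord0 i)) => i.
have := is_deriveM (is_derive_coord i x h) (is_derive_cst (c ord0 i) x h).
rewrite scaler0 add0r => H; apply: is_derive_eq H _.
by rewrite /GRing.scale/= mulrC.
Qed.

Lemma is_derive_sqr x h : is_derive x h (fun y : RN => dot y y) (2 * dot x h).
Proof.
rewrite /dot mulr_sumr.
apply: (@is_derive_sumseq RN _ _ (fun (i : 'I_N) (y : RN) => y ord0 i * y ord0 i)) => i.
have := is_deriveM (is_derive_coord i x h) (is_derive_coord i x h).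
by move=> H; apply: is_derive_eq H _; rewrite /GRing.scale/=; ring.
Qed.

Lemma Ck_on_dotl k c : Ck_on setT k (fun y : RN => dot y c).
Proof.
apply: Ck_on_sum => [|i]; first exact: openT.
by apply: Ck_onM; [exact: openT|exact: Ck_on_coord|exact: Ck_on_cst].
Qed.

Lemma Ck_on_sqr k : Ck_on setT k (fun y : RN => dot y y).
Proof.
apply: Ck_on_sum => [|i]; first exact: openT.
by apply: Ck_onM; [exact: openT|exact: Ck_on_coord|exact: Ck_on_coord].
Qed.

Variables (s : seq RN) (c0 : RN) (eps : R).
Hypotheses (sc0 : c0 \in s) (eps0 : 0 < eps).

(* Up to the factor [expR (- |x|^2 / (2 eps))], which [soft_half_sqdist] restores,
   the weight of [c] is [expR (- |x - c|^2 / (2 eps))]: for small [eps] the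
   log-sum-exp is close to the minimum of [|x - c|^2 / 2]. *)
Definition soft_weight c x : R := expR (eps^-1 * (dot x c - dot c c / 2)).
Definition soft_total x : R := \sum_(c <- s) soft_weight c x.
Definition soft_half_sqdist x : R := dot x x / 2 - eps * ln (soft_total x).
Definition soft_mean x : RN :=
  (soft_total x)^-1 *: \sum_(c <- s) soft_weight c x *: c.
Local Notation E := soft_weight.
Local Notation F := soft_total.
Local Notation q := soft_half_sqdist.

Lemma soft_weight_gt0 c x : 0 < E c x. Proof. exact: expR_gt0. Qed.

Lemma soft_total_gt0 x : 0 < F x.
Proof.
rewrite /soft_total (big_rem c0)//= ltr_wpDr ?soft_weight_gt0//.
by apply: sumr_ge0 => c _; exact/ltW/soft_weight_gt0.
Qed.

Lemma is_derive_soft_weight c x h : is_derive x h (E c) (E c x * (eps^-1 * dot h c)).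
Proof.
have d1 : is_derive x h (fun y => eps^-1 * (dot y c - dot c c / 2)) (eps^-1 * dot h c).
  have := is_deriveB (is_derive_dotl x h c) (is_derive_cst (dot c c / 2) x h).
  by rewrite subr0 => /is_deriveZ H; exact: H.
exact: is_derive_comp d1 (is_derive_expR _).
Qed.

Lemma is_derive_soft_total x h : is_derive x h F (\sum_(c <- s) E c x * (eps^-1 * dot h c)).
Proof. by apply: is_derive_sumseq => c; exact: is_derive_soft_weight. Qed.

Lemma Ck_on_soft_weight k c : Ck_on setT k (E c).
Proof.
have o := @openT RN.
apply: (@Ck_on_comp _ _ _ setT) => //; first exact: Ck_on_expR.
apply: Ck_onZ => //; apply: Ck_onB => //; [exact: Ck_on_dotl|exact: Ck_on_cst].
Qed.

Lemma Ck_on_soft_total k : Ck_on setT k F.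
Proof. by apply: Ck_on_sum => [|c]; [exact: openT|exact: Ck_on_soft_weight]. Qed.

Lemma Ck_on_soft k : Ck_on setT k q.
Proof.
have o := @openT RN.
apply: Ck_onB => //.
  by apply: Ck_onM => //; [exact: Ck_on_sqr|exact: Ck_on_cst].
apply: Ck_onZ => //; apply: (@Ck_on_comp _ _ _ [set t : R | 0 < t]) => //.
- by move=> x _; exact: soft_total_gt0.
- exact: Ck_on_ln.
- exact: Ck_on_soft_total.
Qed.

Lemma is_derive_soft x h : is_derive x h q (dot (x - soft_mean x) h).
Proof.
have Fx := soft_total_gt0 x.
have d1 := is_derive_comp (is_derive_soft_total x h) (is_derive1_ln Fx).
have d2 : is_derive x h (fun y => eps * ln (F y))
    (eps * ((F x)^-1 * \sum_(c <- s) E c x * (eps^-1 * dot h c))) by exact: is_deriveZ.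
have d3 : is_derive x h (fun y : RN => 2^-1 * dot y y) (2^-1 * (2 * dot x h)).
  by apply: is_deriveZ; exact: is_derive_sqr.
have := is_deriveB d3 d2.
rewrite (_ : _ - _ = q); last first.
  by apply/funext => y; rewrite /q mulrC.
move=> H; apply: is_derive_eq H _.
rewrite dotBl; congr (_ - _); first by field.
rewrite /soft_mean dotZl (dotC (\sum_(c <- s) _) h) dot_sumr !mulr_sumr.
apply: eq_bigr => c _; rewrite dotZr; field.
by rewrite !gt_eqF.
Qed.

(** The derivative of the i-th coordinate of [soft_mean] in the i-th direction is the variance of
    that coordinate of the net, under the normalized weights, divided by [eps]. It is nonnegative
    and enters with a minus sign. *)
Lemma soft_laplacian_le x i :
  'D_(basis_vec R i) (fun y => (y - soft_mean y) ord0 i) x <= 1.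
Proof.
have Fx := soft_total_gt0 x; set e := basis_vec R i.
have dote c : dot e c = c ord0 i.
  rewrite /dot (bigD1 i)//= big1 => [|j ji]; rewrite !mxE/= ?eqxx ?mul1r ?addr0//.
  by rewrite (negbTE ji) ?andbF mul0r.
pose A y := \sum_(c <- s) E c y * c ord0 i.
have dA : is_derive x e A (\sum_(c <- s) eps^-1 * (E c x * c ord0 i ^+ 2)).
  apply: is_derive_sumseq => c.
  have := is_deriveM (is_derive_soft_weight c x e) (is_derive_cst (c ord0 i) x e).
  rewrite scaler0 add0r => H; apply: is_derive_eq H _.
  by rewrite /GRing.scale/= dote; ring.
have dF := is_derive_soft_total x e.
have dF' : is_derive x e F (\sum_(c <- s) eps^-1 * (E c x * c ord0 i)).
  by apply: is_derive_eq dF _; apply: eq_bigr => c _; rewrite dote; ring.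
have dV := is_derive_comp dF' (is_derive_inv Fx).
have dM := is_deriveM dA dV.
have e1 : is_derive x e (fun y : RN => y ord0 i) 1.
  apply: is_derive_eq (is_derive_coord i x e) _.
  by rewrite /e /basis_vec mxE !eqxx.
have := is_deriveB e1 dM.
rewrite (_ : _ - _ = fun y => (y - soft_mean y) ord0 i); last first.
  apply/funext => y; rewrite !mxE -[LHS]/(y ord0 i - A y * (F y)^-1); congr (_ - _).
  rewrite mulrC; congr (_ * _); rewrite summxE; apply: eq_bigr => c _; by rewrite mxE.
move=> [_ ->]; rewrite gerBl /GRing.scale/=.
rewrite -!mulr_sumr; set S1 := \sum_(c <- s) E c x * c ord0 i; set S2 := \sum_(c <- s) E c x * _ ^+ 2.
have -> : A x = S1 by [].
have H : 0 <= \sum_(c <- s) E c x * (c ord0 i - S1 / F x) ^+ 2.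
  by apply: sumr_ge0 => c _; rewrite mulr_ge0 ?sqr_ge0// ltW// soft_weight_gt0.
have H2 : \sum_(c <- s) E c x * (c ord0 i - S1 / F x) ^+ 2 = S2 - S1 ^+ 2 / F x.
  transitivity (S2 - 2 * (S1 / F x) * S1 + (S1 / F x) ^+ 2 * F x).
    rewrite /S1 /S2 /F !mulr_sumr -sumrB -big_split/=; apply: eq_bigr => c _; ring.
  by field; rewrite gt_eqF.
rewrite {}H2 in H.
have -> : S1 * (- ((F x)^-1 / F x) * (eps^-1 * S1)) + (F x)^-1 * (eps^-1 * S2) =
   eps^-1 * (F x)^-1 * (S2 - S1 ^+ 2 / F x) by field; rewrite !gt_eqF.
by rewrite !mulr_ge0// invr_ge0 ltW.
Qed.

(** Gibbs form of the normalized weights, in which the squared distance reappears. *)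
Lemma soft_weightE c x : E c x / F x = expR (eps^-1 * (q x - dot (x - c) (x - c) / 2)).
Proof.
have Fx := soft_total_gt0 x.
rewrite -[in LHS](lnK Fx) -expRN -expRD; congr expR.
rewrite /q !dotBl !dotBr (dotC c x); field; by rewrite gt_eqF.
Qed.

Lemma sum_soft_weight x : \sum_(c <- s) E c x / F x = 1.
Proof. by rewrite -mulr_suml divff// gt_eqF// soft_total_gt0. Qed.

Lemma soft_le c x : c \in s -> q x <= dot (x - c) (x - c) / 2.
Proof.
move=> sc; have : E c x / F x <= 1.
  rewrite ler_pdivrMr ?soft_total_gt0// mul1r /soft_total (big_rem c)//= lerDl.
  by apply: sumr_ge0 => *; exact/ltW/soft_weight_gt0.
by rewrite soft_weightE -expR0 ler_expR pmulr_rle0 ?invr_gt0// subr_le0.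
Qed.

(** With n points, if q x were less than b - n eps, each normalized weight would be at most e^(-n),
    and their sum at most n e^(-n) < 1. *)
Lemma soft_ge x b : (forall c, c \in s -> b <= dot (x - c) (x - c) / 2) ->
  b - (size s)%:R * eps <= q x.
Proof.
move=> Hb; rewrite leNgt; apply/negP => qb.
have : \sum_(c <- s) E c x / F x <= (size s)%:R * expR (- (size s)%:R).
  rewrite -sumr_cst !big_seq; apply: ler_sum => c cs.
  rewrite soft_weightE ler_expR mulrC ler_pdivrMr//.
  by have := Hb c cs; move: qb; rewrite mulNr; lra.
rewrite sum_soft_weight expRN ler_pdivlMr ?expR_gt0// mul1r.
by apply/negP; rewrite -ltNge (lt_le_trans _ (expR_ge1Dx _))// ltrDr.
Qed.

Lemma soft_gradE x : x - soft_mean x = \sum_(c <- s) (E c x / F x) *: (x - c).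
Proof.
rewrite (eq_bigr (fun c => (E c x / F x) *: x - (E c x / F x) *: c)); last first.
  by move=> c _; rewrite scalerBr.
rewrite sumrB -scaler_suml sum_soft_weight scale1r; congr (_ - _).
by rewrite /soft_mean scaler_sumr; apply: eq_bigr => c _; rewrite scalerA mulrC.
Qed.

(** The gradient is the mean of the vectors x - c, so its square is at most the mean of |x - c|^2. A
    weight e^y goes with |x - c|^2 / 2 = q x - eps y, and - y e^y <= 1 bounds the excess over q x by
    [eps] for each point. *)
Lemma soft_grad_sqr_le x :
  dot (x - soft_mean x) (x - soft_mean x) <= 2 * q x + 2 * (size s)%:R * eps.
Proof.
have Fx := soft_total_gt0 x.
set u := x - soft_mean x.
have H1 : dot u u <= \sum_(c <- s) (E c x / F x) * ((dot u u + dot (x - c) (x - c)) / 2).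
  rewrite {2}/u soft_gradE dot_sumr; apply: ler_sum => c _.
  rewrite dotZr ler_wpM2l//; first by rewrite ltW// divr_gt0// soft_weight_gt0.
  exact: dot_le_half.
have H2 : \sum_(c <- s) (E c x / F x) * (dot (x - c) (x - c) / 2) <=
    q x + (size s)%:R * eps.
  apply: (@le_trans _ _ (\sum_(c <- s) ((E c x / F x) * q x + eps))).
    apply: ler_sum => c _; rewrite soft_weightE.
    set y := eps^-1 * (q x - _).
    have -> : dot (x - c) (x - c) / 2 = q x + eps * (- y).
      by rewrite /y; field; rewrite gt_eqF.
    rewrite mulrDr lerD2l mulrCA -[leRHS]mulr1 ler_pM2l//.
    rewrite -[y in expR y]opprK expRN mulrC ler_pdivrMr ?expR_gt0// mul1r.
    by apply: le_trans (expR_ge1Dx _); rewrite lerDr.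
  by rewrite big_split/= -mulr_suml sum_soft_weight mul1r sumr_cst.
have : \sum_(c <- s) (E c x / F x) * ((dot u u + dot (x - c) (x - c)) / 2) =
  dot u u / 2 + \sum_(c <- s) (E c x / F x) * (dot (x - c) (x - c) / 2).
  rewrite -[dot u u / 2]mul1r -(sum_soft_weight x) mulr_suml -big_split/=.
  by apply: eq_bigr => c _; ring.
move: H1 H2; set X := \sum_(c <- s) _; set Y := \sum_(c <- s) _; lra.
Qed.

(** Net points whose half squared distance exceeds [q x] by more than [b] have weight at most e^(- b
    / eps) <= eps / b; the others are within [e] of [c1]. *)
Lemma soft_grad_near x c1 e b K : 
  (forall c, c \in s -> enorm (c1 - c) <= K) ->
  (forall c, c \in s -> dot (x - c) (x - c) / 2 <= q x + b -> enorm (c1 - c) <= e) ->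
  0 < b -> 0 <= e ->
  enorm ((x - soft_mean x) - (x - c1)) <= e + (size s)%:R * (eps / b * K).
Proof.
move=> HK He b0 e0; have Fx := soft_total_gt0 x.
have -> : (x - soft_mean x) - (x - c1) = \sum_(c <- s) (E c x / F x) *: (c1 - c).
  rewrite soft_gradE -[x - c1]scale1r -(sum_soft_weight x) scaler_suml -sumrB.
  apply: eq_bigr => c _; rewrite -scalerBr; congr (_ *: _).
  by rewrite opprB addrC -addrA addKr.
apply: le_trans (enorm_sum _ _) _.
apply: (@le_trans _ _ (\sum_(c <- s) ((E c x / F x) * e + eps / b * K))); last first.
  by rewrite big_split/= -mulr_suml sum_soft_weight mul1r sumr_cst.
rewrite !big_seq; apply: ler_sum => c cs.
have P0 : 0 < E c x / F x by rewrite divr_gt0// soft_weight_gt0.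
rewrite enormZ gtr0_norm//.
have K0 : 0 <= K by apply: le_trans (HK c cs); exact: enorm_ge0.
have [near|far] := leP (dot (x - c) (x - c) / 2) (q x + b).
  rewrite (le_trans (_ : _ <= E c x / F x * e))// ?lerDl.
    by rewrite ler_wpM2l ?(ltW P0)// He.
  by rewrite mulr_ge0// divr_ge0 ?ltW.
rewrite ler_wpDl//; first by rewrite mulr_ge0// ltW.
apply: ler_pM; rewrite ?enorm_ge0 ?(ltW P0) ?HK//.
rewrite soft_weightE; set y := eps^-1 * (q x - _).
have yb : b / eps <= - y.
  rewrite /y -mulrN mulrC ler_pM2l ?invr_gt0//; lra.
have be0 : 0 < b / eps by rewrite divr_gt0.
rewrite -[y]opprK expRN -[eps / b]invf_div lef_pV2 ?posrE ?expR_gt0//.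
apply: le_trans (expR_ge1Dx _); lra.
Qed.

End soft_distance.

(** * Smooth approximation of half the squared distance, with its gradient *)

Section soft_distance_existence.
Variables (R : realType) (N : nat).
Local Notation RN := 'rV[R]_N.
Implicit Types (x y c : RN) (G C : set RN).

Lemma finite_net G e : compact G -> 0 < e ->
  exists s : seq RN, (forall c, c \in s -> G c) /\
    forall x, G x -> exists2 c, c \in s & enorm (x - c) < e.
Proof.
rewrite compact_cover => cG e0.
have [c _|x Gx|D' D'G GD'] := cG RN G (fun c => [set y | enorm (y - c) < e]).
- exact: (open_comp (fun y _ => @continuous_enormB R N c y) (@open_lt R e)).
- by exists x => //=; rewrite subrr enorm0.
exists (finmap.enum_fset D'); split => [c /D'G|x /GD'[c /= cD' xc]]; first by rewrite inE.
by exists c.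
Qed.

Lemma continuous_sub_fst (V : normedModType R) :
  continuous (fun t : V * V * V => t.1.1 - t.1.2).
Proof.
move=> t; apply: cvgB; apply: (@continuous_comp _ _ _ fst);
  by [exact: cvg_fst|exact: cvg_snd].
Qed.

Lemma continuous_sub_snd (V : normedModType R) :
  continuous (fun t : V * V * V => t.1.1 - t.2).
Proof.
move=> t; apply: cvgB; last exact: cvg_snd.
by apply: (@continuous_comp _ _ _ fst); exact: cvg_fst.
Qed.

Lemma continuous_sub_mid (V : normedModType R) :
  continuous (fun t : V * V * V => t.1.2 - t.2).
Proof.
move=> t; apply: cvgB; last exact: cvg_snd.
by apply: (@continuous_comp _ _ _ fst); [exact: cvg_fst|exact: cvg_snd].
Qed.

Lemma continuous_fst_fst (V : normedModType R) : continuous (fun t : V * V * V => t.1.1).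
Proof. by move=> t; apply: (@continuous_comp _ _ _ fst); exact: cvg_fst. Qed.

(** Uniqueness of the nearest point made uniform by compactness. On the triples with |c - c'| >= e,
    the sum [Phi] of the two excesses of squared distance is positive, hence bounded below. *)
Lemma nearest_modulus G G' C e : closed G -> G !=set0 -> G' `<=` G -> compact G' ->
  compact C ->
  (forall x c c', C x -> G c -> enorm (x - c) = sdist G x ->
     G c' -> enorm (x - c') = sdist G x -> c = c') ->
  0 < e ->
  exists2 om, 0 < om & forall x c c', C x -> G' c -> G' c' ->
    dot (x - c) (x - c) <= sdist G x ^+ 2 + om ->
    dot (x - c') (x - c') <= sdist G x ^+ 2 + om -> enorm (c - c') < e.
Proof.
move=> cG G0 G'G cG' cC uniq e0.
pose K : set (RN * RN * RN) := ((C `*` G') `*` G') `&`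
  (fun t : RN * RN * RN => enorm (t.1.2 - t.2)) @^-1` [set u | e <= u].
have cK : compact K.
  apply: compact_closedI; first by do 2 (apply: compact_setX => //).
  apply: closed_comp; last exact: closed_ge.
  move=> t _; apply: (@continuous_comp _ _ _ (fun t : RN * RN * RN => t.1.2 - t.2) (@enorm R 1 N)).
    exact: continuous_sub_mid.
  exact: (@continuous_enorm R N (t.1.2 - t.2)).
pose Phi (t : RN * RN * RN) := dot (t.1.1 - t.1.2) (t.1.1 - t.1.2) +
  dot (t.1.1 - t.2) (t.1.1 - t.2) - 2 * (sdist G t.1.1 * sdist G t.1.1).
have cPhi : continuous Phi.
  have c1 := continuous_dot (@continuous_sub_fst RN) (@continuous_sub_fst RN).
  have c2 := continuous_dot (@continuous_sub_snd RN) (@continuous_sub_snd RN).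
  have c3 t : {for t, continuous (fun t : RN * RN * RN => sdist G t.1.1)}.
    apply: (@continuous_comp _ _ _ (fun t : RN * RN * RN => t.1.1) (sdist G)).
      exact: continuous_fst_fst.
    exact: continuous_sdist.
  move=> t; apply: cvgB; first by apply: cvgD; [exact: c1|exact: c2].
  by apply: cvgM; [exact: cvg_cst|apply: cvgM; exact: c3].
have [K0|K0] := pselect (K !=set0); last first.
  exists 1 => // x c c' Cx Gc Gc' _ _; rewrite ltNge; apply/negP => ecc.
  by apply: K0; exists (x, c, c').
have [[[x0 c0] c0']] := compact_EVT_min K0 cK (continuous_subspaceT cPhi).
rewrite inE => -[[[/= Cx0 Gc0] Gc0'] /= ecc] minP.
have D0 := sdist_ge0 x0 G0.
have sq c : G' c -> sdist G x0 ^+ 2 <= dot (x0 - c) (x0 - c).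
  move=> /G'G Gc; rewrite -sqr_enorm lerXn2r ?nnegrE ?enorm_ge0//.
  exact: sdist_le.
have P0 : 0 < Phi (x0, c0, c0').
  rewrite lt_neqAle; apply/andP; split; last first.
    by rewrite /Phi /= -expr2; have := sq _ Gc0; have := sq _ Gc0'; lra.
  apply/eqP => P0.
  have eqc c : G' c -> dot (x0 - c) (x0 - c) <= sdist G x0 ^+ 2 -> enorm (x0 - c) = sdist G x0.
    move=> Gc le; apply/eqP; rewrite eq_le sdist_le ?andbT; last exact: G'G.
    by rewrite -(@ler_pXn2r _ 2)// ?nnegrE ?enorm_ge0// sqr_enorm.
  move: P0; rewrite /Phi /= -expr2 => P0.
  have h1 := sq _ Gc0; have h2 := sq _ Gc0'.
  have E : c0 = c0'.
    by apply: (uniq x0) => //; [exact: G'G|apply: eqc => //; lra|exact: G'G|apply: eqc => //; lra].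
  by move: ecc; rewrite E subrr enorm0 leNgt e0.
(* Two excesses of at most a quarter of the minimum add up to half of it. *)
exists (Phi (x0, c0, c0') / 4); first by rewrite divr_gt0.
move=> x c c' Cx Gc Gc' xc xc'; rewrite ltNge; apply/negP => ee.
have : Phi (x0, c0, c0') <= Phi (x, c, c') by apply: minP; rewrite inE.
move: P0 xc xc'; set P := Phi (x0, _, _); rewrite /Phi /= -expr2; lra.
Qed.

(** [q] and [g] replace D^2 / 2 and its gradient in test functions. The order of choices matters:
    the modulus [om], then the net, and last [eps], which depends on the size of the net. *)
Lemma soft_distance G C (M kap : R) : closed G -> G !=set0 -> 0 <= M -> 0 < kap ->
  compact C -> (forall x, C x -> enorm x <= M) ->
  (forall x c c', C x -> G c -> enorm (x - c) = sdist G x ->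
     G c' -> enorm (x - c') = sdist G x -> c = c') ->
  exists (q : RN -> R) (g : RN -> RN),
  [/\ forall k, Ck_on setT k q,
      forall x h, is_derive x h q (dot (g x) h),
      forall x i, 'D_(basis_vec R i) (fun y => g y ord0 i) x <= 1 &
      forall x, enorm x <= M ->
        [/\ `|q x - sdist G x ^+ 2 / 2| <= kap,
            dot (g x) (g x) <= 2 * q x + kap &
            forall c, C x -> G c -> enorm (x - c) = sdist G x ->
              enorm (g x - (x - c)) <= kap]].
Proof.
move=> cG G0 M0 kap0 cC CM uniq.
set D := sdist G in uniq *.
(* A point of [G] nearest to some [x] with |x| <= M has norm at most |x| + D x <= 2 M + D 0, so the
   net need only cover this bounded part of [G]. *)
pose M' := 2 * M + D 0.
pose G' := [set y | enorm (y - 0) <= M'] `&` G.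
have cG' : compact G' by apply: compact_closedI => //; exact: enorm_ball_compact.
have G'G : G' `<=` G by move=> y [].
have DM x : enorm x <= M -> D x <= D 0 + M.
  by move=> xM; have := sdist_lip x 0 G0; rewrite subr0 -/D; lra.
have nearG' x c : enorm x <= M -> G c -> enorm (x - c) = D x -> G' c.
  move=> xM Gc xc; split => //=; rewrite subr0.
  have := enorm_triangle x c 0; rewrite !subr0 (enormB c) xc.
  by have := DM x xM; rewrite /M'; lra.
have D00 : 0 <= D 0 by exact: sdist_ge0.
have kap2 : 0 < kap / 2 by rewrite divr_gt0.
have [om om0 Hom] := nearest_modulus cG G0 G'G cG' cC uniq kap2.
(* Since q x <= D x^2 / 2 + m, a net point whose half squared distance is at most q x + om / 8 has
   squared distance at most D x^2 + om, as [Hom] requires. *)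
pose m := Num.min (om / 8) (kap / 2).
have m0 : 0 < m by rewrite lt_min !divr_gt0.
have mom : m <= om / 8 by rewrite ge_min lexx.
have mkap : m <= kap / 2 by rewrite ge_min lexx orbT.
pose B := D 0 + M + 1.
have B1 : 1 <= B by rewrite /B; lra.
(* Mesh of the net: replacing the nearest point by a net point raises the half square by gam D x +
   gam^2 / 2 <= gam B <= m. *)
pose gam := Num.min 1 (m / B).
have gam0 : 0 < gam by rewrite lt_min ltr01 divr_gt0//; lra.
have gam1 : gam <= 1 by rewrite ge_min lexx.
have gamm : gam * B <= m.
  by rewrite -ler_pdivlMr; [rewrite ge_min lexx orbT|lra].
have [s [sG' Hs]] := finite_net cG' gam0.
have [c0 sc0] : exists c, c \in s.
  have [p Gp p0] := sdist_attained 0 cG G0.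
  have Gp' : G' p by apply: (nearG' 0) => //; rewrite enorm0.
  by have [c cs _] := Hs p Gp'; exists c.
pose n : R := (size s)%:R; have n0 : 0 <= n by [].
pose K := 2 * M'; have K0 : 0 <= K by rewrite /K /M'; lra.
pose b := om / 8; have b0 : 0 < b by rewrite divr_gt0.
have Kb0 : 0 <= K / b by rewrite divr_ge0// ltW.
(* Makes both n eps and n (eps / b) K at most kap / 2. *)
pose eps := kap / (2 * ((n + 1) * (1 + K / b))).
have den0 : 0 < (n + 1) * (1 + K / b) by rewrite mulr_gt0//; lra.
have eps0 : 0 < eps by rewrite divr_gt0// mulr_gt0.
have epsE : eps * ((n + 1) * (1 + K / b)) = kap / 2.
  rewrite /eps; field; rewrite !gt_eqF//; lra.
have neps : n * eps <= kap / 2.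
  rewrite -epsE mulrC ler_wpM2l ?ltW//; nra.
have nepsK : n * (eps / b * K) <= kap / 2.
  rewrite -epsE (_ : n * (eps / b * K) = eps * (n * (K / b))); last by ring.
  rewrite ler_wpM2l ?ltW//; nra.
exists (soft_half_sqdist s eps), (fun x => x - soft_mean s eps x); split.
- by move=> k; exact: (Ck_on_soft _ sc0).
- by move=> x h; exact: (is_derive_soft sc0 eps0).
- by move=> x i; exact: (soft_laplacian_le sc0 eps0).
move=> x xM; set q := soft_half_sqdist s eps.
have Dx0 : 0 <= D x by exact: sdist_ge0.
have Dx := DM x xM.
have qle : q x <= D x ^+ 2 / 2 + m.
  have [p Gp xp] := sdist_attained x cG G0.
  have [c cs pc] := Hs p (nearG' x p xM Gp xp).
  apply: le_trans (soft_le sc0 eps0 x cs) _.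
  have : enorm (x - c) <= D x + gam.
    by have := enorm_triangle p x c; rewrite xp -/D; lra.
  move=> xc; have {}xc : dot (x - c) (x - c) <= (D x + gam) ^+ 2.
    by rewrite -sqr_enorm lerXn2r ?nnegrE ?enorm_ge0 ?addr_ge0// ltW.
  have : gam * D x + gam ^+ 2 / 2 <= m.
    apply: le_trans gamm; rewrite /B; nra.
  move: xc; rewrite sqrrD; lra.
have qge : D x ^+ 2 / 2 - n * eps <= q x.
  apply: (soft_ge sc0 eps0) => c cs; rewrite ler_pM2r ?invr_gt0// -sqr_enorm.
  by rewrite lerXn2r ?nnegrE ?enorm_ge0// sdist_le//; exact/G'G/sG'.
split.
- by rewrite ler_norml; apply/andP; split; lra.
- apply: le_trans (soft_grad_sqr_le sc0 eps0 x) _; rewrite -/q -/n; lra.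
move=> c Cx Gc xc; have G'c := nearG' x c xM Gc xc.
apply: le_trans (soft_grad_near sc0 eps0 (K := K) (e := kap / 2) (b := b) _ _ b0 (ltW kap2)) _.
- move=> c' /sG'[/= c'M _]; move: G'c => [/= cM _].
  have := enorm_triangle 0 c c'; rewrite (enormB 0 c') /K; lra.
- move=> c' c's xc'; apply/ltW/(Hom x) => //; first exact: sG'.
    by rewrite -sqr_enorm xc -/D; lra.
  by move: xc'; rewrite -/q /b -/D; lra.
- rewrite -/n; lra.
Qed.

End soft_distance_existence.

(** * Integrability and comparison of integrals *)

Section integrability.
Context d (T : measurableType d) (R : realType) (mu : {measure set T -> \bar R}).
Implicit Types f g : T -> R.

Lemma integrable_measurable f : mu.-integrable setT (EFin \o f) -> measurable_fun setT f.
Proof. by case/integrableP => /measurable_EFinP. Qed.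

Lemma integrable_dominated f g : measurable_fun setT f ->
  mu.-integrable setT (EFin \o g) -> (forall x, `|f x| <= `|g x|) ->
  mu.-integrable setT (EFin \o f).
Proof.
move=> mf ig fg; apply: le_integrable ig => //; first exact/measurable_EFinP.
by move=> x _ /=; rewrite lee_fin.
Qed.

Lemma integrable_mul_bounded f g c : mu.-integrable setT (EFin \o f) ->
  measurable_fun setT g -> (forall x, `|g x| <= c) ->
  mu.-integrable setT (EFin \o (fun x => f x * g x)).
Proof.
move=> intf mg gc.
have intcf : mu.-integrable setT (EFin \o (fun x => c * f x)).
  by have := integrableZl measurableT c intf.
apply: integrable_dominated intcf _.
  by apply: measurable_funM => //; exact: integrable_measurable.
move=> x; rewrite normrM mulrC normrM ler_wpM2r//.
by rewrite (le_trans (gc x))// ler_norm.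
Qed.

(** The pointwise comparison is applied to the minimum of [f] and [g], which equals [f] almost
    everywhere. *)
Lemma ae_le_Rintegral f g : mu.-integrable setT (EFin \o f) ->
  mu.-integrable setT (EFin \o g) -> {ae mu, forall x, f x <= g x} ->
  \int[mu]_x f x <= \int[mu]_x g x.
Proof.
move=> intf intg fg.
have mf := integrable_measurable intf; have mg := integrable_measurable intg.
pose h x := Num.min (f x) (g x).
have mh : measurable_fun setT h by exact: measurable_minr.
have fh : \int[mu]_x f x = \int[mu]_x h x.
  rewrite /Rintegral; congr fine; apply: ae_eq_integral => //; try exact/measurable_EFinP.
  by apply: filterS fg => x fgx _ /=; rewrite /h min_l.
rewrite fh; apply: le_Rintegral => //; last by move=> x _; rewrite ge_min lexx orbT.
have intfg : mu.-integrable setT (EFin \o (fun x => `|f x| + `|g x|)).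
  have := integrableD measurableT (integrable_norm intf) (integrable_norm intg).
  by [].
apply: integrable_dominated mh intfg _ => x.
rewrite (ger0_norm (_ : 0 <= `|f x| + `|g x|)) ?addr_ge0// /h.
by case: (leP (f x) (g x)) => _; rewrite ?lerDl ?lerDr.
Qed.

End integrability.

(** * Vector fields and the spatial cutoff *)

Section vector_calculus.
Variables (R : realType) (N : nat).
Local Notation RN := 'rV[R]_N.

Lemma continuous_row (V : normedModType R) (w : V -> RN) (x : V) :
  (forall i, {for x, continuous (fun y => w y ord0 i)}) -> {for x, continuous w}.
Proof.
move=> cw; apply: cvg_near => e e0.
have H (i : 'I_N) : \forall y \near x, `|w x ord0 i - w y ord0 i| < e.
  by have /cvgrPdist_lt/(_ e e0) := cw i.
have {}H := filter_forall _ H.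
near=> y; apply: norm_lt_coord => // i; rewrite !mxE.
by move: i; near: y; exact: H.
Unshelve. all: by end_near. Qed.

Lemma derivable_row (V : normedModType R) (w : V -> RN) (x h : V) :
  (forall i, derivable (fun y => w y ord0 i) x h) -> derivable w x h.
Proof. by move=> H; apply/derivable_mxP => i j; rewrite ord1. Qed.

Lemma derive_row (V : normedModType R) (w : V -> RN) (x h : V) i :
  derivable w x h -> ('D_h w x) ord0 i = 'D_h (fun y => w y ord0 i) x.
Proof. by move=> H; rewrite (derive_mx H) mxE. Qed.

Lemma derivable_coord (V : normedModType R) (w : V -> RN) (x h : V) i :
  derivable w x h -> derivable (fun y => w y ord0 i) x h.
Proof. by move/derivable_mxP => /(_ ord0 i). Qed.

Lemma Ck_on_row (V : normedModType R) (U : set V) k (w : V -> RN) : open U ->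
  (forall i, Ck_on U k (fun y => w y ord0 i)) -> Ck_on U k w.
Proof.
move=> oU; elim: k w => [|k IH] w Hw.
  by split => // x Ux; apply: continuous_row => i; have [c _] := Hw i; exact: c.
have dw h x : U x -> derivable w x h.
  by move=> Ux; apply: derivable_row => i; have [_ /(_ h)[dwi _]] := Hw i; exact: dwi.
apply: Ck_on_succ => [x Ux|h].
  by apply: continuous_row => i; have [c _] := Hw i; exact: c.
split; first exact: dw.
apply: IH => i; have [_ /(_ h)[_ Dw]] := Hw i.
by apply: (Ck_on_eq Dw oU) => x Ux; rewrite derive_row//; exact: dw.
Qed.

Lemma Ck_on_coordinate (V : normedModType R) (U : set V) k (w : V -> RN) i : open U ->
  Ck_on U k w -> Ck_on U k (fun y => w y ord0 i).
Proof.
move=> oU; elim: k w => [|k IH] w [cw Hw].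
  split => // x Ux; apply: (@continuous_comp _ _ _ w (fun y : RN => y ord0 i)); first exact: cw.
  exact: coord_continuous.
apply: Ck_on_succ => [x Ux|h].
  apply: (@continuous_comp _ _ _ w (fun y : RN => y ord0 i)); first exact: cw.
  exact: coord_continuous.
have [dw Dw] := Hw h; split; first by move=> x Ux; apply: derivable_coord; exact: dw.
by apply: (Ck_on_eq (IH _ Dw) oU) => x Ux; rewrite derive_row//; exact: dw.
Qed.

Lemma dot_basis_vec (x : RN) i : dot x (basis_vec R i) = x ord0 i.
Proof.
rewrite /dot (bigD1 i)//= big1 => [|j ji]; rewrite !mxE/= ?eqxx ?mulr1 ?addr0//.
by rewrite (negbTE ji) ?andbF mulr0.
Qed.

Lemma continuous_compact_bounded (f : RN -> R) (K : set RN) : continuous f ->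
  compact K -> (forall x, ~ K x -> f x = 0) -> exists2 c, 0 <= c & forall x, `|f x| <= c.
Proof.
move=> cf cK fK; have [K0|K0] := pselect (K !=set0); last first.
  by exists 0 => // x; rewrite fK ?normr0// => Kx; apply: K0; exists x.
have cnf : continuous (fun x => `|f x|).
  by move=> x; apply: continuous_comp; [exact: cf|exact: norm_continuous].
have [z _ Hz] := EVT_max_rV K0 cK (continuous_subspaceT cnf).
exists `|f z| => // x; have [Kx|nKx] := pselect (K x); first by apply: Hz; rewrite inE.
by rewrite fK ?normr0.
Qed.

Lemma divE (w : RN -> RN) (x : RN) : (forall i, derivable w x (basis_vec R i)) ->
  div w x = \sum_i 'D_(basis_vec R i) (fun y => w y ord0 i) x.
Proof.
move=> dw; rewrite /div /mxtrace; apply: eq_bigr => i _.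
by rewrite mxE derive_row.
Qed.

(** A function of |x|^2, hence smooth at the origin; it goes from 1 on |x| <= M to 0 on |x| >= 2
    M. *)
Definition cutoff (M : R) (x : RN) : R := 1 - step ((dot x x - M ^+ 2) / M ^+ 2).
Definition dcutoff (M : R) (x : RN) : R :=
  - (dstep ((dot x x - M ^+ 2) / M ^+ 2) * (2 / M ^+ 2)).

Lemma cutoff_ge0 M (x : RN) : 0 <= cutoff M x.
Proof. by rewrite subr_ge0 step_le1. Qed.

Lemma cutoff_le1 M (x : RN) : cutoff M x <= 1.
Proof. by rewrite gerBl step_ge0. Qed.

Lemma cutoff_eq1 M (x : RN) : 0 < M -> enorm x <= M -> cutoff M x = 1.
Proof.
move=> M0 xM; rewrite /cutoff step_le0 ?subr0// pmulr_lle0 ?invr_gt0 ?exprn_gt0//.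
by rewrite subr_le0 -sqr_enorm lerXn2r ?nnegrE ?enorm_ge0// ltW.
Qed.

Let far M (x : RN) : 0 < M -> 2 * M <= enorm x -> 1 <= (dot x x - M ^+ 2) / M ^+ 2.
Proof.
move=> M0 xM; rewrite ler_pdivlMr ?exprn_gt0// mul1r -sqr_enorm.
have : (2 * M) ^+ 2 <= enorm x ^+ 2.
  by rewrite lerXn2r ?nnegrE ?enorm_ge0// mulr_ge0// ltW.
rewrite exprMn; nra.
Qed.

Lemma cutoff_eq0 M (x : RN) : 0 < M -> 2 * M <= enorm x -> cutoff M x = 0.
Proof. by move=> M0 xM; rewrite /cutoff step_ge1 ?subrr//; exact: far. Qed.

Lemma dcutoff_eq0 M (x : RN) : 0 < M -> 2 * M <= enorm x -> dcutoff M x = 0.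
Proof. by move=> M0 xM; rewrite /dcutoff dstep_ge1 ?mul0r ?oppr0//; exact: far. Qed.

Lemma Ck_on_cutoff k M : Ck_on setT k (cutoff M).
Proof.
have o := @openT RN.
apply: Ck_onB => //; first exact: Ck_on_cst.
apply: (@Ck_on_comp _ _ _ setT) => //; first exact: Ck_on_step.
apply: Ck_onM => //; last exact: Ck_on_cst.
by apply: Ck_onB => //; [exact: Ck_on_sqr|exact: Ck_on_cst].
Qed.

Lemma is_derive_cutoff M (x h : RN) :
  is_derive x h (cutoff M) (dcutoff M x * dot x h).
Proof.
have d1 : is_derive x h (fun y : RN => (M ^+ 2)^-1 * (dot y y - M ^+ 2))
    ((M ^+ 2)^-1 * (2 * dot x h)).
  have := is_deriveB (is_derive_sqr x h) (is_derive_cst (M ^+ 2) x h).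
  by rewrite subr0 => /is_deriveZ H; exact: H.
have := is_deriveB (is_derive_cst (1 : R) x h) (is_derive_comp d1 (is_derive_step _)).
rewrite (_ : _ - _ = cutoff M); last first.
  by apply/funext => y; rewrite /cutoff [X in step X]mulrC.
by move=> H; apply: is_derive_eq H _; rewrite /dcutoff sub0r [X in dstep X]mulrC; ring.
Qed.

(** The gradient of [cutoff M] is [dcutoff M x *: x]. The constant does not depend on [M], so the
    contribution of the cutoff disappears as [M] grows; the factor 4 is 2 from 2 / M^2 times 2 from
    |x| <= 2 M. *)
Lemma dcutoff_bound : exists2 c, 0 <= c & forall M (x u : RN), 0 < M ->
  `|dcutoff M x * dot x u| <= c / M * enorm u.
Proof.
have [c c0 Hc] := dstep_bounded R.
exists (c * 4); first by rewrite mulr_ge0// ltW.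
move=> M x u M0; have eu := enorm_ge0 u; have [xM|Mx] := leP (2 * M) (enorm x).
  by rewrite dcutoff_eq0// mul0r normr0 !mulr_ge0// ?invr_ge0 ltW.
rewrite normrM /dcutoff normrN normrM ger0_norm ?dstep_ge0//.
have h1 : 0 < 2 / M ^+ 2 by rewrite divr_gt0 ?exprn_gt0.
rewrite (gtr0_norm h1).
apply: (@le_trans _ _ (c * (2 / M ^+ 2) * (2 * M * enorm u))).
  apply: ler_pM => //.
  - by rewrite mulr_ge0 ?dstep_ge0// ltW.
  - by rewrite ler_pM2r.
  - by apply: le_trans (norm_dot_le _ _) _; rewrite ler_wpM2r// ltW.
by rewrite le_eqVlt; apply/orP; left; apply/eqP; field; rewrite gt_eqF.
Qed.

End vector_calculus.

Lemma Ck_continuous (R : realType) (V W : normedModType R) k (f : V -> W) :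
  Ck_on setT k f -> continuous f.
Proof. by move=> Hf x; exact: (Ck_on_cont Hf). Qed.

(** * Mass of a BV function in a thin collar *)

Section collar_mass.
Variables (R : realType) (N : nat).
Local Notation RN := 'rV[R]_N.
Local Notation mu := (@lebesgue_rV R N).
Variables (G Omega : set RN) (a : R).
Local Notation D := (sdist G).
Hypotheses (a0 : 0 < a) (cG : closed G) (G0 : G !=set0) (cO : closed Omega).
Hypothesis Da : forall x, Omega x -> D x <= a.
Hypothesis uniq : forall x c c', Omega x -> 0 < D x ->
  G c -> enorm (x - c) = D x -> G c' -> enorm (x - c') = D x -> c = c'.

(** Phrased with the quantity that [soft_distance] approximates. Where D = a - d with 0 <= d <= a,
    the difference a^2 / 2 - D^2 / 2 lies between a d / 2 and a d, so [b] is comparable to a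
    depth. *)
Definition collar (b : R) : set RN := [set x | a ^+ 2 / 2 - b < D x ^+ 2 / 2].

Lemma measurable_collar b : measurable (collar b).
Proof.
have cD : continuous (fun x => D x ^+ 2 / 2).
  move=> x; apply: (@continuous_comp _ _ _ D (fun t => t ^+ 2 / 2)).
    exact: continuous_sdist.
  by apply: cvgM; [exact: exprn_continuous|exact: cvg_cst].
apply: open_measurable_rV.
exact (open_comp (fun x _ => cD x) (@open_gt R (a ^+ 2 / 2 - b))).
Qed.

(** The first factor removes [y <= a^2 / 8], that is D <= a / 2, and is 1 from a^2 / 4 on. The
    second decreases in [y], with slope of order 1 / b in the collar, and vanishes for
    [y >= a^2 / 2 + 2 b]. *)
Definition collar_profile (b y : R) : R :=
  step (8 / a ^+ 2 * (y - a ^+ 2 / 8)) * flat 0 (b^-1 * (a ^+ 2 / 2 - y) + 2).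

Definition dcollar_profile (b y : R) : R :=
  dstep (8 / a ^+ 2 * (y - a ^+ 2 / 8)) * (8 / a ^+ 2) *
    flat 0 (b^-1 * (a ^+ 2 / 2 - y) + 2)
  - step (8 / a ^+ 2 * (y - a ^+ 2 / 8)) *
    flat 2 (b^-1 * (a ^+ 2 / 2 - y) + 2) / b.

Lemma flat0_le1 (x : R) : flat 0 x <= 1.
Proof.
rewrite /flat; case: ltP => // x0; rewrite expr0 mul1r -expR0 ler_expR oppr_le0.
by rewrite invr_ge0 ltW.
Qed.

Lemma collar_profile_ge0 b y : 0 <= collar_profile b y.
Proof. by rewrite mulr_ge0 ?step_ge0 ?flat_ge0. Qed.

Lemma collar_profile_le1 b y : collar_profile b y <= 1.
Proof. by rewrite mulr_ile1 ?step_ge0 ?flat_ge0 ?step_le1 ?flat0_le1. Qed.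

Lemma is_derive_affine (c u e : R) (x : R) : is_derive x (1 : R) (fun y => c * (y - u) + e) c.
Proof.
have := is_deriveB (is_derive_id x (1 : R)) (is_derive_cst u x (1 : R)).
rewrite subr0 => /(is_deriveZ c) H.
have := is_deriveD H (is_derive_cst e x (1 : R)).
by rewrite addr0 => H'; apply: is_derive_eq H' _; rewrite /GRing.scale/= mulr1.
Qed.

Lemma is_derive_collar_profile b y :
  is_derive y (1 : R) (collar_profile b) (dcollar_profile b y).
Proof.
have d1 : is_derive y (1 : R) (fun y => 8 / a ^+ 2 * (y - a ^+ 2 / 8)) (8 / a ^+ 2).
  have := is_derive_affine (8 / a ^+ 2) (a ^+ 2 / 8) 0 y.
  by under eq_fun do rewrite addr0.
have d2 : is_derive y (1 : R) (fun y => b^-1 * (a ^+ 2 / 2 - y) + 2) (- b^-1).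
  have := is_derive_affine (- b^-1) (a ^+ 2 / 2) 2 y.
  by under eq_fun do rewrite mulNr -mulrN opprB.
have d3 := is_derive_comp d1 (is_derive_step _).
have d4 := is_derive_comp d2 (is_derive_flat 0 _).
have := is_deriveM d3 d4; rewrite mul0r subr0 => H.
by apply: is_derive_eq H _; rewrite /GRing.scale/= /dcollar_profile; ring.
Qed.

Lemma Ck_on_collar_profile k b : Ck_on setT k (collar_profile b).
Proof.
have o := @openT R.
apply: Ck_onM => //; apply: (@Ck_on_comp _ _ _ setT) => //.
- exact: Ck_on_step.
- by apply: Ck_onZ => //; apply: Ck_onB => //; [exact: Ck_on_id|exact: Ck_on_cst].
- exact: Ck_on_flat.
apply: Ck_onD => //; last exact: Ck_on_cst.
by apply: Ck_onZ => //; apply: Ck_onB => //; [exact: Ck_on_cst|exact: Ck_on_id].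
Qed.

(** [flat 2] is the derivative of [flat 0]: this is the steepness of the profile in the collar. *)
Lemma flat2_lower (t : R) : 1 <= t -> t <= 4 -> expR (- 1) / 16 <= flat 2 t.
Proof.
move=> t1 t4; have t0 : 0 < t by lra.
rewrite /flat t0 mulrC ler_pM ?expR_ge0//.
  rewrite exprVn lef_pV2 ?posrE ?exprn_gt0//; nra.
by rewrite ler_expR lerN2 invf_le1.
Qed.

(** For [y] = q x and [z] = D x: in the collar the first factor of the profile is 1 and the argument
    of the second stays in [1, 4], where [flat2_lower] applies. *)
Lemma collar_bounds (b y z : R) : 0 < b -> b <= a ^+ 2 / 8 -> 0 <= z ->
  `|y - z ^+ 2 / 2| <= b -> z <= a -> a ^+ 2 / 2 - b < z ^+ 2 / 2 ->
  [/\ 1 <= 8 / a ^+ 2 * (y - a ^+ 2 / 8), 1 <= b^-1 * (a ^+ 2 / 2 - y) + 2,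
      b^-1 * (a ^+ 2 / 2 - y) + 2 <= 4 & a * (3 / 4) <= z].
Proof.
move=> b0 ba z0; rewrite ler_norml => /andP[y1 y2] za zb.
have a20 : 0 < a ^+ 2 by rewrite exprn_gt0.
have z2 : z ^+ 2 <= a ^+ 2 by rewrite lerXn2r// nnegrE ltW.
have u1 : (a ^+ 2 / 2 - y) / b <= 2 by rewrite ler_pdivrMr//; lra.
have u2 : -1 <= (a ^+ 2 / 2 - y) / b by rewrite ler_pdivlMr//; lra.
split.
- by rewrite mulrAC ler_pdivlMr//; lra.
- by rewrite mulrC; lra.
- by rewrite mulrC; lra.
- by rewrite -(@ler_pXn2r _ 2)// ?nnegrE ?mulr_ge0// ?(ltW a0)//; rewrite exprMn; lra.
Qed.

(* The field of the divergence inequality is [- chi Z(q) grad q], where [q] is a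
   smooth version of [D^2 / 2]: it points towards the boundary, where the
   Laplacian of [q] is bounded from above even if the boundary is very curved. *)
Lemma collar_mass_le (f : RN -> R) : BV f -> {ae mu, forall x, 0 <= f x} ->
  {ae mu, forall x, ~ Omega x -> f x = 0} ->
  exists2 C, 0 <= C & forall b M : R, 0 < b -> b <= a ^+ 2 / 8 -> 1 <= M ->
    \int[mu]_x (f x * (cutoff M x * \1_(collar b) x)) <= C * b.
Proof.
move=> [intf TVf] f0 fO.
have [Cs Cs0 HCs] := dstep_bounded R.
have [Cx Cx0 HCx] := @dcutoff_bound R N.
(* Normalizes the field: |g| <= 2 a wherever the cutoff and the profile do not vanish. *)
pose c1 := (2 * a)^-1; have c10 : 0 < c1 by rewrite invr_gt0 mulr_gt0.
have a20 : 0 < a ^+ 2 by rewrite exprn_gt0.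
(* Lower bound of the main term in the collar, up to the factor 1 / b: the steepness of the profile
   times |g|^2 >= a^2 / 4. *)
pose K1 := c1 * (expR (- 1) / 16 * (a ^+ 2 / 4)).
have sqr_half y : a / 2 <= y -> a ^+ 2 / 4 <= y ^+ 2.
  move=> ay; have -> : a ^+ 2 / 4 = (a / 2) ^+ 2 by field.
  have h2 : 0 <= a / 2 by rewrite divr_ge0// ltW.
  by rewrite lerXn2r// nnegrE (le_trans h2).
have low (y z k : R) : a * (3 / 4) <= z -> z <= k + y -> k <= a / 4 -> a / 2 <= y by lra.
have sum3 (l u x y z x' y' z' : R) : l <= u -> x <= x' -> y <= y' -> z <= z' ->
  l - (x' + y' + z') <= u - x - y - z by lra.
have K10 : 0 < K1 by rewrite !mulr_gt0 ?expR_gt0 ?divr_gt0.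
(* Bounds, independently of [b] and [M], the terms from the gradient of the cutoff, from the first
   factor of the profile and from the Laplacian. *)
pose K2 := c1 * (Cx * (2 * a) + Cs * (8 / a ^+ 2) * (4 * a ^+ 2) + N%:R).
pose TV := fine (total_variation_rV f).
exists (`|TV + K2 * \int[mu]_x f x| / K1); first by rewrite divr_ge0// ltW.
move=> b M b0 ba M1.
have M0 : 0 < M by lra.
(* The three bounds serve [collar_bounds], the estimate |g| >= a / 2 in the collar and the estimate
   |g| <= 2 a. *)
pose kap : R := Num.min b (Num.min (a / 4) (a ^+ 2)).
have kap0 : 0 < kap by rewrite !lt_min b0 a20 divr_gt0.
have kapb : kap <= b by rewrite ge_min lexx.
have kapa : kap <= a / 4 by rewrite !ge_min lexx orbT.
have kapa2 : kap <= a ^+ 2 by rewrite !ge_min lexx !orbT.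
pose Cset := [set x : RN | enorm (x - 0) <= 2 * M] `&` (Omega `&` [set x | a / 2 <= D x]).
have cC : compact Cset.
  apply: compact_closedI; first exact: enorm_ball_compact.
  apply: closedI => //.
  exact (closed_comp (fun x _ => @continuous_sdist R N G G0 x) (@closed_ge R (a / 2))).
have CM x : Cset x -> enorm x <= 2 * M by case=> /=; rewrite subr0.
have M20 : 0 <= 2 * M by lra.
have [|q [g [qC dq lapg qg]]] := soft_distance cG G0 M20 kap0 cC CM.
  move=> x c c' [/= _ [Ox ax]]; apply: uniq => //; lra.
have o := @openT RN.
have gE i : (fun y => g y ord0 i) = 'D_(basis_vec R i) q.
  apply/funext => y; have [_ ->] := dq y (basis_vec R i); by rewrite dot_basis_vec.
have gC k i : Ck_on setT k (fun y => g y ord0 i).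
  by rewrite gE; have [_ /(_ (basis_vec R i))[]] := qC k.+1.
have cg : continuous g.
  by move=> x; apply: continuous_row => i; exact: (Ck_on_cont (gC 0 i)).
pose Z x := collar_profile b (q x).
pose phi x : RN := \row_i (- c1 * (cutoff M x * (Z x * g x ord0 i))).
have phiC k i : Ck_on setT k (fun y => phi y ord0 i).
  rewrite (_ : (fun y => _) = fun x => - c1 * (cutoff M x * (Z x * g x ord0 i))); last first.
    by apply/funext => x; rewrite mxE.
  apply: Ck_onZ => //; apply: Ck_onM => //; first exact: Ck_on_cutoff.
  apply: Ck_onM => //; apply: (@Ck_on_comp _ _ _ setT) => //.
  exact: Ck_on_collar_profile.
have phiC1 : Ck_on setT 1 phi by apply: Ck_on_row.
have phi0 x : 2 * M <= enorm x -> phi x = 0.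
  by move=> xM; apply/rowP => i; rewrite !mxE cutoff_eq0// mul0r mulr0.
have g_le x : enorm x <= 2 * M -> q x <= a ^+ 2 / 2 + 2 * b -> dot (g x) (g x) <= 4 * a ^+ 2.
  by move=> /qg[_ gq _] qx; lra.
have g_le' x : enorm x <= 2 * M -> q x <= a ^+ 2 / 2 + 2 * b -> enorm (g x) <= 2 * a.
  move=> xM qx; rewrite -(@ler_pXn2r _ 2)// ?nnegrE ?enorm_ge0 ?mulr_ge0 ?(ltW a0)//.
  have -> : (2 * a) ^+ 2 = 4 * a ^+ 2 by ring.
  by rewrite sqr_enorm; exact: g_le.
have phi1 x : enorm (phi x) <= 1.
  have -> : phi x = (- c1 * (cutoff M x * Z x)) *: g x.
    by apply/rowP => i; rewrite !mxE !mulrA.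
  rewrite enormZ normrM normrN (gtr0_norm c10) ger0_norm; last first.
    by rewrite mulr_ge0 ?cutoff_ge0 ?collar_profile_ge0.
  have [xM|/ltW xM] := leP (enorm x) (2 * M); last first.
    by rewrite cutoff_eq0// mul0r mulr0 mul0r.
  have [qx|/ltW qx] := leP (q x) (a ^+ 2 / 2 + 2 * b); last first.
    rewrite /Z /collar_profile [flat 0 _]flat_le0 ?mulr0 ?mul0r ?mulr0 ?mul0r//.
    have := ler_wpM2l (ltW (_ : 0 < b^-1)) qx; rewrite invr_gt0 => /(_ b0).
    rewrite mulrDr mulrBr (_ : b^-1 * (2 * b) = 2); last by field; rewrite gt_eqF.
    lra.
  apply: (@le_trans _ _ (c1 * 1 * (2 * a))); last by rewrite mulr1 /c1 mulVf// gt_eqF// mulr_gt0.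
  apply: ler_pM; rewrite ?enorm_ge0 ?g_le'//.
    apply: mulr_ge0; first exact: ltW.
    by apply: mulr_ge0; [exact: cutoff_ge0|exact: collar_profile_ge0].
  rewrite ler_pM2l// mulr_ile1 ?cutoff_ge0 ?collar_profile_ge0 ?cutoff_le1//.
  exact: collar_profile_le1.
have phic : compactly_supported phi.
  exists [set x | enorm (x - 0) <= 2 * M]; first exact: enorm_ball_compact.
  move=> x /=; rewrite subr0 => /negP; rewrite -ltNge => /ltW; exact: phi0.
pose dphi x := - c1 * (Z x * (dcutoff M x * dot x (g x)) +
   cutoff M x * (dcollar_profile b (q x) * dot (g x) (g x)) +
   cutoff M x * Z x * \sum_i 'D_(basis_vec R i) (fun y => g y ord0 i) x).
have divphi x : div phi x = dphi x.
  rewrite divE; last first.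
    by move=> i; have [_ /(_ (basis_vec R i))[H _]] := phiC1; exact: H.
  have dphii i : 'D_(basis_vec R i) (fun y => phi y ord0 i) x =
     - c1 * (Z x * (dcutoff M x * (x ord0 i * g x ord0 i)) +
       cutoff M x * (dcollar_profile b (q x) * (g x ord0 i * g x ord0 i)) +
       cutoff M x * Z x * 'D_(basis_vec R i) (fun y => g y ord0 i) x).
    have dg : is_derive x (basis_vec R i) (fun y => g y ord0 i)
        ('D_(basis_vec R i) (fun y => g y ord0 i) x).
      by apply/derivableP; have [_ /(_ (basis_vec R i))[H _]] := gC 1%N i; exact: H.
    have dZ := is_derive_comp (dq x (basis_vec R i)) (is_derive_collar_profile b (q x)).
    have dc := is_derive_cutoff M x (basis_vec R i).
    have := is_deriveZ (- c1) (is_deriveM dc (is_deriveM dZ dg)).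
    rewrite !dot_basis_vec (_ : _ \*: _ = fun y => phi y ord0 i); last first.
      by apply/funext => y; rewrite mxE.
    by move=> [_ ->]; rewrite /GRing.scale/= !fctE -/(Z x); set L := derive _ _ _; ring.
  rewrite (eq_bigr _ (fun i _ => dphii i)) -mulr_sumr /dphi; congr (_ * _).
  by rewrite !big_split/= -!mulr_sumr.
have cdiv : continuous (fun x => div phi x).
  have -> : div phi = fun x => \sum_i 'D_(basis_vec R i) (fun y => phi y ord0 i) x.
    apply/funext => x; rewrite divE// => i.
    by have [_ /(_ (basis_vec R i))[H _]] := phiC1; exact: H.
  have H : Ck_on setT 0 (fun x => \sum_i 'D_(basis_vec R i) (fun y => phi y ord0 i) x).
    by apply: Ck_on_sum => // i; have [_ /(_ (basis_vec R i))[]] := phiC 1%N i.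
  by move=> x; exact: (Ck_on_cont H).
have div0 x : ~ [set x | enorm (x - 0) <= 2 * M] x -> div phi x = 0.
  move=> /=; rewrite subr0 => /negP; rewrite -ltNge => /ltW xM.
  by rewrite divphi /dphi dcutoff_eq0// cutoff_eq0// !mul0r mulr0 !addr0 mulr0.
have [Cd Cd0 HCd] := continuous_compact_bounded cdiv (@enorm_ball_compact R N 0 (2 * M)) div0.
have intfd : mu.-integrable setT (EFin \o (fun x => f x * div phi x)).
  by apply: (integrable_mul_bounded intf _ HCd); exact: continuous_measurable_rV.
have fd_le : \int[mu]_x (f x * div phi x) <= TV.
  have le : ((\int[mu]_x (f x * div phi x))%:E <= total_variation_rV f)%E.
    by apply: ereal_sup_ubound; exists phi.
  have fn : total_variation_rV f \is a fin_num.
    by rewrite fin_numE; apply/andP; split; [rewrite gt_eqF// (lt_le_trans _ le)// ltNyr|rewrite lt_eqF].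
  by rewrite -lee_fin; apply: le_trans le _; rewrite /TV fineK.
(* Pointwise lower bound of [div phi] on Omega. Integrated against [f], it bounds the mass in the
   collar by the total variation and the total mass. *)
pose w x := K1 / b * (cutoff M x * \1_(collar b) x) - K2.
have mw0 : measurable_fun setT (fun x => cutoff M x * \1_(collar b) x : R).
  apply: measurable_funM; last by apply: measurable_indic; exact: measurable_collar.
  by apply: continuous_measurable_rV; apply: Ck_continuous (Ck_on_cutoff N 0 M).
have w01 x : `|cutoff M x * \1_(collar b) x| <= 1.
  rewrite ger0_norm ?mulr_ge0 ?cutoff_ge0//.
  by rewrite mulr_ile1 ?cutoff_ge0 ?cutoff_le1// indicE; case: (_ \in _).
have intw0 := integrable_mul_bounded intf mw0 w01.
have intw : mu.-integrable setT (EFin \o (fun x => f x * w x)).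
  have H1 := integrableZl measurableT (K1 / b) intw0.
  have H2 := integrableZl measurableT K2 intf.
  have := integrableB measurableT H1 H2.
  apply: eq_integrable => // x _; rewrite /w /=; congr EFin; ring.
have wdiv x : Omega x -> w x <= div phi x.
  move=> Ox; rewrite divphi.
  have K20 : 0 <= K2.
    apply: mulr_ge0; first exact: ltW.
    apply: addr_ge0 => //; apply: addr_ge0.
      by apply: mulr_ge0 => //; rewrite mulr_ge0// ltW.
    apply: mulr_ge0; last by rewrite mulr_ge0// ltW.
    by apply: mulr_ge0; [exact: ltW|rewrite divr_ge0// ltW].
  have [xM|/ltW xM] := leP (enorm x) (2 * M); last first.
    rewrite /w /dphi dcutoff_eq0// cutoff_eq0// !mul0r !mulr0 !addr0 mulr0 sub0r.
    by rewrite oppr_le0.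
  have [qx gx gn] := qg x xM.
  have Dx := Da Ox; have Dx0 : 0 <= D x by exact: sdist_ge0.
  have D2 : D x ^+ 2 <= a ^+ 2 by rewrite lerXn2r ?nnegrE// ltW.
  have qle : q x <= a ^+ 2 / 2 + b.
    by move: qx; rewrite ler_norml => /andP[_]; lra.
  have qle2 : q x <= a ^+ 2 / 2 + 2 * b by lra.
  have gle := g_le x xM qle2; have gle' := g_le' x xM qle2.
  have chi0 := cutoff_ge0 M x; have chi1 := cutoff_le1 M x.
  have Z0 := collar_profile_ge0 b (q x); have Z1 := collar_profile_le1 b (q x).
  have t1 : Z x * (dcutoff M x * dot x (g x)) <= Cx * (2 * a).
    apply: (@le_trans _ _ (1 * (Cx * (2 * a)))); last by rewrite mul1r.
    apply: le_trans (ler_norm _) _; rewrite normrM ger0_norm//.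
    apply: ler_pM => //; apply: le_trans (HCx M x (g x) M0) _.
    apply: ler_pM; rewrite ?enorm_ge0// ?divr_ge0// ?(ltW M0)//.
    by rewrite ler_pdivrMr// ler_peMr.
  have t3 : cutoff M x * Z x * \sum_i 'D_(basis_vec R i) (fun y => g y ord0 i) x <= N%:R.
    have lap : \sum_i 'D_(basis_vec R i) (fun y => g y ord0 i) x <= N%:R.
      rewrite -[in leRHS](card_ord N) -sumr_const; apply: ler_sum => i _; exact: lapg.
    have cZ0 : 0 <= cutoff M x * Z x by rewrite mulr_ge0.
    have cZ1 : cutoff M x * Z x <= 1 by rewrite mulr_ile1.
    have : cutoff M x * Z x * \sum_i 'D_(basis_vec R i) (fun y => g y ord0 i) x <=
      cutoff M x * Z x * N%:R by rewrite ler_wpM2l.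
    have : cutoff M x * Z x * N%:R <= 1 * N%:R by rewrite ler_wpM2r.
    by rewrite mul1r => u v; exact: le_trans v u.
  set s8 := 8 / a ^+ 2 * (q x - a ^+ 2 / 8).
  set tb := b^-1 * (a ^+ 2 / 2 - q x) + 2.
  have gg0 := dot_ge0 (g x).
  have t2 : cutoff M x * (dstep s8 * (8 / a ^+ 2) * flat 0 tb * dot (g x) (g x)) <=
     Cs * (8 / a ^+ 2) * (4 * a ^+ 2).
    have h8 : 0 <= 8 / a ^+ 2 by rewrite divr_ge0// ltW.
    have ds0 := dstep_ge0 s8; have fl0 := flat_ge0 0 tb.
    apply: (@le_trans _ _ (1 * (Cs * (8 / a ^+ 2) * 1 * (4 * a ^+ 2)))); last first.
      by rewrite mul1r mulr1.
    have p1 : 0 <= dstep s8 * (8 / a ^+ 2) by exact: mulr_ge0.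
    have p2 : 0 <= dstep s8 * (8 / a ^+ 2) * flat 0 tb by exact: mulr_ge0.
    apply: ler_pM => //; first exact: mulr_ge0.
    apply: ler_pM => //; apply: ler_pM => //; first by rewrite ler_wpM2r.
    exact: flat0_le1.
  have t4 : K1 / b * (cutoff M x * \1_(collar b) x) <=
    c1 * (cutoff M x * (step s8 * flat 2 tb / b * dot (g x) (g x))).
    have [xT|xT] := boolP (x \in collar b); last first.
      rewrite indicE (negbTE xT) !mulr0; apply: mulr_ge0; first exact: ltW.
      apply: mulr_ge0 => //; apply: mulr_ge0 => //; apply: mulr_ge0; last by rewrite invr_ge0 ltW.
      by apply: mulr_ge0; [exact: step_ge0|exact: flat_ge0].
    rewrite indicE xT mulr1; move: xT; rewrite inE /collar /= => xT.
    have qb : `|q x - D x ^+ 2 / 2| <= b by exact: le_trans qx kapb.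
    have [s1 tb1 tb4 aD] := collar_bounds b0 ba (sdist_ge0 x G0) qb (Da Ox) xT.
    rewrite step_ge1//; have fl := flat2_lower tb1 tb4.
    (* The gradient is within [kap] of x - c, whose length D x is at least 3 a / 4, so |g| >= 3 a /
       4 - a / 4. *)
    have gg : a ^+ 2 / 4 <= dot (g x) (g x).
      have [c Gc xc] := sdist_attained x cG G0.
      have Cx' : Cset x.
        split; rewrite /= ?subr0//; split => //=; apply: le_trans aD.
        by rewrite ler_pM2l// (_ : 2^-1 = 2 / 4 :> R) ?ler_pM2r ?invr_gt0// ?ler_nat//; field.
      have gnx := gn c Cx' Gc xc.
      rewrite -sqr_enorm; apply: sqr_half; apply: (low _ (D x) kap) => //.
      have := enorm_triangle (g x) (x - c) 0; rewrite !subr0 xc (enormB (x - c)) => h.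
      by apply: le_trans h _; rewrite lerD2r.
    have -> : K1 / b * cutoff M x = c1 * (cutoff M x * (expR (- 1) / 16 * (a ^+ 2 / 4) / b)).
      by rewrite /K1; ring.
    rewrite ler_pM2l// ler_wpM2l// mul1r [in leRHS]mulrAC ler_pM2r ?invr_gt0//.
    apply: ler_pM => //; rewrite ?divr_ge0 ?expR_ge0// ltW//.
  rewrite /w /dphi /dcollar_profile -/s8 -/tb /K2.
  set lhs := K1 / b * _ in t4 *.
  move: t1 t2 t3 t4; set A1 := Z x * _; set A3 := cutoff M x * Z x * _.
  move=> t1 t2 t3 t4.
  have e1 : c1 * A1 <= c1 * (Cx * (2 * a)) by rewrite ler_pM2l.
  have e2 : c1 * (cutoff M x * (dstep s8 * (8 / a ^+ 2) * flat 0 tb * dot (g x) (g x))) <=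
     c1 * (Cs * (8 / a ^+ 2) * (4 * a ^+ 2)) by rewrite ler_pM2l.
  have e3 : c1 * A3 <= c1 * N%:R by rewrite ler_pM2l.
  apply: (@le_trans _ _ (c1 * (cutoff M x * (step s8 * flat 2 tb / b * dot (g x) (g x)))
     - c1 * A1 - c1 * (cutoff M x * (dstep s8 * (8 / a ^+ 2) * flat 0 tb * dot (g x) (g x))) - c1 * A3)).
    by rewrite !mulrDr; exact: sum3.
  by rewrite le_eqVlt; apply/orP; left; apply/eqP; ring.
have main : \int[mu]_x (f x * w x) <= \int[mu]_x (f x * div phi x).
  apply: ae_le_Rintegral => //; apply: filterS2 f0 fO => x fx0 fxO.
  have [Ox|nOx] := pselect (Omega x); last by rewrite fxO// !mul0r.
  by rewrite ler_wpM2l// wdiv.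
have wE : \int[mu]_x (f x * w x) =
    K1 / b * \int[mu]_x (f x * (cutoff M x * \1_(collar b) x)) - K2 * \int[mu]_x f x.
  rewrite -(RintegralZl _ measurableT intw0) -(RintegralZl _ measurableT intf).
  rewrite -RintegralB//.
  - by apply: eq_Rintegral => x _; rewrite /w; ring.
  - by have := integrableZl measurableT (K1 / b) intw0.
  - by have := integrableZl measurableT K2 intf.
have := le_trans main fd_le; rewrite wE => H.
have {}H : K1 / b * \int[mu]_x (f x * (cutoff M x * \1_(collar b) x)) <= `|TV + K2 * \int[mu]_x f x|.
  by apply: le_trans (ler_norm _); lra.
rewrite mulrAC ler_pdivlMr// -ler_pdivrMr//.
by apply: le_trans H; rewrite le_eqVlt; apply/orP; left; apply/eqP; field; rewrite gt_eqF.
Qed.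

End collar_mass.

(** * Comparison of integrals without measurability *)

Section lower_integral.
Context d (T : measurableType d) (R : realType) (mu : {measure set T -> \bar R}).

(** The integral of a nonnegative function is a supremum over the simple functions below it, hence
    monotone for arbitrary functions. *)
Lemma ge0_le_lower_integral (E : set T) (f g : T -> \bar R) :
  (forall x, E x -> (0 <= f x)%E) -> (forall x, E x -> (f x <= g x)%E) ->
  (\int[mu]_(x in E) f x <= \int[mu]_(x in E) g x)%E.
Proof.
move=> f0 fg; rewrite !ge0_integralE//; last first.
  by move=> x Ex; exact: le_trans (f0 x Ex) (fg x Ex).
apply: le_ereal_sup => _ [h hf <-]; exists h => // x; apply: le_trans (hf x) _.
rewrite /patch; case: ifP => [|//]; rewrite inE; exact: fg.
Qed.

(* No measurability is assumed of [f]: the integral is then a lower integral. *)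
Lemma le_Rintegral_upper (E : set T) (f g : T -> R) (c : R) :
  measurable E -> (mu E < +oo)%E -> mu.-integrable E (EFin \o g) ->
  (forall x, E x -> - c <= f x <= g x) ->
  \int[mu]_(x in E) f x <= \int[mu]_(x in E) g x.
Proof.
move=> mE Eoo intg fg; rewrite /Rintegral.
pose F := EFin \o f; pose G := EFin \o g.
(* The lower bound on [f] keeps its negative part finite: otherwise the integral could be -oo, which
   [fine] sends to 0, and the comparison could fail. *)
have c0 x : E x -> (F^\- x <= `|c|%:E)%E.
  move=> /fg /andP[cf _]; rewrite /F !funenegE /= -EFin_max lee_fin ge_max normr_ge0 andbT.
  by rewrite lerNl; apply: le_trans cf; rewrite lerN2 ler_norm.
have fgp x : E x -> (F^\+ x <= G^\+ x)%E.
  move=> /fg /andP[_ fgx]; rewrite /F /G !funeposE /= -!EFin_max lee_fin ge_max !le_max.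
  by rewrite fgx lexx orbT.
have fgn x : E x -> (G^\- x <= F^\- x)%E.
  move=> /fg /andP[_ fgx]; rewrite /F /G !funenegE /= -!EFin_max lee_fin ge_max !le_max.
  by rewrite lerN2 fgx lexx orbT.
have lep := ge0_le_lower_integral (fun x _ => funepos_ge0 F x) fgp.
have len := ge0_le_lower_integral (fun x _ => funeneg_ge0 G x) fgn.
have lec := ge0_le_lower_integral (fun x _ => funeneg_ge0 F x) c0.
have Gp := integrable_pos_fin_num mE intg.
have Gn := integrable_neg_fin_num mE intg.
have Fp : (\int[mu]_(x in E) F^\+ x)%E \is a fin_num.
  rewrite ge0_fin_numE; last by apply: integral_ge0 => x _; exact: funepos_ge0.
  by apply: le_lt_trans lep _; rewrite ltey_eq Gp.
have Fn : (\int[mu]_(x in E) F^\- x)%E \is a fin_num.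
  rewrite ge0_fin_numE; last by apply: integral_ge0 => x _; exact: funeneg_ge0.
  apply: le_lt_trans lec _; rewrite integral_cst//.
  by rewrite lte_mul_pinfty.
rewrite (integralE mu E F) (integralE mu E G); apply: fine_le; last exact: leeB.
  by rewrite fin_numB; apply/andP.
by rewrite fin_numB; apply/andP.
Qed.

End lower_integral.

(** * Functions of (t, x) and the time cutoff *)

Section time_derivative.
Variables (R : realType) (V : normedModType R).

Lemma is_derive_time (f : R * V -> R) (t : R) (x : V) l :
  is_derive t (1 : R) (fun s => f (s, x)) l -> is_derive (t, x) ((1, 0) : R * V) f l.
Proof.
move=> /is_derive_line H; apply/is_derive_line.
rewrite (_ : (fun s => f _) = fun s => f (s *: 1 + t, x)) => //.
apply/funext => s; congr f.
by rewrite [RHS]surjective_pairing /= -[in RHS](add0r x) -[in RHS](scaler0 _ s).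
Qed.

Lemma Ck_on_fst k (f : R -> R) : Ck_on setT k f -> Ck_on setT k (fun p : R * V => f p.1).
Proof. by apply: (@Ck_on_linear R _ _ _ k fst f) => // x; exact: cvg_fst. Qed.

Lemma Ck_on_snd k (f : V -> R) : Ck_on setT k f -> Ck_on setT k (fun p : R * V => f p.2).
Proof. by apply: (@Ck_on_linear R _ _ _ k snd f) => // x; exact: cvg_snd. Qed.

End time_derivative.

Section time_cutoff.
Variable R : realType.

(** The first factor, equal to 1 for t >= -1, only makes the support compact. The second falls from
    1 to 0 on [T - de, T]: the entropy inequality has no term at time [T], and the derivative of
    this factor, an approximation of minus the Dirac mass at [T], recovers [rho T]. *)
Definition time_cutoff (T de t : R) : R := step (t + 2) * (1 - step (de^-1 * (t - (T - de)))).
Definition dtime_cutoff (T de t : R) : R := - (dstep (de^-1 * (t - (T - de))) / de).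

Lemma time_cutoff_ge0 T de t : 0 <= time_cutoff T de t.
Proof. by rewrite mulr_ge0 ?step_ge0// subr_ge0 step_le1. Qed.

Lemma time_cutoff_le1 T de t : time_cutoff T de t <= 1.
Proof.
by rewrite mulr_ile1 ?step_ge0 ?step_le1// ?subr_ge0 ?step_le1// gerBl step_ge0.
Qed.

Lemma time_cutoff_late T de t : 0 < de -> T <= t -> time_cutoff T de t = 0.
Proof.
move=> de0 Tt; rewrite /time_cutoff [X in 1 - X]step_ge1 ?subrr ?mulr0//.
by rewrite mulrC ler_pdivlMr//; lra.
Qed.

Lemma time_cutoff_early T de t : t <= -2 -> time_cutoff T de t = 0.
Proof. by move=> t2; rewrite /time_cutoff step_le0 ?mul0r//; lra. Qed.

Lemma time_cutoff0 T de : 0 < de -> de <= T -> time_cutoff T de 0 = 1.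
Proof.
move=> de0 deT; rewrite /time_cutoff step_ge1; last by lra.
by rewrite step_le0 ?subr0 ?mulr1// pmulr_rle0 ?invr_gt0//; lra.
Qed.

Lemma dtime_cutoff_le0 T de t : 0 < de -> dtime_cutoff T de t <= 0.
Proof. by move=> de0; rewrite oppr_le0 divr_ge0 ?dstep_ge0// ltW. Qed.

Lemma dtime_cutoff_supp T de t : 0 < de -> dtime_cutoff T de t != 0 -> T - de <= t <= T.
Proof.
move=> de0; apply: contraR; rewrite negb_and -!ltNge => /orP[tT|Tt].
  by rewrite /dtime_cutoff dstep_le0 ?mul0r ?oppr0// pmulr_rle0 ?invr_gt0//; lra.
by rewrite /dtime_cutoff dstep_ge1 ?mul0r ?oppr0// mulrC ler_pdivlMr//; lra.
Qed.

Lemma is_derive_late_step (T de t : R) :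
  is_derive t (1 : R) (fun s => 1 - step (de^-1 * (s - (T - de)))) (dtime_cutoff T de t).
Proof.
have d1 : is_derive t (1 : R) (fun s => de^-1 * (s - (T - de))) de^-1.
  have := is_derive_affine de^-1 (T - de) 0 t.
  by under eq_fun do rewrite addr0.
have := is_deriveB (is_derive_cst (1 : R) t (1 : R)) (is_derive_comp d1 (is_derive_step _)).
by rewrite sub0r.
Qed.

Lemma is_derive_time_cutoff (T de t : R) : 0 <= t ->
  is_derive t (1 : R) (time_cutoff T de) (dtime_cutoff T de t).
Proof.
move=> t0.
have d1 : is_derive t (1 : R) (fun s => step (s + 2)) (dstep (t + 2)).
  have E : (fun s : R => 1 * (s - 0) + 2) = (fun s => s + 2).
    by apply/funext => s; rewrite subr0 mul1r.
  have d0 := is_derive_affine 1 0 2 t; rewrite E in d0.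
  by have := is_derive_comp d0 (is_derive_step _); rewrite mulr1.
have := is_deriveM d1 (is_derive_late_step T de t).
rewrite step_ge1; last by lra.
rewrite dstep_ge1; last by lra.
by rewrite scaler0 addr0 scale1r.
Qed.

Lemma Ck_on_time_cutoff k T de : Ck_on setT k (time_cutoff T de).
Proof.
have o := @openT R.
apply: Ck_onM => //.
  apply: (@Ck_on_comp _ _ _ setT) => //; first exact: Ck_on_step.
  by apply: Ck_onD => //; [exact: Ck_on_id|exact: Ck_on_cst].
apply: Ck_onB => //; first exact: Ck_on_cst.
apply: (@Ck_on_comp _ _ _ setT) => //; first exact: Ck_on_step.
by apply: Ck_onZ => //; apply: Ck_onB => //; [exact: Ck_on_id|exact: Ck_on_cst].
Qed.

Lemma continuous_dtime_cutoff T de : continuous (dtime_cutoff T de).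
Proof.
have o := @openT R.
apply: (@Ck_continuous _ _ _ 0); apply: Ck_onN => //; apply: Ck_onM => //; last exact: Ck_on_cst.
apply: (@Ck_on_comp _ _ _ setT) => //; first exact: Ck_on_dstep.
by apply: Ck_onZ => //; apply: Ck_onB => //; [exact: Ck_on_id|exact: Ck_on_cst].
Qed.

Lemma integral_dtime_cutoff (T de : R) : 0 < de -> de <= T ->
  \int[lebesgue_measure]_(t in `[0, T]) dtime_cutoff T de t = -1.
Proof.
move=> de0 deT.
have T0 : 0 < T by lra.
pose F s := 1 - step (de^-1 * (s - (T - de))).
have cF : continuous F.
  move=> t; have [H _] := is_derive_late_step T de t.
  exact/differentiable_continuous/derivable1_diffP.
rewrite /Rintegral (@continuous_FTC2 _ _ F) //.
- rewrite /F step_ge1; last by rewrite mulrC ler_pdivlMr//; lra.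
  rewrite step_le0; last by rewrite pmulr_rle0 ?invr_gt0//; lra.
  by rewrite /=; lra.
- by apply: continuous_subspaceT; exact: continuous_dtime_cutoff.
- split.
  + by move=> t _; have [] := is_derive_late_step T de t.
  + by apply: cvg_at_right_filter; exact: cF.
  + by apply: cvg_at_left_filter; exact: cF.
- by move=> t _; rewrite derive1E; have [_ ->] := is_derive_late_step T de t.
Qed.

End time_cutoff.

(** * The entropy inequality tested on a moving front *)

Section flow.
Variables (R : realType) (N : nat).
Local Notation RN := 'rV[R]_N.
Local Notation mu := (@lebesgue_rV R N).
Variables (G Omega : set RN) (a : R).
Implicit Types (t s e de o kap M : R).
Local Notation D := (sdist G).
Hypotheses (a0 : 0 < a) (cG : closed G) (G0 : G !=set0) (cO : closed Omega).
Hypothesis Hout : forall x, D x < a -> Omega x.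
Hypothesis uniq : forall x c c', Omega x -> 0 < D x ->
  G c -> enorm (x - c) = D x -> G c' -> enorm (x - c') = D x -> c = c'.
Variables (rmax V : R) (v : R -> R).
Hypotheses (rmax0 : 0 < rmax) (V0 : 0 < V) (cv : continuous v).
Hypothesis vV : forall s, 0 <= s <= rmax -> 0 <= v s <= V.
Variables (T W L J lam S Cx : R) (w : R -> RN -> RN) (rho0 : RN -> R) (rho : R -> RN -> R).
Hypotheses (T0 : 0 < T) (W0 : 0 <= W) (L0 : 0 <= L) (J0 : 0 < J) (lam0 : 0 < lam).
Hypothesis Hrho : forall t, 0 <= t <= T -> L1_range rmax (rho t).
Hypothesis HS : forall t, 0 <= t <= T -> \int[mu]_x `|rho t x| <= S.
Hypothesis Hcont : forall e, 0 < e -> exists2 de, 0 < de &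
  forall t, 0 <= t <= T -> T - de <= t -> \int[mu]_x `|rho t x - rho T x| <= e.
Hypothesis Hk : forall phi, test_function T phi -> kruzkov_inequality T v w rho0 rho 0 phi.
Hypothesis wc : forall t, 0 <= t <= T -> continuous (w t).
Hypothesis wW : forall t x, 0 <= t <= T -> enorm (w t x) <= W.
Hypothesis wcore : forall t x c, 0 <= t <= T -> 0 < D x < a -> G c -> enorm (x - c) = D x ->
  dot (w t x) (x - c) <= J * expR (lam * t) + L * (a ^+ 2 - D x ^+ 2).
Hypotheses (irho0 : mu.-integrable setT (EFin \o rho0)) (rho00 : {ae mu, forall x, 0 <= rho0 x}).
Hypothesis Cx0 : 0 <= Cx.
Hypothesis HCx : forall M (x u : RN), 0 < M -> `|dcutoff M x * dot x u| <= Cx / M * enorm u.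

(* For [o = 0], [front_width] is the solution of
   [y' = - 2 V (L y + J expR (lam t))] with [y T = 0]. *)
Definition front_rate : R := lam + 2 * V * L.
Definition front_scale : R := 2 * V * J / front_rate.
Definition front_width (o t : R) : R :=
  front_scale * (expR (front_rate * T - 2 * V * L * t) - expR (lam * t)) + o.
Definition dfront_width (t : R) : R :=
  - (front_scale * (2 * V * L * expR (front_rate * T - 2 * V * L * t) + lam * expR (lam * t))).

Lemma front_rate_gt0 : 0 < front_rate.
Proof. by rewrite /front_rate ltr_wpDr// !mulr_ge0// ltW. Qed.

Lemma front_scale_gt0 : 0 < front_scale.
Proof. by rewrite divr_gt0 ?front_rate_gt0// mulr_gt0// mulr_gt0. Qed.

Lemma is_derive_front_width o t : is_derive t (1 : R) (front_width o) (dfront_width t).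
Proof.
have d1 := is_derive_comp (is_derive_affine (- (2 * V * L)) 0 (front_rate * T) t) (is_derive_expR _).
have d2 := is_derive_comp (is_derive_affine lam 0 0 t) (is_derive_expR _).
have := is_deriveD (is_deriveZ front_scale (is_deriveB d1 d2)) (is_derive_cst o t (1 : R)).
rewrite (_ : _ + _ = front_width o); last first.
  apply/funext => s; rewrite /front_width -[LHS]/(front_scale * (expR _ - expR _) + o).
  by rewrite !subr0 !addr0; congr (_ * (expR _ - _) + _); ring.
move=> H; apply: is_derive_eq H _; rewrite addr0 /GRing.scale/= subr0 addr0 /dfront_width.
by rewrite (_ : - (2 * V * L) * t + front_rate * T = front_rate * T - 2 * V * L * t); ring.
Qed.

Lemma Ck_on_front_width k o : Ck_on setT k (front_width o).
Proof.
have oT := @openT R.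
have E (c d : R) : Ck_on setT k (fun t => expR (c - d * t)).
  apply: (@Ck_on_comp _ _ _ setT) => //; first exact: Ck_on_expR.
  apply: Ck_onB => //; first exact: Ck_on_cst.
  by apply: Ck_onZ => //; exact: Ck_on_id.
apply: Ck_onD => //; last exact: Ck_on_cst.
apply: Ck_onZ => //; apply: Ck_onB => //.
apply: (@Ck_on_comp _ _ _ setT) => //; first exact: Ck_on_expR.
by apply: Ck_onZ => //; exact: Ck_on_id.
Qed.

Lemma front_width_bounds o t : 0 <= t <= T ->
  o <= front_width o t <= front_scale * (expR (front_rate * T) - 1) + o.
Proof.
move=> /andP[t0 tT]; have B0 := front_scale_gt0; have m0 := front_rate_gt0.
have VL : 0 <= 2 * V * L by rewrite !mulr_ge0// ltW.
rewrite /front_width lerDr lerD2r; apply/andP; split.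
  apply: mulr_ge0; first exact: ltW.
  rewrite subr_ge0 ler_expR.
  have : front_rate * t <= front_rate * T by rewrite ler_pM2l.
  by rewrite {1}/front_rate mulrDl; lra.
rewrite ler_pM2l//; apply: lerB.
  by rewrite ler_expR gerBl mulr_ge0.
by rewrite -expR0 ler_expR mulr_ge0// ltW.
Qed.

Lemma front_widthE o t :
  - dfront_width t = 2 * V * L * (front_width o t - o) + 2 * V * J * expR (lam * t).
Proof.
have m0 := front_rate_gt0.
rewrite /dfront_width /front_width opprK addrK.
have -> : 2 * V * J = front_scale * front_rate by rewrite /front_scale divfK// gt_eqF.
by rewrite /front_rate; ring.
Qed.

Lemma dfront_width_bounds t : 0 <= t <= T ->
  0 <= - dfront_width t <= front_scale * (front_rate * expR (front_rate * T)).
Proof.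
move=> /andP[t0 tT]; have B0 := front_scale_gt0; have m0 := front_rate_gt0.
have VL : 0 <= 2 * V * L by rewrite !mulr_ge0// ltW.
rewrite /dfront_width opprK; apply/andP; split.
  apply: mulr_ge0; first exact: ltW.
  by apply: addr_ge0; apply: mulr_ge0; rewrite ?expR_ge0// ltW.
rewrite ler_pM2l//; set X := expR (front_rate * T).
have -> : front_rate * X = 2 * V * L * X + lam * X by rewrite {1}/front_rate; ring.
apply: lerD; first by rewrite ler_wpM2l// ler_expR gerBl mulr_ge0.
rewrite ler_pM2l// ler_expR; apply: ler_pM => //; first exact: ltW.
by rewrite /front_rate lerDl.
Qed.

(* The test function is a smoothed indicator of the region
   [D^2 / 2 > a^2 / 2 - front_width t]: it shrinks faster than the flow can carry
   mass into it, and at time [T] it still contains the complement of [Omega]. *)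
Lemma flow_estimate (o kap M e : R) : 0 < o -> 0 < kap -> 4 * kap <= o ->
  (2 * L + W) * kap + 2 * L * o <= J ->
  front_scale * (expR (front_rate * T) - 1) + o + kap <= a ^+ 2 / 8 ->
  1 <= M -> 0 < e ->
  \int[mu]_x (rho T x * (cutoff M x * \1_(~` Omega) x)) <=
  e + V * (Cx / M * W) * S * T +
  \int[mu]_x (rho0 x * (cutoff M x *
     \1_(collar G a (front_scale * (expR (front_rate * T) - 1) + o + kap)) x)).
Proof.
set b := front_scale * _ + o + kap.
move=> o0 kap0 kapo HJ ba M1 e0.
have fin (m E0 I0 : R) : 0 <= - (m - e) + E0 + I0 -> m <= e + E0 + I0 by lra.
have M0 : 0 < M by lra.
have a20 : 0 < a ^+ 2 by rewrite exprn_gt0.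
have [Cs Cs0 HCs] := dstep_bounded R.
have VL : 0 <= 2 * V * L by rewrite !mulr_ge0// ltW.
have VW0 : 0 <= V * (Cx / M * W).
  by apply: mulr_ge0; [exact: ltW|apply: mulr_ge0 => //; apply: divr_ge0 => //; exact: ltW].
pose Cset := [set x : RN | enorm (x - 0) <= 2 * M] `&` (Omega `&` [set x | a / 2 <= D x]).
have cC : compact Cset.
  apply: compact_closedI; first exact: enorm_ball_compact.
  apply: closedI => //.
  exact (closed_comp (fun x _ => @continuous_sdist R N G G0 x) (@closed_ge R (a / 2))).
have CM x : Cset x -> enorm x <= 2 * M by case=> /=; rewrite subr0.
have M20 : 0 <= 2 * M by lra.
have [|q [g [qC dq _ qg]]] := soft_distance cG G0 M20 kap0 cC CM.
  by move=> x c c' [/= _ [Ox ax]]; apply: uniq => //; apply: lt_le_trans ax; rewrite divr_gt0.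
have oRN := @openT RN.
have gE i : (fun y => g y ord0 i) = 'D_(basis_vec R i) q.
  apply/funext => y; have [_ ->] := dq y (basis_vec R i); by rewrite dot_basis_vec.
have cg : continuous g.
  move=> x; apply: continuous_row => i; rewrite gE.
  have [_ /(_ (basis_vec R i))[_ H]] := qC 1%N.
  exact: (@Ck_continuous _ _ _ 0%N _ H x).
have cq : continuous q by exact: Ck_continuous (qC 0%N).
have [de de0 Hde] := Hcont e0.
(* At most [T], so that the time cutoff equals 1 at time 0 as well. *)
pose d1 := Num.min de T.
have d10 : 0 < d1 by rewrite lt_min de0.
have d1T : d1 <= T by rewrite ge_min lexx orbT.
have d1de : d1 <= de by rewrite ge_min lexx.
pose alpha t := a ^+ 2 / 2 - front_width o t.
pose P t x := kap^-1 * (q x - alpha t).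
pose th := time_cutoff T d1; pose dth := dtime_cutoff T d1.
pose phi (p : R * RN) := th p.1 * (cutoff M p.2 * step (P p.1 p.2)).
have th0 t : 0 <= th t by exact: time_cutoff_ge0.
have th1 t : th t <= 1 by exact: time_cutoff_le1.
have chi0 x := cutoff_ge0 M x; have chi1 x := cutoff_le1 M x.
have phi_smooth : smooth phi.
  move=> k; have oP := @openT (R * RN)%type.
  apply: Ck_onM => //; first exact/Ck_on_fst/Ck_on_time_cutoff.
  apply: Ck_onM => //; first exact/Ck_on_snd/Ck_on_cutoff.
  apply: (@Ck_on_comp _ _ _ setT) => //; first exact: Ck_on_step.
  apply: Ck_onZ => //; apply: Ck_onB => //; first exact: Ck_on_snd.
  apply: Ck_on_fst; apply: Ck_onB; [exact: openT|exact: Ck_on_cst|exact: Ck_on_front_width].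
have phi_supp : compactly_supported phi.
  exists (`[-2, T]%classic `*` [set x | enorm (x - 0) <= 2 * M]).
    by apply: compact_setX; [exact: segment_compact|exact: enorm_ball_compact].
  move=> [t x] /= /not_andP[tT|xM].
    have [t2|t2] := leP t (-2); first by rewrite /phi /= /th time_cutoff_early ?mul0r.
    have [Tt|tT'] := leP T t; first by rewrite /phi /= /th time_cutoff_late ?mul0r.
    by exfalso; apply: tT; rewrite in_itv/= !ltW.
  rewrite subr0 in xM; move/negP: xM; rewrite -ltNge => /ltW xM.
  by rewrite /phi /= cutoff_eq0// mul0r mulr0.
have phi_test : test_function T phi.
  split => // t x _; rewrite /phi /=; apply: mulr_ge0 => //.
  by apply: mulr_ge0 => //; exact: step_ge0.
have dphi_t t x : 0 <= t -> 'D_((1, 0) : R * RN) phi (t, x) =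
    dth t * (cutoff M x * step (P t x))
    - th t * (cutoff M x * (dstep (P t x) / kap)) * (- dfront_width t).
  move=> t0.
  have dP : is_derive t (1 : R) (fun s => kap^-1 * (q x - (a ^+ 2 / 2 - front_width o s)))
      (kap^-1 * dfront_width t).
    have := is_deriveD (is_derive_cst (q x - a ^+ 2 / 2) t (1 : R)) (is_derive_front_width o t).
    rewrite add0r => /(is_deriveZ kap^-1).
    rewrite (_ : _ \*: _ = fun s => kap^-1 * (q x - (a ^+ 2 / 2 - front_width o s)))//.
    apply/funext => s; rewrite -[LHS]/(kap^-1 * (q x - a ^+ 2 / 2 + front_width o s)).
    by congr (_ * _); ring.
  have dS := is_deriveZ (cutoff M x) (is_derive_comp dP (is_derive_step _)).
  have dF := is_deriveM (is_derive_time_cutoff T d1 t0) dS.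
  have [_ ->] := is_derive_time (f := phi) (t := t) (x := x) dF.
  rewrite /GRing.scale/= -/(dth t) -/(th t) -/(alpha t) -/(P t x).
  by rewrite -[_ *: step _]/(cutoff M x * step (P t x)); ring.
have gradphi t x i : grad (fun y => phi (t, y)) x ord0 i =
    th t * (dcutoff M x * x ord0 i * step (P t x) +
            cutoff M x * (dstep (P t x) / kap) * g x ord0 i).
  rewrite mxE.
  have dP : is_derive x (basis_vec R i) (fun y => kap^-1 * (q y - alpha t)) (kap^-1 * g x ord0 i).
    have := is_deriveB (dq x (basis_vec R i)) (is_derive_cst (alpha t) x (basis_vec R i)).
    by rewrite subr0 dot_basis_vec => /(is_deriveZ kap^-1).
  have dc := is_derive_cutoff M x (basis_vec R i).
  have [_] := is_deriveZ (th t) (is_deriveM dc (is_derive_comp dP (is_derive_step _))).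
  rewrite dot_basis_vec => E.
  by rewrite [LHS]E /GRing.scale/= -/(P t x); ring.
have dotgrad t x : dot (w t x) (grad (fun y => phi (t, y)) x) =
    th t * (dcutoff M x * dot x (w t x) * step (P t x)) +
    th t * (cutoff M x * (dstep (P t x) / kap)) * dot (g x) (w t x).
  rewrite /dot [in RHS]mulr_sumr [in RHS]mulr_suml !mulr_sumr -big_split/=.
  by apply: eq_bigr => i _; rewrite gradphi; ring.
(* For k = 0 the integrand is |rho| [H t x rho], because rho v(rho) sgn rho = |rho| v(rho). [X2] is
   the weight of the transition layer of the step; it is of order 1 / kap, so its terms must be
   discarded by their sign. *)
pose X2 t x := th t * (cutoff M x * (dstep (P t x) / kap)).
pose H t x (s : R) := dth t * (cutoff M x * step (P t x)) - X2 t x * (- dfront_width t)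
   + v s * (th t * (dcutoff M x * dot x (w t x) * step (P t x)) + X2 t x * dot (g x) (w t x)).
have X20 t x : 0 <= X2 t x.
  apply: mulr_ge0 => //; apply: mulr_ge0 => //; apply: divr_ge0; last exact: ltW.
  exact: dstep_ge0.
have X2le t x : X2 t x <= Cs / kap.
  have dk0 : 0 <= dstep (P t x) / kap by apply: divr_ge0; [exact: dstep_ge0|exact: ltW].
  apply: (@le_trans _ _ (dstep (P t x) / kap)); last by rewrite ler_pM2r ?invr_gt0.
  apply: (@le_trans _ _ (cutoff M x * (dstep (P t x) / kap))).
    by apply: ler_piMl => //; exact: mulr_ge0.
  exact: ler_piMl.
have X2supp t x : 0 <= t <= T -> X2 t x != 0 ->
    [/\ enorm x <= 2 * M, alpha t < q x & q x < alpha t + kap].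
  move=> t0T X2n; split.
  - by rewrite leNgt; apply: contra X2n => /ltW xM; rewrite /X2 cutoff_eq0// mul0r mulr0.
  - rewrite ltNge; apply: contra X2n => qa; rewrite /X2 dstep_le0 ?mul0r ?mulr0//.
    by rewrite /P pmulr_rle0 ?invr_gt0// subr_le0.
  - rewrite ltNge; apply: contra X2n => qa; rewrite /X2 dstep_ge1 ?mul0r ?mulr0//.
    by rewrite /P mulrC ler_pdivlMr//; lra.
have beta_bd t : 0 <= t <= T -> o <= front_width o t /\ front_width o t + kap <= a ^+ 2 / 8.
  move=> t0T; have /andP[u1 u2] := front_width_bounds o t0T; split => //.
  by apply: le_trans ba; rewrite /b; lra.
have kapa : kap <= a ^+ 2 / 8.
  by have [|h1 h2] := beta_bd 0; [rewrite lexx ltW|lra].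
have gle t x : 0 <= t <= T -> X2 t x != 0 -> enorm (g x) <= 2 * a.
  move=> t0T /(X2supp t x t0T)[xM qa qk].
  have [_ gx _] := qg x xM; have [h1 h2] := beta_bd t t0T.
  rewrite -(@ler_pXn2r _ 2)// ?nnegrE ?enorm_ge0 ?mulr_ge0 ?(ltW a0)//.
  have -> : (2 * a) ^+ 2 = 4 * a ^+ 2 by ring.
  rewrite sqr_enorm; apply: le_trans gx _; rewrite /alpha in qk; lra.
(* In the transition layer the flow raises [q] at rate at most - [dfront_width], the rate at which
   the front level [alpha] rises. *)
have key t x s : 0 <= t <= T -> 0 <= s <= rmax ->
    X2 t x * (v s * dot (g x) (w t x) - (- dfront_width t)) <= 0.
  move=> t0T srm; have [->|X2n] := eqVneq (X2 t x) 0; first by rewrite mul0r.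
  apply: mulr_ge0_le0 => //; rewrite subr_le0.
  have [xM qa qk] := X2supp t x t0T X2n; have [h1 h2] := beta_bd t t0T.
  have [qD _ gn] := qg x xM; move: qD; rewrite ler_norml => /andP[qD1 qD2].
  rewrite /alpha in qa qk.
  have D0 : 0 <= D x by exact: sdist_ge0.
  have Dlt : D x < a.
    rewrite -(@ltr_pXn2r _ 2)// ?nnegrE ?(ltW a0)//; lra.
  have Ox := Hout Dlt.
  have Dge : a / 2 <= D x.
    rewrite -(@ler_pXn2r _ 2)// ?nnegrE ?divr_ge0 ?(ltW a0)//.
    have -> : (a / 2) ^+ 2 = a ^+ 2 / 4 by field.
    lra.
  have [c Gc xc] := sdist_attained x cG G0.
  have Cx' : Cset x by split; rewrite /= ?subr0.
  have gnx := gn c Cx' Gc xc.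
  have D0a : 0 < D x < a by rewrite Dlt andbT; lra.
  have wx := wcore t0T D0a Gc xc.
  have dotle : dot (g x) (w t x) <= J * expR (lam * t) + L * (a ^+ 2 - D x ^+ 2) + kap * W.
    have -> : g x = (x - c) + (g x - (x - c)) by rewrite addrC subrK.
    rewrite dotDl (dotC (x - c)); apply: lerD => //.
    apply: le_trans (cauchy_schwarz _ _) _; apply: ler_pM; rewrite ?enorm_ge0//.
    exact: wW.
  have E1 : 1 <= expR (lam * t).
    by case/andP: t0T => t0 _; rewrite -expR0 ler_expR mulr_ge0// ltW.
  (* In the layer q x > alpha t, and D x^2 / 2 >= q x - kap, whence a^2 - D x^2 < 2 (front_width +
     kap). *)
  have Ldist : L * (a ^+ 2 - D x ^+ 2) <= L * (2 * (front_width o t + kap)).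
    by rewrite ler_wpM2l//; lra.
  have JE : J <= J * expR (lam * t) by rewrite ler_peMr// ltW.
  have Vdot : V * dot (g x) (w t x) <= - dfront_width t.
    rewrite (front_widthE o).
    have : V * dot (g x) (w t x) <=
        V * (J * expR (lam * t) + L * (2 * (front_width o t + kap)) + kap * W).
      by rewrite ler_pM2l//; apply: le_trans dotle _; rewrite lerD2r lerD2l.
    move/le_trans; apply.
    (* The front equation has 2 V J where V J would balance the inflow: the surplus, at least V J,
       absorbs V ((2 L + W) kap + 2 L o). *)
    have -> : 2 * V * L * (front_width o t - o) + 2 * V * J * expR (lam * t) =
      V * (2 * L * (front_width o t - o) + 2 * (J * expR (lam * t))) by ring.
    rewrite ler_pM2l//; lra.
  have [+ _] := andP (dfront_width_bounds t0T); have [v0 v1] := andP (vV srm) => dw0.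
  have [d0|d0] := leP (dot (g x) (w t x)) 0.
    by apply: le_trans dw0; exact: mulr_ge0_le0.
  by apply: le_trans Vdot; rewrite ler_pM2r.
(* Outside Omega q x >= a^2 / 2 - kap, and the width is at least o >= 4 kap: the offset [o] keeps
   the step equal to 1 there even at time [T]. *)
have stepOut t x : 0 <= t <= T -> enorm x <= 2 * M -> ~ Omega x -> step (P t x) = 1.
  move=> t0T xM nOx; apply: step_ge1; rewrite /P mulrC ler_pdivlMr// mul1r.
  have aD : a <= D x by rewrite leNgt; apply/negP => /Hout.
  have [qD _ _] := qg x xM; move: qD; rewrite ler_norml => /andP[qD1 _].
  have a2D : a ^+ 2 <= D x ^+ 2 by rewrite lerXn2r ?nnegrE ?(ltW a0)// (le_trans _ aD)// ltW.
  have [h1 h2] := beta_bd t t0T; rewrite /alpha; lra.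
have dth0 t : dth t <= 0 by exact: dtime_cutoff_le0.
have absY t x : 0 <= t <= T ->
    `|th t * (dcutoff M x * dot x (w t x) * step (P t x))| <= Cx / M * W.
  move=> t0T; rewrite normrM ger0_norm//.
  apply: (@le_trans _ _ `|dcutoff M x * dot x (w t x) * step (P t x)|); first exact: ler_piMl.
  rewrite normrM [X in _ * X]ger0_norm ?step_ge0//.
  apply: (@le_trans _ _ `|dcutoff M x * dot x (w t x)|).
    by apply: ler_piMr => //; exact: step_le1.
  apply: le_trans (HCx _ _ M0) _; rewrite ler_wpM2l ?wW//.
  by apply: divr_ge0 => //; exact: ltW.
have Hle t x s : 0 <= t <= T -> 0 <= s <= rmax ->
    H t x s <= dth t * (cutoff M x * \1_(~` Omega) x) + V * (Cx / M * W).
  move=> t0T srm; have k1 := key t x s t0T srm.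
  (* [dth] is nonpositive, so replacing the step by a smaller function increases the term. *)
  have s1 : dth t * (cutoff M x * step (P t x)) <= dth t * (cutoff M x * \1_(~` Omega) x).
    apply: ler_wnM2l => //.
    have [xM|/ltW xM] := leP (enorm x) (2 * M); last by rewrite cutoff_eq0// !mul0r.
    rewrite ler_wpM2l// indicE; have [xO|_] := boolP (x \in ~` Omega); last exact: step_ge0.
    by rewrite stepOut//; move: xO; rewrite inE.
  have [v0 v1] := andP (vV srm).
  have y1 : v s * (th t * (dcutoff M x * dot x (w t x) * step (P t x))) <= V * (Cx / M * W).
    apply: le_trans (ler_norm _) _; rewrite normrM ger0_norm//.
    by apply: ler_pM => //; exact: absY.
  rewrite /H; move: k1 s1 y1; move: (X2 t x) (dot (g x) (w t x)) (- dfront_width t) (v s).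
  move: (th t * _) (dth t * _) (dth t * _) (V * _) => Y A2 A1 A3 X d fw vs k1 s1 y1.
  have -> : A1 - X * fw + vs * (Y + X * d) = A1 + vs * Y + X * (vs * d - fw) by ring.
  lra.
(* A crude bound, used only for integrability and for the lower bound that the outer integral
   requires. *)
pose Cb := Cs / d1 + Cs / kap * (front_scale * (front_rate * expR (front_rate * T)))
   + V * (Cx / M * W + Cs / kap * (2 * a * W)).
have Habs t x s : 0 <= t <= T -> 0 <= s <= rmax -> `|H t x s| <= Cb.
  move=> t0T srm; have [v0 v1] := andP (vV srm).
  have [fw0 fw1] := andP (dfront_width_bounds t0T).
  have c1 : `|dth t * (cutoff M x * step (P t x))| <= Cs / d1.
    have p0 : 0 <= cutoff M x * step (P t x) by apply: mulr_ge0 => //; exact: step_ge0.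
    have p1 : cutoff M x * step (P t x) <= 1 by apply: mulr_ile1 => //; [exact: step_ge0|exact: step_le1].
    rewrite normrM [X in _ * X]ger0_norm// /dth /dtime_cutoff normrN.
    set ds := dstep _ / d1; have ds0 : 0 <= ds by apply: divr_ge0; [exact: dstep_ge0|exact: ltW].
    rewrite ger0_norm//; apply: (@le_trans _ _ ds); first exact: ler_piMr.
    by rewrite ler_pM2r ?invr_gt0.
  have c2 : `|X2 t x * (- dfront_width t)| <=
      Cs / kap * (front_scale * (front_rate * expR (front_rate * T))).
    by rewrite ger0_norm; [apply: ler_pM|exact: mulr_ge0].
  have c3 : `|X2 t x * dot (g x) (w t x)| <= Cs / kap * (2 * a * W).
    have [->|X2n] := eqVneq (X2 t x) 0.
      rewrite mul0r normr0; apply: mulr_ge0; first by apply: divr_ge0; exact: ltW.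
      by apply: mulr_ge0 => //; apply: mulr_ge0 => //; exact: ltW.
    rewrite normrM ger0_norm//; apply: ler_pM => //.
    apply: le_trans (norm_dot_le _ _) _; apply: ler_pM; rewrite ?enorm_ge0//.
      exact: (gle t).
    exact: wW.
  rewrite /H /Cb; apply: le_trans (ler_normD _ _) _; apply: lerD.
    by apply: le_trans (ler_normB _ _) _; exact: lerD.
  rewrite normrM ger0_norm//; apply: ler_pM => //.
  by apply: le_trans (ler_normD _ _) _; apply: lerD => //; exact: absY.
have Hcts t : 0 <= t <= T -> continuous (fun x => cutoff M x * step (P t x)) /\
   continuous (X2 t) /\ continuous (fun x => th t * (dcutoff M x * dot x (w t x) * step (P t x)))
   /\ continuous (fun x => dot (g x) (w t x)).
  move=> t0T.
  have cP : Ck_on setT 0 (P t).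
    apply: Ck_onZ => //; apply: Ck_onB => //; exact: Ck_on_cst.
  have cS : Ck_on setT 0 (fun x => step (P t x)).
    by apply: (@Ck_on_comp _ _ _ setT) => //; exact: Ck_on_step.
  have cdw f : continuous f -> Ck_on setT 0 (fun x => dot (f x) (w t x)).
    by move=> cf; split => // x _; exact: (continuous_dot cf (wc t0T)).
  have cdc : Ck_on setT 0 (@dcutoff R N M).
    apply: Ck_onN => //; apply: Ck_onM => //; last exact: Ck_on_cst.
    apply: (@Ck_on_comp _ _ _ setT) => //; first exact: Ck_on_dstep.
    apply: Ck_onM => //; last exact: Ck_on_cst.
    by apply: Ck_onB => //; [exact: Ck_on_sqr|exact: Ck_on_cst].
  split; first by apply: (@Ck_continuous _ _ _ 0); apply: Ck_onM => //; exact: Ck_on_cutoff.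
  split.
    apply: (@Ck_continuous _ _ _ 0); apply: Ck_onZ => //; apply: Ck_onM => //; first exact: Ck_on_cutoff.
    apply: Ck_onM => //; last exact: Ck_on_cst.
    by apply: (@Ck_on_comp _ _ _ setT) => //; exact: Ck_on_dstep.
  split; last exact: Ck_continuous (cdw _ cg).
  apply: (@Ck_continuous _ _ _ 0); apply: Ck_onZ => //; apply: Ck_onM => //; apply: Ck_onM => //.
  by apply: (cdw id) => x; exact: cvg_id.
(* The density takes values in [0, rmax] only almost everywhere; truncating it makes the bounds on
   [H] hold at every point. *)
pose rr t x := Num.max 0 (Num.min (rho t x) rmax).
have rr_ge0 t x : 0 <= rr t x by rewrite le_max lexx.
have rr_rng t x : 0 <= rr t x <= rmax.
  by rewrite rr_ge0 /= ge_max (ltW rmax0) ge_min lexx orbT.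
have rrE t : 0 <= t <= T -> {ae mu, forall x, rr t x = rho t x}.
  move=> /Hrho[_]; apply: filterS => x /andP[r0 r1].
  by rewrite /rr min_l// max_r.
have mrho t : 0 <= t <= T -> measurable_fun setT (rho t).
  by move=> /Hrho[irho _]; exact: integrable_measurable irho.
have mrr t : 0 <= t <= T -> measurable_fun setT (rr t).
  by move=> t0T; apply: measurable_maxr => //; apply: measurable_minr => //; exact: mrho.
have irr t : 0 <= t <= T -> mu.-integrable setT (EFin \o rr t).
  move=> t0T; have [irho _] := Hrho t0T; apply: integrable_dominated irho _; first exact: mrr.
  move=> x; rewrite /rr; have [r0|r0] := leP (rho t x) 0.
    by rewrite max_l ?normr0// ge_min r0.
  rewrite !ger0_norm// ?(ltW r0)//; last by rewrite le_max lexx.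
  by rewrite ge_max (ltW r0) ge_min lexx.
have mH t : 0 <= t <= T -> measurable_fun setT (fun x => H t x (rr t x)).
  move=> t0T; have [k1 [k2 [k3 k4]]] := Hcts t t0T.
  have mC (f : RN -> R) : continuous f -> measurable_fun setT f := @continuous_measurable_rV R N f.
  apply: measurable_funD.
    apply: measurable_funB; first by apply: measurable_funM => //; exact: mC.
    by apply: measurable_funM => //; exact: mC.
  apply: measurable_funM; last first.
    by apply: measurable_funD; [exact: mC|apply: measurable_funM; exact: mC].
  by apply: measurableT_comp; [exact: continuous_measurable_fun|exact: mrr].
have irH t : 0 <= t <= T -> mu.-integrable setT (EFin \o (fun x => rr t x * H t x (rr t x))).
  move=> t0T; apply: (@integrable_mul_bounded _ _ _ _ _ _ Cb); [exact: irr|exact: mH|].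
  by move=> x; exact: Habs.
pose integrand t x := `|rho t x - 0| * 'D_((1, 0) : R * RN) phi (t, x) +
  ((rho t x * v (rho t x) - 0 * v 0) * dot (w t x) (grad (fun y => phi (t, y)) x)
   - 0 * v 0 * div (w t) x * phi (t, x)) * Num.sg (rho t x - 0).
have integrandE t x : 0 <= t -> integrand t x = `|rho t x| * H t x (rho t x).
  move=> t0; rewrite /integrand !subr0 !mul0r !subr0 dphi_t// dotgrad /H -/(X2 t x).
  rewrite [`|rho t x|]normrEsg; ring.
have GE t : 0 <= t <= T -> \int[mu]_x integrand t x = \int[mu]_x (rr t x * H t x (rr t x)).
  move=> t0T; have t0 : 0 <= t by case/andP: t0T.
  rewrite /Rintegral; congr fine; apply: ae_eq_integral => //.
  - apply/measurable_EFinP; rewrite (_ : integrand t = fun x => `|rho t x| * H t x (rho t x)); last first.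
      by apply/funext => x; exact: integrandE.
    have [k1 [k2 [k3 k4]]] := Hcts t t0T.
    have mC (f : RN -> R) : continuous f -> measurable_fun setT f := @continuous_measurable_rV R N f.
    apply: measurable_funM; first by apply: measurableT_comp => //; exact: mrho.
    apply: measurable_funD.
      apply: measurable_funB; first by apply: measurable_funM => //; exact: mC.
      by apply: measurable_funM => //; exact: mC.
    apply: measurable_funM; last first.
      by apply: measurable_funD; [exact: mC|apply: measurable_funM; exact: mC].
    by apply: measurableT_comp; [exact: continuous_measurable_fun|exact: mrho].
  - by apply/measurable_EFinP; apply: measurable_funM; [exact: mrr|exact: mH].
  - apply: filterS (rrE t t0T) => x rx _ /=; rewrite integrandE// rx.
    by rewrite ger0_norm// -rx.
have rr_int t : 0 <= t <= T -> \int[mu]_x rr t x <= S.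
  move=> t0T; apply: le_trans (HS t0T); apply: ae_le_Rintegral; first exact: irr.
    by apply: integrable_norm; have [] := Hrho t0T.
  by apply: filterS (rrE t t0T) => x ->; exact: ler_norm.
have S0 : 0 <= S.
  have TT : 0 <= T <= T by rewrite lexx ltW.
  by apply: le_trans (rr_int T TT); apply: Rintegral_ge0.
pose wt x := cutoff M x * \1_(~` Omega) x : R.
have mwt : measurable_fun setT wt.
  apply: measurable_funM.
    by apply: continuous_measurable_rV; apply: Ck_continuous (Ck_on_cutoff N 0 M).
  by apply: measurable_indic; apply: measurableC; exact: closed_measurable_rV.
have wt01 x : 0 <= wt x <= 1.
  by rewrite /wt indicE; case: (_ \in _) => /=; rewrite ?mulr1 ?mulr0 ?chi0 ?chi1 ?lexx ?ler01.
have wtn x : `|wt x| <= 1 by have /andP[u1 u2] := wt01 x; rewrite ger0_norm.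
pose mM t := \int[mu]_x (rho t x * wt x).
have imM t : 0 <= t <= T -> mu.-integrable setT (EFin \o (fun x => rho t x * wt x)).
  by move=> /Hrho[irho _]; exact: integrable_mul_bounded irho mwt wtn.
have irrw t : 0 <= t <= T -> mu.-integrable setT (EFin \o (fun x => rr t x * wt x)).
  by move=> /irr irho; exact: integrable_mul_bounded irho mwt wtn.
have mME t : 0 <= t <= T -> \int[mu]_x (rr t x * wt x) = mM t.
  move=> t0T; rewrite /mM /Rintegral; congr fine; apply: ae_eq_integral => //.
  - by apply/measurable_EFinP; exact: integrable_measurable (irrw t t0T).
  - by apply/measurable_EFinP; exact: integrable_measurable (imM t t0T).
  - by apply: filterS (rrE t t0T) => x /= -> _.
have TT : 0 <= T <= T by rewrite lexx ltW.
have mMcont t : 0 <= t <= T -> T - d1 <= t -> mM T - e <= mM t.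
  move=> t0T td; have tde : T - de <= t by lra.
  have := Hde t t0T tde => intd.
  have iT := imM T TT; have it := imM t t0T.
  have [iT' _] := Hrho TT; have [it' _] := Hrho t0T.
  have id : mu.-integrable setT (EFin \o (fun x => `|rho t x - rho T x|)).
    by apply: integrable_norm; have := integrableB measurableT it' iT'.
  rewrite lerBlDr -lerBlDl -(RintegralB measurableT iT it).
  apply: le_trans intd; apply: le_Rintegral => //; first by have := integrableB measurableT iT it.
  move=> x _; rewrite -mulrBl; apply: le_trans (ler_norm _) _.
  by rewrite normrM distrC; apply: ler_piMr.
have Gle t : 0 <= t <= T -> \int[mu]_x integrand t x <= dth t * (mM T - e) + V * (Cx / M * W) * S.
  move=> t0T; rewrite GE//.
  apply: (@le_trans _ _ (\int[mu]_x (rr t x * (dth t * wt x + V * (Cx / M * W))))).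
    apply: le_Rintegral => //; first exact: irH.
      have i1 := integrableZl measurableT (dth t) (irrw t t0T).
      have i2 := integrableZl measurableT (V * (Cx / M * W)) (irr t t0T).
      have := integrableD measurableT i1 i2.
      by apply: eq_integrable => // x _ /=; congr EFin; ring.
    by move=> x _; rewrite ler_wpM2l// Hle.
  have -> : \int[mu]_x (rr t x * (dth t * wt x + V * (Cx / M * W))) =
      dth t * mM t + V * (Cx / M * W) * \int[mu]_x rr t x.
    rewrite -mME// -(RintegralZl _ measurableT (irrw t t0T)) -(RintegralZl _ measurableT (irr t t0T)).
    rewrite -RintegralD//.
    - by apply: eq_Rintegral => x _; ring.
    - by have := integrableZl measurableT (dth t) (irrw t t0T).
    - by have := integrableZl measurableT (V * (Cx / M * W)) (irr t t0T).
  apply: lerD; last by rewrite ler_wpM2l// rr_int.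
  have [->|dn] := eqVneq (dth t) 0; first by rewrite !mul0r.
  have /andP[td _] := dtime_cutoff_supp d10 dn.
  by apply: ler_wnM2l => //; exact: mMcont.
(* Lower bound for [le_Rintegral_upper], which spares proving that the inner integral is measurable
   in time. *)
have Gge t : 0 <= t <= T -> - (Cb * S) <= \int[mu]_x integrand t x.
  move=> t0T; rewrite GE//.
  have Cb0 : 0 <= Cb by apply: le_trans (Habs t 0 0 t0T _); rewrite ?lexx ?(ltW rmax0).
  have ii := integrableZl measurableT (- Cb) (irr t t0T).
  apply: (@le_trans _ _ (\int[mu]_x (- Cb * rr t x))).
    rewrite (RintegralZl _ measurableT (irr t t0T)) mulNr lerN2.
    by rewrite ler_wpM2l// rr_int.
  apply: le_Rintegral => //; first exact: irH.
  move=> x _; rewrite mulrC ler_wpM2l//.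
  by have := Habs t x (rr t x) t0T (rr_rng t x); rewrite ler_norml => /andP[].
have K := Hk phi_test.
rewrite /kruzkov_inequality in K.
have mI : (lebesgue_measure `[0, T] : \bar R) = T%:E.
  by rewrite lebesgue_measure_itv/= lte_fin T0 oppr0 adde0.
have iU : lebesgue_measure.-integrable `[0, T]
    (EFin \o (fun t => dth t * (mM T - e) + V * (Cx / M * W) * S)).
  apply: continuous_compact_integrable; first exact: segment_compact.
  apply: continuous_subspaceT => t; apply: cvgD; last exact: cvg_cst.
  by apply: cvgM; [exact: continuous_dtime_cutoff|exact: cvg_cst].
have outer : \int[lebesgue_measure]_(t in `[0, T]) (\int[mu]_x integrand t x) <=
   \int[lebesgue_measure]_(t in `[0, T]) (dth t * (mM T - e) + V * (Cx / M * W) * S).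
  apply: (@le_Rintegral_upper _ _ _ _ _ _ _ (Cb * S)) => //.
    by rewrite [X in (X < _)%E]mI ltry.
  by move=> t /=; rewrite in_itv/= => t0T; rewrite Gge// Gle.
have idth : lebesgue_measure.-integrable `[0, T] (EFin \o dth).
  apply: continuous_compact_integrable; first exact: segment_compact.
  by apply: continuous_subspaceT; exact: continuous_dtime_cutoff.
have outerE : \int[lebesgue_measure]_(t in `[0, T]) (dth t * (mM T - e) + V * (Cx / M * W) * S) =
   - (mM T - e) + V * (Cx / M * W) * S * T.
  rewrite RintegralD//.
  - rewrite (RintegralZr _ _ idth)// integral_dtime_cutoff// mulN1r Rintegral_cst//.
    by rewrite [X in fine X]mI.
  - have mIT : measurable (`[0, T]%classic : set (measurableTypeR R)) by exact: measurable_itv.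
    by have := integrableZr mIT (mM T - e) idth.
  - apply: continuous_compact_integrable; first exact: segment_compact.
    by apply: continuous_subspaceT => t; exact: cvg_cst.
have init : \int[mu]_x (`|rho0 x - 0| * phi (0, x)) <=
   \int[mu]_x (rho0 x * (cutoff M x * \1_(collar G a b) x)).
  have cphi : continuous (fun x => phi (0, x)).
    have [|k1 _] := Hcts 0; first by rewrite lexx ltW.
    rewrite /phi /=; under eq_fun do rewrite /th time_cutoff0// mul1r.
    exact: k1.
  have phi01 x : `|phi (0, x)| <= 1.
    rewrite /phi /th /= time_cutoff0// mul1r ger0_norm ?mulr_ge0 ?step_ge0//.
    by apply: mulr_ile1; rewrite ?step_ge0 ?step_le1.
  have mc : measurable_fun setT (fun x => cutoff M x * \1_(collar G a b) x : R).
    apply: measurable_funM.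
      by apply: continuous_measurable_rV; apply: Ck_continuous (Ck_on_cutoff N 0 M).
    by apply: measurable_indic; exact: measurable_collar.
  have c01 x : `|cutoff M x * \1_(collar G a b) x| <= 1.
    rewrite ger0_norm ?mulr_ge0//.
    by rewrite indicE; case: (_ \in _) => /=; rewrite ?mulr1 ?mulr0 ?chi1 ?ler01.
  apply: ae_le_Rintegral.
  - have i0 : mu.-integrable setT (EFin \o (fun x => `|rho0 x - 0|)).
      by under eq_fun do rewrite subr0; exact: integrable_norm.
    by apply: (integrable_mul_bounded i0 _ phi01); exact: continuous_measurable_rV.
  - exact: integrable_mul_bounded irho0 mc c01.
  apply: filterS rho00 => x r0; rewrite subr0 ger0_norm// ler_wpM2l//.
  rewrite /phi /th /= time_cutoff0// mul1r.
  have [xM|/ltW xM] := leP (enorm x) (2 * M); last by rewrite cutoff_eq0// !mul0r.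
  rewrite ler_wpM2l// indicE; have [_|xc] := boolP (x \in collar G a b); first exact: step_le1.
  rewrite step_le0// /P pmulr_rle0 ?invr_gt0// subr_le0.
  move: xc; rewrite notin_setE /collar /= => /negP; rewrite -leNgt => Dx.
  have [qD _ _] := qg x xM; move: qD; rewrite ler_norml => /andP[_ qD2].
  (* The term [kap] of [b] offsets the error of [q]: outside the collar q x <= alpha 0, where the
     step vanishes. *)
  have -> : alpha 0 = a ^+ 2 / 2 - b + kap.
    by rewrite /alpha /front_width !mulr0 subr0 expR0 /b; ring.
  have h : q x <= D x ^+ 2 / 2 + kap by rewrite -lerBlDl.
  by apply: le_trans h _; rewrite lerD2r.
move: K; rewrite -/(integrand) => K.
by apply: fin; rewrite -outerE; exact: le_trans K (lerD outer init).
Qed.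

End flow.

(** * Pointwise and Lipschitz bounds from Sobolev norms; L^1 continuity and tails *)

Section sobolev_bounds.
Variables (R : realType) (N : nat).
Local Notation RN := 'rV[R]_N.
Local Notation mu := (@lebesgue_rV R N).

Lemma line_lipschitz (f : RN -> R) (x h : RN) (c t : R) :
  (forall y, derivable f y h) -> (forall y, `|'D_h f y| <= c) ->
  `|f (t *: h + x) - f x| <= c * `|t|.
Proof.
move=> df Dc.
have dline (y : RN) (s : R) : is_derive s (1 : R) (fun s => f (s *: h + y)) ('D_h f (s *: h + y)).
  apply/is_derive_line.
  have /is_derive_line := derivableP (df (s *: h + y)).
  rewrite (_ : (fun t => f (t *: h + (s *: h + y))) = (fun t => f ((t *: 1 + s) *: h + y)))//.
  by apply/funext => u; rewrite addrA -scalerDl /GRing.scale/= mulr1.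
have pos (y : RN) (s : R) : 0 < s -> `|f (s *: h + y) - f y| <= c * `|s|.
  move=> s0.
  have cl : {within `[0, s], continuous (fun s => f (s *: h + y))}.
    apply: continuous_subspaceT => u; have [du _] := dline y u.
    exact/differentiable_continuous/derivable1_diffP.
  have [u _] := MVT s0 (fun u _ => dline y u) cl.
  by rewrite scale0r add0r subr0 => ->; rewrite normrM ler_wpM2r.
have [t0|t0|->] := ltrgtP t 0; [|exact: pos|].
  have := pos (t *: h + x) (- t); rewrite oppr_gt0 => /(_ t0).
  by rewrite addrA -scalerDl addNr scale0r add0r distrC normrN.
by rewrite scale0r add0r subrr !normr0 mulr0.
Qed.

(** Telescopes along the points [z k], which change [y] into [x] one coordinate at a time, so that
    only partial derivatives enter. *)
Lemma coord_lipschitz (f : RN -> R) (x y : RN) (c : R) :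
  (forall z j, derivable f z (basis_vec R j)) ->
  (forall z j, `|'D_(basis_vec R j) f z| <= c) ->
  `|f x - f y| <= c * \sum_j `|x ord0 j - y ord0 j|.
Proof.
move=> df Dc.
pose z k : RN := \row_j (if (j < k)%N then x ord0 j else y ord0 j).
have z0 : z 0%N = y by apply/rowP => j; rewrite mxE.
have zN : z N = x by apply/rowP => j; rewrite mxE ltn_ord.
rewrite -{1}zN -{1}z0 -(telescope_sumr (fun k => f (z k)) (leq0n N)) big_mkord mulr_sumr.
apply: le_trans (ler_norm_sum _ _ _) _; apply: ler_sum => j _.
have -> : z j.+1 = (x ord0 j - y ord0 j) *: basis_vec R j + z j.
  apply/rowP => i; rewrite !mxE eqxx /= ltnS leq_eqVlt.
  have [->|ij] := eqVneq i j; first by rewrite ltnn eqxx mulr1 subrK.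
  by rewrite (_ : (i == j :> nat) = false) ?mulr0 ?add0r//; apply/negbTE.
by apply: line_lipschitz => u; [exact: df|exact: Dc].
Qed.

Lemma Lp_norm_ge0 p (f : RN -> R) : (0 <= Lp_norm p f)%E.
Proof. exact: Lnorm_ge0. Qed.

Lemma W1p_normv_bounds (w : RN -> RN) (c : R) : Ck_on setT 1 w ->
  (W1p_normv +oo w <= c%:E)%E ->
  (forall x, enorm (w x) <= c) /\
  (forall x i j, `|'D_(basis_vec R j) (fun y => w y ord0 i) x| <= c).
Proof.
move=> wC Hw.
have h1 : (Lp_normv +oo w <= c%:E)%E.
  by apply: le_trans Hw; rewrite leeDl// Lp_norm_ge0.
have h2 : (Lp_normv +oo (Dmx w) <= c%:E)%E.
  by apply: le_trans Hw; rewrite leeDr// Lp_norm_ge0.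
have oT := @openT RN.
have dw i j : Ck_on setT 0 (fun x => 'D_(basis_vec R j) (fun y => w y ord0 i) x).
  by have [_ /(_ (basis_vec R j))[]] := Ck_on_coordinate i oT wC.
have dwd x j : derivable w x (basis_vec R j).
  by have [_ /(_ (basis_vec R j))[H _]] := wC; exact: H.
have DE x i j : Dmx w x i j = 'D_(basis_vec R j) (fun y => w y ord0 i) x.
  by rewrite mxE derive_row.
split=> [x|x i j].
  have cw : continuous w by exact: Ck_continuous wC.
  have := Lp_normy_le (f := fun x => enorm (w x)) _ h1 x.
  rewrite ger0_norm ?enorm_ge0//; apply=> y.
  by apply: (@continuous_comp _ _ _ w (@enorm R 1 N)); [exact: cw|exact: continuous_enorm].
have cD : continuous (fun x => enorm (Dmx w x)).
  have H : Ck_on setT 0 (fun x => \sum_i \sum_j Dmx w x i j * Dmx w x i j).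
    apply: Ck_on_sum => // i'; apply: Ck_on_sum => // j'.
    have E : (fun x => Dmx w x i' j') = (fun x => 'D_(basis_vec R j') (fun y => w y ord0 i') x).
      by apply/funext => y; exact: DE.
    by apply: Ck_onM => //; rewrite E.
  have cH := Ck_continuous H.
  move=> y; exact: (@cvg_comp _ _ _ (fun x => \sum_i \sum_j Dmx w x i j * Dmx w x i j)
    Num.sqrt _ _ _ (cH y) (@sqrt_continuous _ _)).
have := Lp_normy_le cD h2 x; rewrite ger0_norm ?enorm_ge0// => H.
by rewrite -DE; apply: le_trans (coord_le_enorm _ _ _) H.
Qed.

(** The two factors [N] come from bounding the sums of the coordinates of x - y and of [u] by [N]
    times the Euclidean norm. *)
Lemma field_lipschitz (w : RN -> RN) (c : R) (x y u : RN) : Ck_on setT 1 w ->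
  (W1p_normv +oo w <= c%:E)%E ->
  dot (w x - w y) u <= c * N%:R * N%:R * (enorm (x - y) * enorm u).
Proof.
move=> wC Hw; have [w1 w2] := W1p_normv_bounds wC Hw.
have c0 : 0 <= c by apply: le_trans (w1 0); exact: enorm_ge0.
have oT := @openT RN.
have lip i : `|w x ord0 i - w y ord0 i| <= c * (N%:R * enorm (x - y)).
  apply: le_trans (coord_lipschitz (f := fun z => w z ord0 i) (c := c) x y _ _) _.
  - move=> z j; have [_ /(_ (basis_vec R j))[H _]] := Ck_on_coordinate i oT wC.
    exact: H.
  - by move=> z j; exact: w2.
  - rewrite ler_wpM2l//; apply: le_trans _ (sum_coord_le _).
    by rewrite le_eqVlt; apply/orP; left; apply/eqP; apply: eq_bigr => j _; rewrite !mxE.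
apply: (@le_trans _ _ (\sum_i (c * (N%:R * enorm (x - y))) * `|u ord0 i|)).
  apply: ler_sum => i _; rewrite !mxE; apply: le_trans (ler_norm _) _.
  by rewrite normrM ler_wpM2r.
rewrite -mulr_sumr; apply: (@le_trans _ _ (c * (N%:R * enorm (x - y)) * (N%:R * enorm u))).
  rewrite ler_wpM2l ?sum_coord_le//; apply: mulr_ge0 => //; apply: mulr_ge0 => //.
  exact: enorm_ge0.
by rewrite le_eqVlt; apply/orP; left; apply/eqP; ring.
Qed.

Lemma Lp_norm1E (f : RN -> R) : mu.-integrable setT (EFin \o f) ->
  Lp_norm 1 f = (\int[mu]_x `|f x|)%:E.
Proof.
move=> intf; rewrite /Lp_norm Lnorm1 /Rintegral fineK//.
exact: integrable_fin_num (integrable_norm intf).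
Qed.

Lemma L1_integrable rmax (f : RN -> R) : L1_range rmax f -> mu.-integrable setT (EFin \o f).
Proof. by case. Qed.

Lemma integrable_sub (f g : RN -> R) : mu.-integrable setT (EFin \o f) ->
  mu.-integrable setT (EFin \o g) -> mu.-integrable setT (EFin \o (fun x => f x - g x)).
Proof. by move=> intf intg; have := integrableB measurableT intf intg. Qed.

Lemma continuous_in_L1_near rmax (T : R) (rho : R -> RN -> R) :
  (forall t : R, 0 <= t <= T -> L1_range rmax (rho t)) -> continuous_in_L1 `[0, T] rho ->
  forall t e : R, 0 <= t <= T -> 0 < e -> exists2 de, 0 < de &
    forall s : R, 0 <= s <= T -> `|s - t| < de -> \int[mu]_x `|rho s x - rho t x| <= e.
Proof.
move=> Hr cr t e tT e0.
have tT' : `[0, T]%classic t by rewrite /= in_itv.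
have H := cr t tT'.
have : nbhs (0%E : \bar R) [set y : \bar R | (y < e%:E)%E].
  by apply: open_nbhs_nbhs; split; [exact: open_ereal_lt_ereal|rewrite /= lte_fin].
move=> /H /nbhs_ballP[de /= de0 Hde].
exists de => // s sT sde.
have := Hde s; rewrite /ball /= distrC => /(_ sde); rewrite in_itv => /(_ sT).
rewrite Lp_norm1E ?lte_fin; first exact: ltW.
by apply: integrable_sub; [exact: L1_integrable (Hr s sT)|exact: L1_integrable (Hr t tT)].
Qed.

Lemma L1_norm_bounded rmax (T : R) (rho : R -> RN -> R) : 0 < T ->
  (forall t : R, 0 <= t <= T -> L1_range rmax (rho t)) -> continuous_in_L1 `[0, T] rho ->
  exists S, forall t : R, 0 <= t <= T -> \int[mu]_x `|rho t x| <= S.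
Proof.
move=> T0 Hr cr; pose n t := \int[mu]_x `|rho t x|.
have nle s t : 0 <= s <= T -> 0 <= t <= T -> n s <= n t + \int[mu]_x `|rho s x - rho t x|.
  move=> sT tT; have i1 := L1_integrable (Hr s sT); have i2 := L1_integrable (Hr t tT).
  have i3 := integrable_sub i1 i2.
  rewrite -RintegralD//; try exact: integrable_norm.
  apply: le_Rintegral => //; first exact: integrable_norm.
    by have := integrableD measurableT (integrable_norm i2) (integrable_norm i3).
  by move=> x _; rewrite -{1}(subrK (rho t x) (rho s x)) addrC ler_normD.
have cn : {within `[0, T], continuous n}.
  apply/subspace_continuousP => t /=; rewrite in_itv/= => tT.
  apply/cvgrPdist_le => e e0.
  have [de de0 H] := continuous_in_L1_near Hr cr tT e0.
  rewrite near_withinE; apply/nbhs_ballP; exists de => //= s.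
  rewrite /ball/= distrC => sde; rewrite in_itv/= => sT.
  have h := H s sT sde; have h1 := nle s t sT tT; have h2 := nle t s tT sT.
  have E : \int[mu]_x `|rho t x - rho s x| = \int[mu]_x `|rho s x - rho t x|.
    by apply: eq_Rintegral => x _; exact: distrC.
  rewrite E in h2; rewrite /from_subspace ler_norml.
  have {}h1 : n s <= n t + e by apply: le_trans h1 _; rewrite lerD2l.
  have {}h2 : n t <= n s + e by apply: le_trans h2 _; rewrite lerD2l.
  by move: (n s) (n t) h1 h2 => ns nt h1 h2; apply/andP; split; lra.
have [c _ Hc] := EVT_max (ltW T0) cn.
by exists (n c) => t tT; apply: Hc; rewrite in_itv.
Qed.

(** Dominated convergence along the integer radii; [M] can be taken beyond any threshold, as other
    constraints on it require. *)
Lemma cutoff_tail (f : RN -> R) (A : set RN) e : mu.-integrable setT (EFin \o f) ->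
  measurable A -> 0 < e -> forall M0, exists2 M, M0 <= M &
  \int[mu]_x (f x * \1_A x) <= \int[mu]_x (f x * (cutoff M x * \1_A x)) + e.
Proof.
move=> intf mA e0 M0.
have mc M : measurable_fun setT (fun x => cutoff M x * \1_A x : R).
  apply: measurable_funM; last exact: measurable_indic.
  by apply: continuous_measurable_rV; apply: Ck_continuous (Ck_on_cutoff N 0 M).
have c01 M x : `|cutoff M x * \1_A x| <= 1.
  rewrite ger0_norm ?mulr_ge0 ?cutoff_ge0//.
  by rewrite indicE; case: (_ \in _) => /=; rewrite ?mulr1 ?mulr0 ?cutoff_le1 ?ler01.
have i01 M := integrable_mul_bounded intf (mc M) (c01 M).
have iA : mu.-integrable setT (EFin \o (fun x => f x * \1_A x)).
  apply: (integrable_mul_bounded (c := 1) intf); first exact: measurable_indic.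
  by move=> x; rewrite indicE; case: (_ \in _) => /=; rewrite ?normr1 ?normr0 ?ler01.
pose F (k : nat) x := (f x * (cutoff k.+1%:R x * \1_A x))%:E.
have [|||||_ _] := @dominated_convergence _ _ _ mu setT measurableT F
    (EFin \o (fun x => f x * \1_A x)) (EFin \o (fun x => `|f x|)).
- by move=> k; apply/measurable_EFinP; exact: integrable_measurable (i01 _).
- by apply/measurable_EFinP; exact: integrable_measurable iA.
- apply: nearW => x _; apply: cvg_near_cst.
  near=> k; rewrite /F /= cutoff_eq1 ?mul1r//.
  near: k; exists (Num.truncn (enorm x)).+1%N => // k /= kx.
  by rewrite ltW// (lt_trans (Num.Theory.truncnS_gt _))// ltr_nat ltnS.
- exact: integrable_norm.
- apply: nearW => x k _; rewrite /F /= lee_fin normrM.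
  by apply: ler_piMr => //; exact: c01.
move=> cv.
have cv' : (fun k => \int[mu]_x (f x * (cutoff k.+1%:R x * \1_A x))) @ \oo -->
    \int[mu]_x (f x * \1_A x).
  have /fine_cvgP[_] : (\int[mu]_x F k x)%E @[k --> \oo] --> (\int[mu]_x (f x * \1_A x))%:E.
    rewrite /Rintegral fineK//; exact: integrable_fin_num iA.
  exact.
have /cvgrPdist_lt/(_ e e0)[k0 _ Hk0] := cv'.
pose k := maxn k0 (Num.truncn (`|M0|)).+1.
exists k.+1%:R.
  apply: le_trans (ler_norm _) _; rewrite ltW// (lt_trans (Num.Theory.truncnS_gt _))// ltr_nat ltnS.
  exact: leq_maxr.
have := Hk0 k (leq_maxl _ _); rewrite ltr_norml => /andP[_]; lra.
Unshelve. all: by end_near. Qed.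

End sobolev_bounds.

(** The limit of [flow_estimate] as [o], [kap] and [e] tend to 0 and [M] to infinity: [Y M] is the
    truncated mass outside, [X] the full one, and [F] the limit width at time 0. *)
Lemma front_limit (R : realType) (L W J Q F C b0 X : R) (Y : R -> R) :
  0 <= L -> 0 <= W -> 0 < J -> 0 <= Q -> 0 <= C -> F < b0 ->
  (forall o kap M e, 0 < o -> 0 < kap -> 4 * kap <= o -> (2 * L + W) * kap + 2 * L * o <= J ->
     F + o + kap <= b0 -> 1 <= M -> 0 < e -> Y M <= e + Q / M + C * (F + o + kap)) ->
  (forall e M0, 0 < e -> exists2 M, M0 <= M & X <= Y M + e) ->
  X <= C * F.
Proof.
move=> L0 W0 J0 Q0 C0 Fb H tail; apply/ler_addgt0Pr => e e0.
have d0 : 0 < b0 - F by rewrite subr_gt0.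
have LW0 : 0 < 4 * L + W + 1 by rewrite ltr_wpDl// addr_ge0// mulr_ge0.
have C10 : 0 < C + 1 by rewrite ltr_wpDl.
(* With kap = o / 4, the three bounds ensure the constraint on [J], the width F + o + kap <= b0, and
   an error C (o + kap) below e / 4. *)
pose o := Num.min (J / (4 * L + W + 1)) (Num.min ((b0 - F) / 2) (e / (8 * (C + 1)))).
have o0 : 0 < o by rewrite !lt_min !divr_gt0// mulr_gt0.
have oJ : (4 * L + W + 1) * o <= J by rewrite mulrC -ler_pdivlMr// /o ge_min lexx.
have ob : 2 * o <= b0 - F by rewrite mulrC -ler_pdivlMr// /o !ge_min lexx orbT.
have oe : (8 * (C + 1)) * o <= e by rewrite mulrC -ler_pdivlMr ?mulr_gt0// /o !ge_min lexx !orbT.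
have Lo : 0 <= L * o by rewrite mulr_ge0// ltW.
have Wo : 0 <= W * o by rewrite mulr_ge0// ltW.
have Co : 0 <= C * o by rewrite mulr_ge0// ltW.
have [|M M0 XM] := tail (e / 4) (Num.max 1 (4 * Q / e)); first by rewrite divr_gt0.
have [M1 MQ] : 1 <= M /\ 4 * Q / e <= M by split; apply: le_trans M0; rewrite le_max lexx ?orbT.
have QM : Q / M <= e / 4.
  rewrite ler_pdivrMr ?(lt_le_trans ltr01)//; move: MQ; rewrite ler_pdivrMr// => MQ; lra.
have {}H := H o (o / 4) M (e / 4) o0.
have K : C * (F + o + o / 4) = C * F + C * o + C * o / 4 by ring.
have : Y M <= e / 4 + Q / M + C * (F + o + o / 4) by apply: H; lra.
rewrite K => H'; lra.
Qed.

(** * The mass outside Omega *)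

Section outer_mass.
Variables (R : realType) (N : nat) (Omega : set 'rV[R]_N) (rmax : R).
Local Notation RN := 'rV[R]_N.
Local Notation mu := (@lebesgue_rV R N).
Hypothesis cO : closed Omega.
Implicit Types f : RN -> R.

Definition outer_mass f : R := \int[mu]_x (f x * \1_(~` Omega) x).

Let ind_le1 (A : set RN) x : `|\1_A x : R| <= 1.
Proof. by rewrite indicE; case: (_ \in _) => /=; rewrite ?normr1 ?normr0 ?ler01. Qed.

Let mO : measurable Omega := closed_measurable_rV cO.
Let mCO : measurable (~` Omega) := measurableC mO.

Let integrable_indic (A : set RN) f : measurable A -> mu.-integrable setT (EFin \o f) ->
  mu.-integrable setT (EFin \o (fun x => f x * \1_A x)).
Proof.
move=> mA intf; apply: (integrable_mul_bounded intf) (ind_le1 A).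
exact: measurable_indic.
Qed.

Lemma outer_mass_lip f g : mu.-integrable setT (EFin \o f) -> mu.-integrable setT (EFin \o g) ->
  outer_mass f <= outer_mass g + \int[mu]_x `|f x - g x|.
Proof.
move=> intf intg; have i3 := integrable_norm (integrable_sub intf intg).
have ig := integrable_indic mCO intg.
rewrite /outer_mass -RintegralD//; apply: le_Rintegral => //.
- exact: integrable_indic.
- by have := integrableD measurableT ig i3.
move=> x _; rewrite -lerBlDl -mulrBl; apply: le_trans (ler_norm _) _.
by rewrite normrM; apply: ler_piMr => //; exact: ind_le1.
Qed.

Lemma outer_mass_le f : mu.-integrable setT (EFin \o f) -> outer_mass f <= \int[mu]_x `|f x|.
Proof.
move=> intf; apply: le_Rintegral => //; first exact: integrable_indic.
  exact: integrable_norm.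
move=> x _; apply: le_trans (ler_norm _) _.
by rewrite normrM; apply: ler_piMr => //; exact: ind_le1.
Qed.

Lemma norm_outer_mass f : L1_range rmax f ->
  \int[mu]_x `|f x * \1_(~` Omega) x| = outer_mass f.
Proof.
move=> [intf f0]; have i := integrable_indic mCO intf.
apply/eqP; rewrite eq_le; apply/andP; split; apply: ae_le_Rintegral => //;
  try exact: integrable_norm; last first.
  by apply: filterS f0 => x _; exact: ler_norm.
apply: filterS f0 => x /andP[fx _].
by rewrite ger0_norm// mulr_ge0// indicE.
Qed.

Lemma outer_mass_ge0 f : L1_range rmax f -> 0 <= outer_mass f.
Proof. by move=> Lf; rewrite -(norm_outer_mass Lf); apply: Rintegral_ge0. Qed.

Lemma outer_mass_eq0 f : L1_range rmax f -> outer_mass f <= 0 -> spt f `<=` Omega.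
Proof.
move=> Lf m0; have [intf f0] := Lf; apply/(spt_ae _ cO).
have i := integrable_indic mCO intf.
have m0' : outer_mass f = 0 by apply/eqP; rewrite eq_le m0 outer_mass_ge0.
have i0 : (\int[mu]_x `|(f x * \1_(~` Omega) x)%:E| = 0)%E.
  have H := congr1 EFin (norm_outer_mass Lf); move: H.
  rewrite m0' /Rintegral fineK; first exact.
  exact: integrable_fin_num (integrable_norm i).
have mf : measurable_fun setT (fun x => (f x * \1_(~` Omega) x)%:E).
  by apply/measurable_EFinP; exact: integrable_measurable i.
have := (ae_eq_integral_abs mu measurableT mf).1 i0.
apply: filterS => x /(_ I) /= [] + Ox; rewrite indicE mem_set//= mulr1.
exact.
Qed.

(** The restriction is admissible in the sign hypothesis on the boundary, and its L^1 distance to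
    [f] is what the Lipschitz estimate of the nonlocal term sees. *)
Lemma restriction_L1_range f : L1_range rmax f ->
  [/\ L1_range rmax (fun x => f x * \1_Omega x), spt (fun x => f x * \1_Omega x) `<=` Omega &
    Lp_norm 1 (fun x => f x - f x * \1_Omega x) = (outer_mass f)%:E].
Proof.
move=> Lf; have [intf f0] := Lf; have i := integrable_indic mO intf.
split.
- split=> //; apply: filterS f0 => x /andP[fx0 fx1].
  rewrite indicE; case: (_ \in _); rewrite ?mulr1 ?fx0// mulr0 lexx.
  exact: le_trans fx1.
- apply/(spt_ae _ cO); apply: filterE => x Ox.
  by rewrite indicE memNset//= mulr0.
rewrite Lp_norm1E; last exact: integrable_sub.
congr (_%:E); rewrite -norm_outer_mass//; apply: eq_Rintegral => x _.
by congr (`|_|); rewrite -{1}(mulr1 (f x)) -mulrBr indicC !indicE; case: (_ \in _); rewrite /=; ring.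
Qed.
End outer_mass.

Lemma normy_sub_le (R : realType) (N : nat) (w1 w2 : 'rV[R]_N -> 'rV[R]_N) (c : R) :
  continuous w1 -> continuous w2 ->
  (Lp_normv +oo (fun x => w1 x - w2 x)%R <= c%:E)%E -> forall x, enorm (w1 x - w2 x) <= c.
Proof.
move=> c1 c2 H x; have := Lp_normy_le (f := fun x => enorm (w1 x - w2 x)) _ H x.
rewrite ger0_norm ?enorm_ge0//; apply=> y.
apply: (@continuous_comp _ _ _ (fun x => w1 x - w2 x) (@enorm R 1 N)).
  exact: (continuousB (c1 y) (c2 y)).
exact: continuous_enorm.
Qed.

(** * From the normal velocity on the boundary to the velocity in the collar *)

Section core_inflow.
Variables (R : realType) (N : nat).
Local Notation RN := 'rV[R]_N.
Variables (Omega U : set RN) (r a : R).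
Hypotheses (oU : open U) (OmegaE : Omega = closure U).
Hypotheses (bd0 : boundary Omega !=set0) (r0 : 0 < r).
Hypothesis Cd : Ck_upto_boundary (tubular (boundary Omega) r `&` interior Omega)
  (boundary Omega) 2 (dist_boundary Omega).
Hypotheses (a0 : 0 < a) (ar : a < r).
Local Notation G := (inner_core Omega a).
Local Notation D := (sdist G).

(** Compare [w x] with [w p], where x - c = - D x n(p) and |x - p| = a - D x. The first difference
    contributes at most L (a - D x) D x, and [w p] at most D x k. *)
Lemma core_inflow (w : RN -> RN) (L k : R) x c : 0 <= L -> 0 <= k ->
  (forall x y u, dot (w x - w y) u <= L * (enorm (x - y) * enorm u)) ->
  (forall p, boundary Omega p -> - k <= dot (w p) (inward_normal Omega p)) ->
  0 < D x < a -> G c -> enorm (x - c) = D x ->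
  dot (w x) (x - c) <= a * k + L * (a ^+ 2 - D x ^+ 2).
Proof.
move=> L0 k0 lip wn /andP[Dx Dxa] Gc xc.
have ix : interior Omega x.
  apply: contrapT => nix; have := core_dist_out oU OmegaE bd0 Cd a0 ar nix.
  by rewrite leNgt Dxa.
have [p [bp xp xcE]] := core_direction oU OmegaE bd0 r0 Cd a0 ar ix Dx Gc xc.
have h1 := lip x p (x - c); rewrite dotBl xp xc in h1.
have h2 : dot (w p) (x - c) <= a * k.
  rewrite xcE dotNr dotZr; have := wn p bp; move: (dot _ _) => z zk.
  apply: (@le_trans _ _ (D x * k)); last by rewrite ler_wpM2r// ltW.
  by rewrite -mulrN ler_wpM2l ?(ltW Dx)// lerNl.
have h3 : L * ((a - D x) * D x) <= L * (a ^+ 2 - D x ^+ 2).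
  rewrite ler_wpM2l// subr_sqr ler_wpM2l ?subr_ge0 ?(ltW Dxa)// lerDr ltW//.
move: h1 h2 h3; move: (dot (w x) _) (dot (w p) _) => y z h1 h2 h3; lra.
Qed.

End core_inflow.

(** * The Gronwall argument *)

Section decay.
Variables (R : realType) (N : nat).
Local Notation RN := 'rV[R]_N.
Local Notation mu := (@lebesgue_rV R N).
Variables (G Omega : set RN) (a : R).
Implicit Types (t s e : R).
Local Notation D := (sdist G).
Hypotheses (a0 : 0 < a) (cG : closed G) (G0 : G !=set0) (cO : closed Omega).
Hypothesis Hout : forall x, D x < a -> Omega x.
Hypothesis uniq : forall x c c', Omega x -> 0 < D x ->
  G c -> enorm (x - c) = D x -> G c' -> enorm (x - c') = D x -> c = c'.
Variables (rmax V : R) (v : R -> R).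
Hypotheses (rmax0 : 0 < rmax) (V0 : 0 < V) (cv : continuous v).
Hypothesis vV : forall s, 0 <= s <= rmax -> 0 <= v s <= V.
Variables (T W L k C S : R) (w : R -> RN -> RN) (rho0 : RN -> R) (rho : R -> RN -> R).
Hypotheses (T0 : 0 < T) (W0 : 0 <= W) (L0 : 0 <= L) (k0 : 0 < k) (C0 : 0 <= C).
Hypothesis Hrho : forall t, 0 <= t <= T -> L1_range rmax (rho t).
Hypothesis HS : forall t, 0 <= t <= T -> \int[mu]_x `|rho t x| <= S.
Hypothesis Hcont : forall t e, 0 <= t <= T -> 0 < e -> exists2 de, 0 < de &
  forall s, 0 <= s <= T -> `|s - t| < de -> \int[mu]_x `|rho s x - rho t x| <= e.
Hypothesis Hk : forall T', 0 < T' <= T -> forall phi, test_function T' phi ->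
  kruzkov_inequality T' v w rho0 rho 0 phi.
Hypothesis wc : forall t, 0 <= t <= T -> continuous (w t).
Hypothesis wW : forall t x, 0 <= t <= T -> enorm (w t x) <= W.
Hypothesis winflow : forall t x c, 0 <= t <= T -> 0 < D x < a -> G c -> enorm (x - c) = D x ->
  dot (w t x) (x - c) <= k * outer_mass Omega (rho t) + L * (a ^+ 2 - D x ^+ 2).
Hypotheses (irho0 : mu.-integrable setT (EFin \o rho0)) (rho00 : {ae mu, forall x, 0 <= rho0 x}).
Hypothesis Hcollar : forall b M : R, 0 < b -> b <= a ^+ 2 / 8 -> 1 <= M ->
  \int[mu]_x (rho0 x * (cutoff M x * \1_(collar G a b) x)) <= C * b.
Local Notation m t := (outer_mass Omega (rho t)).

(** [rho 0] and [rho0] are linked only through the entropy inequality, so the bound at time 0 is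
    obtained from positive times by L^1 continuity. *)
Lemma outer_mass_initial (A lam : R) : 0 < A -> 0 < lam ->
  (forall t, 0 < t <= T -> m t <= A * expR (lam * t)) -> m 0 <= A.
Proof.
move=> A0 lam0 H; apply/ler_addgt0Pr => e e0.
have T00 : 0 <= (0 : R) <= T by rewrite lexx ltW.
have e20 : 0 < e / 2 by rewrite divr_gt0.
have [de de0 Hde] := Hcont T00 e20.
have q1 : 1 < 1 + e / 2 / A by rewrite ltrDl divr_gt0.
(* Small enough for continuity and for A e^(lam s) <= A + e / 2. *)
pose s := Num.min (Num.min (de / 2) T) (ln (1 + e / 2 / A) / lam).
have s0 : 0 < s by rewrite !lt_min T0 !divr_gt0 ?ln_gt0.
have sT : s <= T by rewrite /s !ge_min lexx orbT.
have sde : s < de.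
  by apply: (@le_lt_trans _ _ (de / 2)); rewrite ?/s ?ge_min ?lexx//; lra.
have sl : lam * s <= ln (1 + e / 2 / A).
  by rewrite mulrC -ler_pdivlMr// /s ge_min lexx orbT.
have sI : 0 <= s <= T by rewrite (ltW s0).
have h1 : m s <= A + e / 2.
  have -> : A + e / 2 = A * (1 + e / 2 / A) by rewrite mulrDr mulr1 mulrCA divff ?gt_eqF// mulr1.
  apply: le_trans (H s _) _; first by rewrite s0.
  by rewrite ler_pM2l// -[leRHS]lnK ?ler_expR// posrE (lt_trans ltr01).
have i1 := L1_integrable (Hrho T00); have i2 := L1_integrable (Hrho sI).
have h2 := outer_mass_lip cO i1 i2.
have h3 : \int[mu]_x `|rho 0 x - rho s x| <= e / 2.
  rewrite (_ : \int[mu]_x _ = \int[mu]_x `|rho s x - rho 0 x|).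
    by apply: Hde => //; rewrite subr0 gtr0_norm.
  by apply: eq_Rintegral => x _; exact: distrC.
apply: le_trans h2 _; apply: le_trans (lerD h1 h3) _; lra.
Qed.

(* By the BV estimate, the mass outside at time [T'] is at most proportional to the
   front width; this width integrates the assumed bound on the outer mass over
   [[0, T']], so a large weight [lam] makes the resulting factor at most [1 / 2]. *)
Lemma outer_mass_halve : exists2 lam, 0 < lam & forall A : R, 0 < A ->
  (forall t, 0 < t <= T -> m t <= A * expR (lam * t)) ->
  (forall t, 0 < t <= T -> m t <= A / 2 * expR (lam * t)).
Proof.
have S0 : 0 <= S.
  apply: le_trans (HS (t := 0) _); first exact: Rintegral_ge0.
  by rewrite lexx ltW.
have a20 : 0 < a ^+ 2 / 8 by rewrite divr_gt0// exprn_gt0.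
have VL0 : 0 <= 2 * V * L by rewrite !mulr_ge0// ltW.
(* The collar estimate requires a width of at most a^2 / 8; for a larger [F] the trivial bound S <=
   S / (a^2 / 8) F replaces it. *)
pose C2 := C + S / (a ^+ 2 / 8).
have C20 : 0 <= C2 by rewrite addr_ge0// divr_ge0// ltW.
pose E := expR (2 * V * L * T); have E0 : 0 < E := expR_gt0 _.
(* Chosen so that 4 C2 V k E / lam <= 1 in the estimate [FA]; [E] bounds the growth due to the
   Lipschitz constant. *)
pose lam := 4 * C2 * V * k * E + 1.
have lam0 : 0 < lam by rewrite ltr_wpDl// !mulr_ge0// ltW.
exists lam => // A A0 HA.
(* The flow estimate needs the inflow bound on the closed interval, including time 0. *)
have m0A := outer_mass_initial A0 lam0 HA.
move=> T' /andP[T'0 T'T].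
have J0 : 0 < k * A by rewrite mulr_gt0.
(* Width at time 0, for offset 0, of the front that closes at T' when the inflow is k A e^(lam
   t). *)
pose F := front_scale V L (k * A) lam * (expR (front_rate V L lam * T') - 1).
have rate0 : 0 < front_rate V L lam by rewrite ltr_wpDr.
have scale0 : 0 < front_scale V L (k * A) lam by rewrite divr_gt0// mulr_gt0// mulr_gt0.
have F0 : 0 <= F.
  by rewrite mulr_ge0 ?(ltW scale0)// subr_ge0 -expR0 ler_expR mulr_ge0// ltW.
have FA : C2 * F <= A / 2 * expR (lam * T').
  have h1 : F <= 2 * V * (k * A) / lam * (expR (lam * T') * E).
    apply: ler_pM; rewrite ?(ltW scale0)//.
    - by rewrite subr_ge0 -expR0 ler_expR mulr_ge0// ltW.
    - rewrite ler_wpM2l ?mulr_ge0 ?(ltW V0) ?(ltW k0) ?(ltW A0)//.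
      by rewrite lef_pV2 ?posrE// lerDl.
    - rewrite lerBlDr -[leLHS]addr0 lerD// -expRD ler_expR mulrDl lerD2l.
      by rewrite ler_wpM2l.
  apply: le_trans (ler_wpM2l C20 h1) _.
  have -> : C2 * (2 * V * (k * A) / lam * (expR (lam * T') * E)) =
     (4 * C2 * V * k * E) / lam * (A / 2 * expR (lam * T')).
    by field; rewrite gt_eqF.
  rewrite -[leRHS]mul1r ler_wpM2r ?mulr_ge0 ?expR_ge0 ?divr_ge0 ?(ltW A0)//.
  by rewrite ler_pdivrMr// mul1r lerDl.
have T'I : 0 <= T' <= T by rewrite (ltW T'0).
apply: le_trans FA.
have [F8|F8] := leP (a ^+ 2 / 8) F.
  apply: (@le_trans _ _ S).
    exact: le_trans (outer_mass_le cO (L1_integrable (Hrho T'I))) (HS T'I).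
  apply: (@le_trans _ _ (S / (a ^+ 2 / 8) * F)).
    by rewrite -{1}[S](divfK (lt0r_neq0 a20)) ler_wpM2l// divr_ge0// ltW.
  by rewrite ler_wpM2r// lerDr.
apply: (@le_trans _ _ (C * F)); last by rewrite ler_wpM2r// lerDl divr_ge0// ltW.
have [Cx Cx0 HCx] := @dcutoff_bound R N.
pose Q := V * (Cx * W) * S * T'.
apply: (@front_limit R L W (k * A) Q F C (a ^+ 2 / 8) _
  (fun M => \int[mu]_x (rho T' x * (cutoff M x * \1_(~` Omega) x)))) => //.
- by rewrite /Q !mulr_ge0// ltW.
- move=> o kap M e o0 kap0 ok oJ Fb M1 e0.
  have sub t : 0 <= t <= T' -> 0 <= t <= T.
    by move=> /andP[-> tT]; exact: le_trans tT T'T.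
  have q1 t : 0 <= t <= T' -> L1_range rmax (rho t) by move=> /sub; exact: Hrho.
  have q2 t : 0 <= t <= T' -> \int[mu]_x `|rho t x| <= S by move=> /sub; exact: HS.
  have q3 e' : 0 < e' -> exists2 de, 0 < de & forall t, 0 <= t <= T' -> T' - de <= t ->
      \int[mu]_x `|rho t x - rho T' x| <= e'.
    move=> e'0; have [de de0 Hde] := Hcont T'I e'0.
    exists (de / 2); first by rewrite divr_gt0.
    move=> t tT' tde; apply: Hde; first exact: sub.
    by case/andP: tT' => _ tT'; rewrite distrC ger0_norm ?subr_ge0//; lra.
  have q4 phi : test_function T' phi -> kruzkov_inequality T' v w rho0 rho 0 phi.
    by apply: Hk; rewrite T'0.
  have q5 t : 0 <= t <= T' -> continuous (w t) by move=> /sub; exact: wc.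
  have q6 t x : 0 <= t <= T' -> enorm (w t x) <= W by move=> /sub; exact: wW.
  have q7 t x c : 0 <= t <= T' -> 0 < D x < a -> G c -> enorm (x - c) = D x ->
      dot (w t x) (x - c) <= k * A * expR (lam * t) + L * (a ^+ 2 - D x ^+ 2).
    move=> tT' Dx Gc xc; apply: le_trans (winflow (sub _ tT') Dx Gc xc) _.
    rewrite lerD2r -mulrA ler_pM2l//.
    case/andP: (sub _ tT') => t0 tT; have [->|tn0] := eqVneq t 0.
      by rewrite mulr0 expR0 mulr1.
    by apply: HA; rewrite lt_neqAle eq_sym tn0 t0.
  have FE := (flow_estimate a0 cG G0 cO Hout uniq rmax0 V0 cv vV T'0 W0 L0 J0 lam0
    q1 q2 q3 q4 q5 q6 q7 irho0 rho00 Cx0 HCx o0 kap0 ok oJ Fb M1 e0).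
  apply: le_trans FE _.
  apply: lerD; last first.
    by apply: Hcollar => //; rewrite ltr_wpDl// addr_ge0// ltW.
  rewrite lerD2l /Q le_eqVlt; apply/orP; left; apply/eqP; ring.
- move=> e M0 e0; apply: cutoff_tail => //; first exact: L1_integrable (Hrho T'I).
  exact: measurableC (closed_measurable_rV cO).
Qed.

(** Halving repeatedly from the a priori bound S + 1, positive even if [S] is 0, leaves m <= (S + 1)
    / 2^n e^(lam t) for every n. *)
Lemma outer_mass_vanish t : 0 <= t <= T -> m t <= 0.
Proof.
have [lam lam0 Hlam] := outer_mass_halve.
have S0 : 0 <= S.
  apply: le_trans (HS (t := 0) _); first exact: Rintegral_ge0.
  by rewrite lexx ltW.
have iter n s : 0 < s <= T -> m s <= (S + 1) / 2 ^+ n * expR (lam * s).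
  have S10 : 0 < S + 1 by rewrite ltr_wpDl.
  elim: n s => [|n IH] s sT.
    have sI : 0 <= s <= T by case/andP: sT => /ltW ->.
    apply: le_trans (outer_mass_le cO (L1_integrable (Hrho sI))) _.
    apply: le_trans (HS sI) _; rewrite expr0 divr1 -[leLHS]mulr1.
    apply: ler_pM => //; first by rewrite lerDl.
    by rewrite -expR0 ler_expR mulr_ge0 ?(ltW lam0)//; case/andP: sI.
  rewrite exprSr invfM mulrA; apply: Hlam => //.
  by rewrite divr_gt0// exprn_gt0.
have pos s : 0 < s <= T -> m s <= 0.
  move=> sT; rewrite leNgt; apply/negP => ms.
  pose B := (S + 1) * expR (lam * s) / m s.
  have B0 : 0 <= B by rewrite divr_ge0 ?mulr_ge0 ?expR_ge0 ?addr_ge0// ltW.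
  (* For this n, 2^n > n > B, which contradicts 2^n <= B. *)
  have := iter (Num.truncn B).+1 s sT.
  rewrite mulrAC ler_pdivlMr ?exprn_gt0// mulrC -ler_pdivlMr// -/B leNgt => /negP; apply.
  apply: lt_le_trans (Num.Theory.truncnS_gt _) _.
  by rewrite -natrX ler_nat ltnW// ltn_expl.
move=> /andP[]; rewrite le_eqVlt => /predU1P[<- _|t0 tT]; last by apply: pos; rewrite t0.
apply/ler_addgt0Pr => e e0; rewrite add0r.
apply: (outer_mass_initial e0 ltr01) => s sT; apply: le_trans (pos s sT) _.
by rewrite mulr_ge0 ?expR_ge0// ltW.
Qed.
End decay.

(** * Verification of the hypotheses of the decay argument *)

Theorem proposition3p1 (R : realType) (N : nat) (rmax V : R) (v : R -> R)
    (nu : 'rV[R]_N -> 'rV[R]_N)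
    (Inl : ('rV[R]_N -> R) -> 'rV[R]_N -> 'rV[R]_N) (Omega : set 'rV[R]_N) :
  (1 <= N)%N -> 0 < rmax -> 0 < V ->
  hyp_v rmax V v -> hyp_nu nu -> hyp_I rmax Inl -> hyp_Omega Omega ->
  (forall (x : 'rV[R]_N) (rho : 'rV[R]_N -> R),
     boundary Omega x -> L1_range rmax rho -> spt rho `<=` Omega ->
     0 <= dot (nu x + Inl rho x) (inward_normal Omega x)) ->
  invariant_Cauchy_problem rmax v nu Inl Omega.
Proof.
move=> _ rmax0 V0 [Cv vdec v0 vr] [Cnu nuoo _ _] [CI _ [C_I [CI0 CImono _ _] HCI] [K HK]].
move=> [[U [U0 oU _] OmegaE] Hr] Hn rho0 Lrho0 BVrho0 srho0 rho [_ _ Hw] t0 t00.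
have cO := closed_domain OmegaE.
(* Without boundary Omega is the whole space: a segment from a point of [U] to a point outside the
   interior would meet the boundary. *)
have [bd0|nbd] := pselect (boundary Omega !=set0); last first.
  move=> y _; have [x Ux] := U0.
  have ix : interior Omega x := sub_interior oU OmegaE Ux.
  apply: interior_subset; apply: contrapT => ny.
  by have [s _ bs] := segment_meets_boundary ix ny; apply: nbd; exists (s *: (y - x) + x).
have {Hr} [r [r0 Cd n1]] := Hr bd0.
pose a := r / 2; have a0 : 0 < a by rewrite divr_gt0.
have ar : a < r by rewrite /a; lra.
(* Positive also when [t0] is 0. *)
pose T := t0 + 1; have T0 : 0 < T by rewrite ltr_wpDl.
have [Lrho crho _] := Hw T T0.
have [S HS] := L1_norm_bounded T0 Lrho crho.
have S0 : 0 <= S.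
  apply: le_trans (HS 0 _); first exact: Rintegral_ge0.
  by rewrite lexx ltW.
pose cn := fine (W1p_normv +oo nu).
have nuE : W1p_normv +oo nu = cn%:E.
  rewrite fineK// ge0_fin_numE//; apply: adde_ge0; exact: Lp_norm_ge0.
have cn0 : 0 <= cn by rewrite fine_ge0//; apply: adde_ge0; exact: Lp_norm_ge0.
have cI0 : 0 <= C_I S by exact: CI0.
have oT := @openT 'rV[R]_N.
have nu1 := Ck_on_leq (leqnSn 1) Cnu.
have In1 t : 0 <= t <= T -> Ck_on setT 1 (Inl (rho t)).
  by move=> tT; apply: Ck_on_leq (leqnSn 1) (CI _ (Lrho t tT)).
(* [C_I] is increasing, so the bound [S] on the mass makes the estimate uniform in time. *)
have InW t : 0 <= t <= T -> (W1p_normv +oo (Inl (rho t)) <= (C_I S)%:E)%E.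
  move=> tT; have [H _ _] := HCI _ (Lrho t tT).
  apply: le_trans H _; rewrite Lp_norm1E; last exact: L1_integrable (Lrho t tT).
  by rewrite lee_fin; apply: CImono (HS t tT); exact: Rintegral_ge0.
have nuW : (W1p_normv +oo nu <= cn%:E)%E by rewrite nuE.
pose W := cn + C_I S; have W0 : 0 <= W by exact: addr_ge0.
pose L := W * N%:R * N%:R; have L0 : 0 <= L by rewrite !mulr_ge0.
pose K1 := `|K| + 1; have K10 : 0 < K1 by rewrite ltr_wpDl.
pose w t := velocity nu Inl (rho t).
have wc t : 0 <= t <= T -> continuous (w t).
  move=> tT x; have c1 : continuous nu := Ck_continuous nu1.
  have c2 : continuous (Inl (rho t)) := Ck_continuous (In1 t tT).
  exact: (continuousD (c1 x) (c2 x)).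
have wW t x : 0 <= t <= T -> enorm (w t x) <= W.
  move=> tT; apply: le_trans (enormD _ _) _; apply: lerD.
    by have [H _] := W1p_normv_bounds nu1 nuW.
  by have [H _] := W1p_normv_bounds (In1 t tT) (InW t tT).
have wlip t x y u : 0 <= t <= T -> dot (w t x - w t y) u <= L * (enorm (x - y) * enorm u).
  move=> tT; have -> : w t x - w t y = (nu x - nu y) + (Inl (rho t) x - Inl (rho t) y).
    by rewrite /w /velocity opprD addrACA.
  rewrite dotDl /L /W !mulrDl; apply: lerD; first exact: field_lipschitz.
  by apply: field_lipschitz; [exact: In1|exact: InW].
have normal1 p : boundary Omega p -> enorm (inward_normal Omega p) = 1.
  move=> bp; apply: n1; split; last by rewrite (boundaryE OmegaE) in bp; case: bp.
  by exists p => //; rewrite subrr enorm0.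
(* The sign hypothesis applies to the restriction [f] of [rho t] to Omega, and the Lipschitz
   estimate bounds the difference of the nonlocal terms by K times the mass outside. [K1] replaces
   [K] to be positive. *)
have wn t p : 0 <= t <= T -> boundary Omega p ->
    - (K1 * outer_mass Omega (rho t)) <= dot (w t p) (inward_normal Omega p).
  move=> tT bp; have Lt := Lrho t tT.
  have [Lr sr rE] := restriction_L1_range cO Lt.
  set f := (fun x => rho t x * \1_Omega x) in Lr sr rE.
  have := HK _ _ Lt Lr; rewrite rE => -[H _].
  have c1 := Ck_continuous (CI _ Lt); have c2 := Ck_continuous (CI _ Lr).
  have := normy_sub_le c1 c2 (c := K * outer_mass Omega (rho t)).
  rewrite EFinM => /(_ H p) H'.
  have m0 := outer_mass_ge0 cO Lt.
  have -> : w t p = (nu p + Inl f p) + (Inl (rho t) p - Inl f p).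
    by rewrite /w /velocity -addrA; congr (_ + _); rewrite [RHS]addrC subrK.
  rewrite dotDl; have h1 := Hn p f bp Lr sr.
  have h2 := norm_dot_le (Inl (rho t) p - Inl f p) (inward_normal Omega p).
  rewrite normal1// mulr1 in h2.
  have h3 : K * outer_mass Omega (rho t) <= K1 * outer_mass Omega (rho t).
    by rewrite ler_wpM2r// /K1 (le_trans (ler_norm _))// lerDl.
  rewrite -[leLHS]add0r; apply: lerD => //.
  have := le_trans h2 (le_trans H' h3); rewrite ler_norml => /andP[].
  by [].
pose G := inner_core Omega a.
have cG : closed G := closed_inner_core OmegaE bd0 a0.
have G0 : G !=set0 := inner_core0 oU OmegaE bd0 Cd a0 ar.
have Da x : Omega x -> sdist G x <= a by exact: (core_dist_le oU OmegaE bd0 Cd a0 ar).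
have uniq x c c' : Omega x -> 0 < sdist G x ->
    G c -> enorm (x - c) = sdist G x -> G c' -> enorm (x - c') = sdist G x -> c = c'.
  exact: (core_nearest_unique oU OmegaE bd0 r0 Cd a0 ar).
have Hout x : sdist G x < a -> Omega x.
  move=> xa; apply: contrapT => nO.
  have := core_dist_out oU OmegaE bd0 Cd a0 ar (x := x); rewrite leNgt xa => H.
  by have := H (fun i => nO (interior_subset i)).
have rho00 : {ae lebesgue_rV R N, forall x, 0 <= rho0 x}.
  by have [_ H] := Lrho0; apply: filterS H => x /andP[].
have rho0O := (spt_ae rho0 cO).1 srho0.
have [C C0 HC] := collar_mass_le a0 cG G0 cO Da uniq BVrho0 rho00 rho0O.
have vV s : 0 <= s <= rmax -> 0 <= v s <= V.
  by move=> /andP[s0 sr]; rewrite -vr -v0 !vdec.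
have cv : continuous v := Ck_continuous Cv.
have t0T : 0 <= t0 <= T by rewrite t00 /T lerDl ler01.
apply: (outer_mass_eq0 cO (rmax := rmax)); first exact: Lrho.
have Hk T' : 0 < T' <= T -> forall phi, test_function T' phi ->
    kruzkov_inequality T' v w rho0 rho 0 phi.
  by move=> /andP[T'0 _] phi tphi; have [_ _ H] := Hw T' T'0; exact: H.
have winflow t x c : 0 <= t <= T -> 0 < sdist G x < a -> G c -> enorm (x - c) = sdist G x ->
    dot (w t x) (x - c) <= a * K1 * outer_mass Omega (rho t) + L * (a ^+ 2 - sdist G x ^+ 2).
  move=> tT Dx Gc xc; rewrite -mulrA.
  apply: (core_inflow oU OmegaE bd0 r0 Cd a0 ar L0) => //.
  - by rewrite mulr_ge0 ?(ltW K10)//; exact: outer_mass_ge0 (Lrho t tT).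
  - by move=> *; exact: wlip.
  - by move=> p bp; exact: wn.
have aK0 : 0 < a * K1 by exact: mulr_gt0.
have Hcont := continuous_in_L1_near Lrho crho.
exact: (outer_mass_vanish a0 cG G0 cO Hout uniq rmax0 V0 cv vV T0 W0 L0 aK0 C0 Lrho HS Hcont Hk
  wc wW winflow (L1_integrable Lrho0) rho00 HC t0T).
Qed.
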